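(* Let $N\ge 3$, let $\Omega\subset\mathbb{R}^N$ be a bounded domain, strictly star-shaped with respect to some point, whose boundary is a $C^2$-manifold, and let $0<\alpha<\beta<1$ satisfy $2(1+\alpha)(1+\beta)-N(1-\alpha)(1-\beta)<0$. Let $\lambda^*>0$ be the critical value and $u_{\lambda^*}$ a non-negative flat or compact support ground state of $P(\alpha,\beta,\lambda^* )$, as described in the context. Assume $\lambda>\lambda^*$, $v_0=u_{\lambda^*}$, and let $v$ be the non-negative weak solution of the parabolic problem $PP(\alpha,\beta,\lambda,v_0)$. Let $\theta>0$ satisfy $\theta^{\beta-\alpha}<1/\lambda$. Let $x_0\in\mathbb{R}^N\setminus\operatorname{supp}(v_0)$ and $\rho_0>0$ be such that $B_{\rho_0}(x_0)\subset\mathbb{R}^N\setminus\operatorname{supp}(v_0)$. Then there exist $\widehat t>0$ and a continuous decreasing function $\rho:[0,\widehat t]\to[0,\rho_0]$ such that $\rho(0)=\rho_0$, $\rho(\widehat t)=0$ and $$B_{\rho(t)}(x_0)\subset\mathbb{R}^N\setminus\big(\operatorname{supp}(v(t,\cdot))\cap\Omega_{v,\theta}(t)\big)\qquad\text{for any }t\in[0,\widehat t].$$ In particular, $v(t,x)=0$ for a.e. $x\in B_{\rho(t)}(x_0)$, for any $t\in[0,\widehat t]$.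
   Context: $P(\alpha,\beta,\lambda)$ is the problem $-\Delta u+|u|^{\alpha-1}u=\lambda|u|^{\beta-1}u$ in $\Omega$, $u=0$ on $\partial\Omega$; its weak solutions are the critical points in $H_0^1(\Omega)$ of $E_\lambda(u)=\frac12\int_\Omega|\nabla u|^2dx+\frac{1}{\alpha+1}\int_\Omega|u|^{\alpha+1}dx-\frac{\lambda}{\beta+1}\int_\Omega|u|^{\beta+1}dx$. A ground state is a non-zero weak solution $u$ with $E_\lambda(u)\le E_\lambda(w)$ for every non-zero weak solution $w$. Under the stated hypotheses there is a unique $\lambda^*>0$ such that $P(\alpha,\beta,\lambda)$ has a ground state for every $\lambda\ge\lambda^*$ and no non-zero weak solution for $\lambda<\lambda^*$, and $P(\alpha,\beta,\lambda^* )$ has a non-negative ground state $u_{\lambda^*}\in C^1(\overline\Omega)$ with $\partial u_{\lambda^*}/\partial\nu=0$ on $\partial\Omega$ ($\nu$ the unit outward normal), radially symmetric about a point of $\Omega$, with support the closure of a ball of largest radius contained in $\Omega$. $\Omega$ is strictly star-shaped with respect to $y$ if $(x-y)\cdot\nu(x)>0$ for all $x\in\partial\Omega$. $PP(\alpha,\beta,\lambda,v_0)$ is the parabolic problem $v_t-\Delta v+|v|^{\alpha-1}v=\lambda|v|^{\beta-1}v$ in $(0,+\infty)\times\Omega$, $v=0$ on $(0,+\infty)\times\partial\Omega$, $v(0,x)=v_0(x)$ on $\Omega$; for $v_0\in L^\infty(\Omega)$, $v_0\ge0$, there is a non-negative weak solution $v\in C([0,+\infty),L^2(\Omega))\cap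 L^\infty((0,+\infty)\times\Omega)$. Functions on $\Omega$ are extended by $0$ outside $\Omega$. $\Omega_{v,\theta}(t):=\{x\in\Omega: v(t,x)\le\theta\}$. $B_r(x_0)$ is the open ball of radius $r$ centred at $x_0$ (empty if $r=0$). *)

(* Defs.v *)
From HB Require Import structures.
From mathcomp Require Import all_boot all_order all_algebra.
From mathcomp Require Import all_classical all_reals all_analysis.

Set Implicit Arguments.
Unset Strict Implicit.
Unset Printing Implicit Defensive.

Import Order.TTheory GRing.Theory Num.Theory.
Import numFieldNormedType.Exports.

Local Open Scope classical_set_scope.
Local Open Scope ring_scope.

Definition rV_display : measure_display. Proof. exact: default_measure_display. Qed.

Section measurable_rV.
Context {R : realType} (n : nat).

Let coord (i : 'I_n) (x : 'rV[R]_n) : R := x ord0 i.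

Let rV_set0 : g_sigma_preimage coord set0.
Proof. exact: sigma_algebra0. Qed.

Let rV_setC A : g_sigma_preimage coord A -> g_sigma_preimage coord (~` A).
Proof. exact: sigma_algebraC. Qed.

Let rV_bigcup (F : (set 'rV[R]_n)^nat) :
  (forall i, g_sigma_preimage coord (F i)) ->
  g_sigma_preimage coord (\bigcup_i (F i)).
Proof. exact: sigma_algebra_bigcup. Qed.

(* The sigma-algebra generated by the coordinates, i.e. the Borel one. *)
HB.instance Definition _ := @isMeasurable.Build rV_display
  'rV[R]_n (g_sigma_preimage coord) rV_set0 rV_setC rV_bigcup.

Lemma measurable_coord_rV (i : 'I_n) :
  measurable_fun [set: 'rV[R]_n] (fun x : 'rV[R]_n => x ord0 i).
Proof.
move=> _ Y mY; rewrite setTI; apply: sub_sigma_algebra => /=.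
rewrite -bigcup_seq/=; exists i => /=; first by rewrite mem_index_enum.
by exists Y => //; rewrite setTI.
Qed.

Lemma measurable_fun_rV d (T : measurableType d) (f : T -> 'rV[R]_n) :
  (forall i, measurable_fun setT (fun t => f t ord0 i)) ->
  measurable_fun setT f.
Proof.
move=> mf _; suff H : g_sigma_preimage coord `<=`
    [set A | measurable (setT `&` f @^-1` A)] by move=> Y mY; exact: H.
apply: smallest_sub.
  split => /=; first by rewrite preimage_set0 setI0.
  - move=> A; rewrite !setTI setTD preimage_setC => mA; exact: measurableC.
  - move=> F mF; rewrite preimage_bigcup setI_bigcupr.
    exact: bigcup_measurable.
move=> A; rewrite -bigcup_seq/= => -[i _ [B mB <-]] /=.
rewrite setTI -comp_preimage; exact: mf.
Qed.
End measurable_rV.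

Section lebesgue_rV.
Context {R : realType}.

Definition cons_rV n (p : measurableTypeR R * 'rV[R]_n) : 'rV[R]_n.+1 :=
  row_mx (const_mx p.1 : 'rV[R]_1) p.2 : 'rV[R]_(1 + n).

Definition uncons_rV n (x : 'rV[R]_n.+1) : measurableTypeR R * 'rV[R]_n :=
  (x ord0 ord0, rsubmx (x : 'rV[R]_(1 + n))).

Lemma cons_rVK n : cancel (@cons_rV n) (@uncons_rV n).
Proof.
case=> a y; rewrite /cons_rV /uncons_rV row_mxKr /=; congr pair.
have -> : (ord0 : 'I_n.+1) = lshift n (ord0 : 'I_1) by exact: val_inj.
by rewrite [LHS](@row_mxEl R 1 1 n) mxE.
Qed.

Lemma measurable_cons_rV n : measurable_fun setT (@cons_rV n).
Proof.
apply: measurable_fun_rV => i; rewrite /cons_rV.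
case: (split_ordP (i : 'I_(1 + n))) => j ->.
  rewrite [X in measurable_fun _ X](_ : _ = fst); first exact: measurable_fst.
  by apply/funext => p; rewrite [LHS](@row_mxEl R 1 1 n) mxE.
rewrite [X in measurable_fun _ X](_ : _ =
  fun p : measurableTypeR R * 'rV[R]_n => p.2 ord0 j); last first.
  by apply/funext => p; rewrite [LHS](@row_mxEr R 1 1 n).
apply: (@measurableT_comp _ _ _ _ _ _ (fun y : 'rV[R]_n => y ord0 j)) => //.
exact: measurable_coord_rV.
Qed.

Lemma measurable_uncons_rV n : measurable_fun setT (@uncons_rV n).
Proof.
apply/measurable_fun_pairP; split; first exact: measurable_coord_rV.
apply: measurable_fun_rV => i.
under eq_fun do rewrite /= mxE.
exact: measurable_coord_rV.
Qed.

HB.instance Definition _ n := @isMeasurableFun.Build _ _ _ _ (@cons_rV n)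
  (@measurable_cons_rV n).

Section step.
Variables (n : nat) (m : {sigma_finite_measure set 'rV[R]_n -> \bar R}).

Definition cons_measure : set 'rV[R]_n.+1 -> \bar R :=
  pushforward (lebesgue_measure \x m)%E (@cons_rV n).

Let m0 : cons_measure set0 = 0%E. Proof. exact: measure0. Qed.
Let m_ge0 A : (0 <= cons_measure A)%E. Proof. exact: measure_ge0. Qed.
Let m_sigma_additive : semi_sigma_additive cons_measure.
Proof. exact: measure_semi_sigma_additive. Qed.

HB.instance Definition _ := isMeasure.Build _ _ _ cons_measure
  m0 m_ge0 m_sigma_additive.

Let cons_measure_sigma_finite : sigma_finite setT cons_measure.
Proof.
have /sigma_finiteP[F [TF ndF Foo]] := sigma_finiteT (@lebesgue_measure R).
have /sigma_finiteP[G [TG ndG Goo]] := sigma_finiteT m.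
exists (fun k => @uncons_rV n @^-1` (F k `*` G k)).
  rewrite -preimage_bigcup (_ : \bigcup_k _ = setT) ?preimage_setT//.
  apply/seteqP; split=> // -[x y] _.
  have [i _ Fx] : (\bigcup_k F k) x by rewrite -TF.
  have [j _ Gy] : (\bigcup_k G k) y by rewrite -TG.
  exists (maxn i j) => //; split => /=.
    by move: x Fx; exact/subsetPset/ndF/leq_maxl.
  by move: y Gy; exact/subsetPset/ndG/leq_maxr.
move=> k; have [mF Fk] := Foo k; have [mG Gk] := Goo k; split.
  rewrite -[X in measurable X]setTI; apply: measurable_uncons_rV => //.
  exact: measurableX.
rewrite /cons_measure /pushforward -comp_preimage.
rewrite (_ : _ \o _ = id); last by apply/funext => p /=; rewrite cons_rVK.
by rewrite preimage_id product_measure1E// lte_mul_pinfty// ge0_fin_numE.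
Qed.

HB.instance Definition _ := @Measure_isSigmaFinite.Build _ _ _ cons_measure
  cons_measure_sigma_finite.
End step.

(* [lebesgue_rV n.+1] is the image of [lebesgue_measure \x lebesgue_rV n] under
   [R * R^n ~ R^n.+1]. *)
Fixpoint lebesgue_rV (n : nat) : {sigma_finite_measure set 'rV[R]_n -> \bar R} :=
  match n return {sigma_finite_measure set 'rV[R]_n -> \bar R} with
  | 0 => \d_ (0 : 'rV[R]_0)
  | n'.+1 => @cons_measure n' (lebesgue_rV n')
  end.
End lebesgue_rV.

(* The library norm on ['rV[R]_n] is the sup norm, not the Euclidean one. *)

Section euclidean.
Context {R : realType} {n : nat}.
Implicit Types (x y : 'rV[R]_n) (A : set 'rV[R]_n).

Definition dot x y : R := \sum_i x ord0 i * y ord0 i.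
Definition enorm x : R := Num.sqrt (dot x x).
Definition eball x (r : R) : set 'rV[R]_n := [set y | enorm (y - x) < r].
Definition zero_ext A (f : 'rV[R]_n -> R) : 'rV[R]_n -> R :=
  patch (fun=> 0) A f.
Definition frontier A : set 'rV[R]_n := closure A `\` interior A.
End euclidean.

(* [f] is of class C^k on the open set [U]: in finite dimension it is enough to
   iterate directional derivatives along fixed vectors. *)
Fixpoint Ck {R : realType} {V : normedModType R} (k : nat) (U : set V)
    (f : V -> R) : Prop :=
  (forall x, U x -> {for x, continuous f}) /\
  match k with
  | 0 => True
  | k'.+1 => forall h : V,
      (forall x, U x -> derivable f x h) /\ Ck k' U (fun x => 'D_h f x)
  end.

Definition test_function {R : realType} {V : normedModType R} (U : set V)
    (f : V -> R) : Prop :=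
  [/\ forall k, Ck k setT f,
      compact (closure [set x | f x != 0]) &
      closure [set x | f x != 0] `<=` U].

Definition grad {R : realType} {n : nat} (f : 'rV[R]_n -> R) (x : 'rV[R]_n) :
  'rV[R]_n := \row_i 'D_(delta_mx ord0 i) f x.

Section spacetime.
Context {R : realType} {n : nat}.

Definition dt (phi : R * 'rV[R]_n -> R) (p : R * 'rV[R]_n) : R :=
  'D_(1, 0) phi p.
Definition grad_x (phi : R * 'rV[R]_n -> R) (p : R * 'rV[R]_n) : 'rV[R]_n :=
  \row_i 'D_(0, delta_mx ord0 i) phi p.
End spacetime.

Section domains.
Context {R : realType} {n : nat}.
Implicit Types (Omega U : set 'rV[R]_n) (p nu : 'rV[R]_n).

Definition bounded_domain Omega : Prop :=
  [/\ open Omega, connected Omega, Omega !=set0 & bounded_set Omega].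

(* [g] is a C^2 local defining function of [Omega] near [p]; for [p] on the
   boundary, the boundary is [g = 0] in [U] and [Omega] lies on one side. *)
Definition C2_defining_function Omega p U (g : 'rV[R]_n -> R) : Prop :=
  [/\ open U, U p, Ck 2 U g,
      (forall x, U x -> grad g x != 0) &
      (forall x, U x -> (Omega x <-> g x < 0))].

Definition C2_boundary Omega : Prop :=
  forall p, frontier Omega p ->
  exists U, exists g, C2_defining_function Omega p U g.

Definition unit_outward_normal Omega p nu : Prop :=
  exists U, exists g, C2_defining_function Omega p U g /\
    nu = (enorm (grad g p))^-1 *: grad g p.

Definition strictly_star_shaped Omega (y : 'rV[R]_n) : Prop :=
  forall x nu, frontier Omega x -> unit_outward_normal Omega x nu ->
    0 < dot (x - y) nu.

Definition essential_support (f : 'rV[R]_n -> R) : set 'rV[R]_n :=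
  [set x | forall U, open U -> U x ->
     ~ {ae lebesgue_rV n, forall y, U y -> f y = 0}].

(* [u] is C^1 up to the boundary; [Du] is the continuous extension to the
   closure of the gradient. *)
Definition C1_closure Omega (u : 'rV[R]_n -> R) (Du : 'rV[R]_n -> 'rV[R]_n) :
    Prop :=
  [/\ {within closure Omega, continuous u},
      {within closure Omega, continuous Du} &
      forall x, Omega x ->
        (forall h, derivable u x h) /\ grad u x = Du x].
End domains.

Definition L2 {d} {T : measurableType d} {R : realType}
    (mu : {measure set T -> \bar R}) (D : set T) (f : T -> R) : Prop :=
  measurable_fun D f /\ mu.-integrable D (fun x => (f x ^+ 2)%:E).

Section elliptic.
Context {R : realType} {n : nat}.
Local Notation mu := (@lebesgue_rV R n).
Implicit Types (Omega : set 'rV[R]_n) (u w psi : 'rV[R]_n -> R)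
  (Du Dw Dpsi : 'rV[R]_n -> 'rV[R]_n) (alpha beta lambda : R).

(* [u] is in H^1_0(Omega), the H^1-closure of the test functions, and [Du] is
   its weak gradient (the L^2 limit of the gradients). *)
Definition H10 Omega u Du : Prop :=
  [/\ L2 mu Omega u,
      forall i, L2 mu Omega (fun x => Du x ord0 i) &
      exists phi : nat -> 'rV[R]_n -> R,
      [/\ forall k, test_function Omega (phi k),
          (\int[mu]_(x in Omega) ((phi k x - u x) ^+ 2)%:E)%E @[k --> \oo]
            --> 0%E &
          (\int[mu]_(x in Omega) (enorm (grad (phi k) x - Du x) ^+ 2)%:E)%E
            @[k --> \oo] --> 0%E]].

Definition energy Omega alpha beta lambda u Du : R :=
  2^-1 * \int[mu]_(x in Omega) (enorm (Du x) ^+ 2)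
  + (alpha + 1)^-1 * \int[mu]_(x in Omega) (`|u x| `^ (alpha + 1))
  - lambda / (beta + 1) * \int[mu]_(x in Omega) (`|u x| `^ (beta + 1)).

(* [u] is a critical point of the energy on H^1_0(Omega): its derivative along
   every direction of H^1_0(Omega) vanishes. *)
Definition weak_solution Omega alpha beta lambda u Du : Prop :=
  H10 Omega u Du /\
  forall psi Dpsi, H10 Omega psi Dpsi ->
    is_derive (0 : R) (1 : R)
      (fun s : R => energy Omega alpha beta lambda
         (fun x => u x + s * psi x) (fun x => Du x + s *: Dpsi x))
      (0 : R).

Definition nonzero Omega u : Prop :=
  ~ {ae mu, forall x, Omega x -> u x = 0}.

Definition ground_state Omega alpha beta lambda u Du : Prop :=
  [/\ weak_solution Omega alpha beta lambda u Du, nonzero Omega u &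
      forall w Dw, weak_solution Omega alpha beta lambda w Dw ->
        nonzero Omega w ->
        energy Omega alpha beta lambda u Du
          <= energy Omega alpha beta lambda w Dw].

Definition critical_value Omega alpha beta (lstar : R) : Prop :=
  [/\ 0 < lstar,
      forall lambda, lstar <= lambda ->
        exists u Du, ground_state Omega alpha beta lambda u Du &
      forall lambda, lambda < lstar ->
        ~ exists u Du, weak_solution Omega alpha beta lambda u Du /\
                       nonzero Omega u].

Definition flat_or_compact_support_ground_state Omega alpha beta lambda u :
    Prop :=
  [/\ exists Du, ground_state Omega alpha beta lambda u Du,
      forall x, Omega x -> 0 <= u x,
      exists Du, C1_closure Omega u Du /\
        forall x nu, frontier Omega x -> unit_outward_normal Omega x nu ->
          dot (Du x) nu = 0,
      exists2 y, Omega y & forall x x', Omega x -> Omega x' ->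
        enorm (x - y) = enorm (x' - y) -> u x = u x' &
      exists z r,
      [/\ 0 < r, eball z r `<=` Omega,
          forall z' r', eball z' r' `<=` Omega -> r' <= r &
          essential_support (zero_ext Omega u) = closure (eball z r)]].
End elliptic.

Section parabolic.
Context {R : realType} {n : nat}.
Local Notation mu := (@lebesgue_rV R n).
Local Notation mu1 := (@lebesgue_measure R).
Local Notation mutx := (mu1 \x mu)%E.
Implicit Types (Omega : set 'rV[R]_n) (alpha beta lambda : R)
  (v : R -> 'rV[R]_n -> R) (Dv : R -> 'rV[R]_n -> 'rV[R]_n).

Definition cylinder (I : set R) Omega : set (measurableTypeR R * 'rV[R]_n) :=
  [set p | I p.1 /\ Omega p.2].

(* [v t] is a representative of the class in L^2(Omega) of the solution at
   time [t]; the boundary condition is [v t] in H^1_0(Omega) for almost every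
   [t > 0], with locally square integrable gradient up to [t = 0]. *)
Record parabolic_weak_solution Omega alpha beta lambda
    (v0 : 'rV[R]_n -> R) v : Prop := {
  pws_measurable :
    measurable_fun (cylinder `]0, +oo[ Omega) (fun p => v p.1 p.2) ;
  pws_bounded : exists M : R,
    {ae mutx, forall p, cylinder `]0, +oo[ Omega p -> `|v p.1 p.2| <= M} ;
  pws_L2 : forall t, 0 <= t -> L2 mu Omega (v t) ;
  pws_continuous : forall t, 0 <= t ->
    (\int[mu]_(x in Omega) ((v s x - v t x) ^+ 2)%:E)%E
      @[s --> within `[0, +oo[%classic (nbhs t)] --> 0%E ;
  pws_initial : {ae mu, forall x, Omega x -> v 0 x = v0 x} ;
  pws_equation : exists Dv,
    [/\ forall T : R, 0 < T -> forall i,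
          L2 mutx (cylinder `]0, T[ Omega) (fun p => Dv p.1 p.2 ord0 i),
        {ae mu1, forall t, 0 < t -> H10 Omega (v t) (Dv t)} &
        forall phi : R * 'rV[R]_n -> R,
          test_function (cylinder `]0, +oo[ Omega) phi ->
          \int[mutx]_(p in cylinder `]0, +oo[ Omega)
             (- (v p.1 p.2 * dt phi p) + dot (Dv p.1 p.2) (grad_x phi p)
              + `|v p.1 p.2| `^ (alpha - 1) * v p.1 p.2 * phi p)
          = lambda * \int[mutx]_(p in cylinder `]0, +oo[ Omega)
             (`|v p.1 p.2| `^ (beta - 1) * v p.1 p.2 * phi p)] }.

Definition nonnegative_solution Omega v : Prop :=
  forall t, 0 <= t -> {ae mu, forall x, Omega x -> 0 <= v t x}.

Definition sublevel Omega v (theta t : R) : set 'rV[R]_n :=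
  [set x | Omega x /\ v t x <= theta].
End parabolic.

(* Main.v *)
(** The solution is compared with an explicit barrier. For [s >= 0] the reaction satisfies
    [lambda s^beta - s^alpha <= K s - s^alpha / 2], so [u = e^(-Kt) v] is a subsolution of
    [u_t - Delta u + c u^alpha = 0] for short times. The function
    [W(t,x) = M e^(p/d) E(|x - x0|^2 - r^2 + kappa t)], [E(g) = e^(-p/g)] for [g > 0] and [0]
    otherwise, [r^2 = rho0^2 - d], is a smooth supersolution once [p] is large (depending only on
    the data) and [kappa] is of order [1 / d^2]; it dominates [v0] at [t = 0] because [v0] vanishes
    on the ball of radius [rho0]. Hence [v] vanishes where [W] does, that is on the ball of radius
    [rho] as long as [t <= c (rho0^2 - rho^2)^3].

    The comparison [u <= W] uses no regularity in time of [v]. With [J(s) = s e^(-1/s)] convex and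
    [G = J'], convexity bounds the backward differences of [Phi(t) = int J(u - W)] by
    [int G(u - W) (u(t) - u(t - h))], which the weak formulation expresses through the time averages
    of [Dv] over [(t - h, t)]. Dividing by [h] and letting [h] tend to [0] by Fatou's lemma gives
    [Phi(T) <= Phi(0) = 0]; Fatou applies because [2 |A b| <= A^2 + b^2] and averaging contracts
    the L^2 norm. *)
From HB Require Import structures.
From mathcomp Require Import all_boot all_order all_algebra.
From mathcomp Require Import all_classical all_reals all_analysis.
From mathcomp Require Import measurable_realfun ring lra.
Require Import Defs.

Set Implicit Arguments.
Unset Strict Implicit.
Unset Printing Implicit Defensive.

Import Order.TTheory GRing.Theory Num.Theory.
Import numFieldNormedType.Exports.

Local Open Scope classical_set_scope.
Local Open Scope ring_scope.

(** * Measure theory and calculus on row vectors *)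

(** Two properties of [gG] shape the argument. It is smooth, and it vanishes on the negative
    half-line: as the barrier is non-negative, [gG (c * phi - w)] is a test function whenever [phi]
    is, so the nonlinear test function is reached from the weak formulation by approximating [v t]
    in H^1_0. The barrier has two regimes. Where its level [g] is below [d / 2], it is so small that
    the sublinear absorption dominates its second derivatives; where [g] is at least [d / 2], the
    motion of the level sets at speed [kappa] does. The factor [e^(p/d)] makes the barrier at least
    [M] at level [d], hence initially everywhere outside the ball of radius [rho0]. The factor
    [e^(-Kt)] weakens the absorption, by at most [e^(-K)] up to time 1; this is why only times at
    most 1 are considered. As [d] depends on the target radius, each pair [(rho, t)] has its own
    barrier. Only [p] and the constant relating [rho] and [t] are shared, and the function [rho(t)]
    is built from this relation at the end. *)

Section rV_measure.
Context {R : realType}.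

(** Cubes with rational centre and radius [1 / (k + 1)]. Their indices form a countable type, so
    [pickle] enumerates a base of the topology. This makes open sets measurable for the
    sigma-algebra generated by the coordinates, and local almost-everywhere statements global. *)
Definition rbox n (p : 'rV[rat]_n * nat) : set 'rV[R]_n :=
  [set y | forall i, `|y ord0 i - ratr (p.1 ord0 i)| < p.2.+1%:R^-1].

Lemma open_rVP n (U : set 'rV[R]_n) x : open U -> U x ->
  exists2 e : R, 0 < e & forall y : 'rV[R]_n,
    (forall i, `|y ord0 i - x ord0 i| < e) -> U y.
Proof.
move=> oU Ux; have /nbhs_ballP[e /= e0 eU] := open_nbhs_nbhs (conj oU Ux).
exists e => // y xy; apply: eU; split => // i j.
by rewrite ord1 /ball /= distrC.
Qed.

Lemma rbox_base n (U : set 'rV[R]_n) x : open U -> U x ->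
  exists p, rbox p x /\ rbox p `<=` U.
Proof.
move=> oU Ux; have [e e0 eU] := open_rVP oU Ux.
have e20 : 0 < e / 2 by rewrite divr_gt0.
pose k := Num.truncn (e / 2)^-1.
have ke : k.+1%:R^-1 < e / 2 :> R.
  by rewrite invf_plt ?posrE// truncnS_gt.
have dq (i : 'I_n) : exists q : rat, `|x ord0 i - ratr q| < k.+1%:R^-1.
  have k0 : 0 < k.+1%:R^-1 :> R by rewrite invr_gt0.
  have [] := @dense_rat R (ball (x ord0 i) k.+1%:R^-1).
  - by exists (x ord0 i); exact: ballxx.
  - exact: ball_open.
  by move=> z [xz [q _ qz]]; exists q; rewrite qz.
have [q qP] := choice dq.
exists (\row_i q i, k); split=> [i|y yq]; first by rewrite /= mxE.
apply: eU => i; move: (yq i) (qP i); rewrite /= mxE => yqi qPi.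
rewrite -(subrK (ratr (q i)) (y ord0 i)) -addrA (le_lt_trans (ler_normD _ _))//.
by rewrite [ltRHS](splitr e) ltrD// ?(lt_trans yqi)// distrC (lt_trans qPi).
Qed.

Lemma measurable_rbox n (p : 'rV[rat]_n * nat) : measurable (rbox p).
Proof.
have -> : rbox p = \bigcap_(i in [set: 'I_n])
    ((fun y : 'rV[R]_n => `|y ord0 i - ratr (p.1 ord0 i)|) @^-1` `]-oo, p.2.+1%:R^-1[).
  apply/seteqP; split => [y py i _|y py i] /=; first by rewrite in_itv/=; exact: py.
  by have := py i I; rewrite /= in_itv.
apply: fin_bigcap_measurable => // i _; rewrite -[X in measurable X]setTI.
apply: (_ : measurable_fun _ _) => //.
apply: measurableT_comp => //; apply: measurable_funB => //.
exact: measurable_coord_rV.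
Qed.

Lemma open_measurable_rV n (U : set 'rV[R]_n) : open U -> measurable U.
Proof.
move=> oU; pose F (k : nat) : set 'rV[R]_n :=
  if unpickle k is Some p then (if `[< rbox p `<=` U >] then rbox p else set0) else set0.
have -> : U = \bigcup_k F k.
  apply/seteqP; split => [x Ux|x [k _]]; rewrite /F.
    have [p [px pU]] := rbox_base oU Ux.
    by exists (pickle p) => //; rewrite pickleK; case: asboolP.
  by case: unpickle => [p|//]; case: asboolP => // pU /pU.
apply: bigcup_measurable => k _; rewrite /F; case: unpickle => [p|]; last exact: measurable0.
by case: ifP => _; [exact: measurable_rbox|exact: measurable0].
Qed.

Lemma continuous_measurable_rV n (f : 'rV[R]_n -> R) :
  continuous f -> measurable_fun setT f.
Proof.
move=> /continuousP cf; apply: (measurability _ (RGenOpens.measurableE R)) => //.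
by move=> _ [_ [a [b ->] <-]]; rewrite setTI; apply: open_measurable_rV; exact/cf/interval_open.
Qed.

(** A Lindelof argument: the cubes on which [P] holds almost everywhere cover [A], and there are
    countably many of them. It is meant for the complement of an essential support, which is
    described by neighbourhoods of its points. *)
Lemma ae_local n (A : set 'rV[R]_n) (P : 'rV[R]_n -> Prop) :
  (forall x, A x -> exists U, [/\ open U, U x &
     {ae lebesgue_rV n, forall y, U y -> P y}]) ->
  {ae lebesgue_rV n, forall y, A y -> P y}.
Proof.
move=> AP; pose Q p := {ae lebesgue_rV n, forall y, rbox p y -> P y}.
pose F (k : nat) : set 'rV[R]_n :=
  if unpickle k is Some p then (if `[< Q p >] then [set y | rbox p y /\ ~ P y] else set0) else set0.
have : (lebesgue_rV n).-negligible (\bigcup_k F k).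
  apply: negligible_bigcup => k; rewrite /F; case: unpickle => [p|]; last exact: negligible_set0.
  case: asboolP => [Qp|_]; last exact: negligible_set0.
  by apply: negligibleS Qp => y [py Py] /=; apply/not_implyP.
apply: negligibleS => y /= /not_implyP[Ay nPy].
have [U [oU Uy UP]] := AP _ Ay.
have [p [py pU]] := rbox_base oU Uy.
exists (pickle p) => //; rewrite /F pickleK; case: asboolP => //; apply.
by apply: filterS UP => z Pz /pU.
Qed.

Lemma measurable_cbox n (C : R) :
  measurable [set y : 'rV[R]_n | forall i, `|y ord0 i| <= C].
Proof.
have -> : [set y : 'rV[R]_n | forall i, `|y ord0 i| <= C] = \bigcap_(i in [set: 'I_n])
    ((fun y : 'rV[R]_n => `|y ord0 i|) @^-1` `]-oo, C]).
    apply/seteqP; split => [y py i _|y py i] /=; first by rewrite in_itv/=; exact: py.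
    by have := py i I; rewrite /= in_itv.
  apply: fin_bigcap_measurable => // i _; rewrite -[X in measurable X]setTI.
  apply: (_ : measurable_fun _ _) => //.
  by apply: measurableT_comp => //; exact: measurable_coord_rV.
Qed.

Lemma lebesgue_rV_box n (C : R) :
  (lebesgue_rV n [set y : 'rV[R]_n | forall i, (`|y ord0 i| <= C)%R] < +oo)%E.
Proof.
elim: n => [|n IHn]; first by rewrite /= /dirac /= indicE; case: (_ \in _); rewrite ltry.
rewrite /= /cons_measure /pushforward.
have mbox : measurable [set y : 'rV[R]_n | forall i, `|y ord0 i| <= C] by exact: measurable_cbox.
rewrite (_ : _ @^-1` _ = `[-C, C]%classic `*` [set y : 'rV[R]_n | forall i, `|y ord0 i| <= C]).
  have lC : (@lebesgue_measure R `[(- C)%R, C%R]%classic < +oo)%E.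
    by rewrite lebesgue_measure_itv/=; case: ifP; rewrite -?EFinB ltry.
  rewrite product_measure1E// lte_mul_pinfty//.
  by rewrite ge0_fin_numE//; exact: measure_ge0.
apply/seteqP; split => -[a y] /=.
  move=> ay; split.
    have := ay ord0; rewrite /cons_rV.
    have -> : (ord0 : 'I_n.+1) = lshift n (ord0 : 'I_1) by exact: val_inj.
    by rewrite (@row_mxEl R 1 1 n) mxE in_itv/= ler_norml.
  move=> i; have := ay (rshift 1 i).
  by rewrite /cons_rV (@row_mxEr R 1 1 n).
move=> [aC yC] i; rewrite /cons_rV.
case: (split_ordP (i : 'I_(1 + n))) => j ->.
  by move: aC; rewrite (@row_mxEl R 1 1 n) mxE/= in_itv/= ler_norml.
by rewrite (@row_mxEr R 1 1 n).
Qed.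

Lemma ler_coord_rV n (x : 'rV[R]_n) i : `|x ord0 i| <= `|x|.
Proof.
rewrite {2}/Num.norm /= mx_normrE; apply: le_trans (le_bigmax _ _ (ord0, i)).
by [].
Qed.

Lemma bounded_setP_rV n (A : set 'rV[R]_n) : bounded_set A ->
  exists C : R, forall x, A x -> `|x| <= C.
Proof.
move=> [M [_ AM]]; exists (M + 1) => x; apply: AM; by rewrite ltrDl.
Qed.

Lemma bounded_lebesgue_rV n (A : set 'rV[R]_n) : measurable A -> bounded_set A ->
  (lebesgue_rV n A < +oo)%E.
Proof.
move=> mA /bounded_setP_rV[C AC]; apply: le_lt_trans (lebesgue_rV_box n C).
apply: le_measure; rewrite ?inE//; first exact: measurable_cbox.
by move=> x /AC xC i; exact: le_trans (ler_coord_rV _ _) xC.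
Qed.
End rV_measure.

(** * Calculus of smooth functions *)

Section smooth.
Context {R : realType}.

Definition smooth {V : normedModType R} (f : V -> R) := forall k, Ck k setT f.

Lemma CkS {V : normedModType R} k (U : set V) f : Ck k.+1 U f -> Ck k U f.
Proof.
elim: k f => [|k IHk] f [cf H]; first by split.
by split => // h; have [df Hf] := H h; split => //; exact: IHk.
Qed.

Lemma smoothP {V : normedModType R} (f : V -> R) :
  smooth f -> [/\ continuous f, forall x h, derivable f x h &
    forall h, smooth (fun x => 'D_h f x)].
Proof.
move=> sf; split => [x|x h|h k].
- by have [cf _] := sf 0%N; exact: cf.
- by have [_ /(_ h)[df _]] := sf 1%N; exact: df.
- by have [_ /(_ h)[_]] := sf k.+1.
Qed.

Lemma Ck_cst {V : normedModType R} k (c : R) : Ck k [set: V] (fun=> c).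
Proof.
elim: k c => [|k IHk] c; split => //; try by move=> x _; exact: cvg_cst.
move=> h; split => [x _|]; first exact: derivable_cst.
rewrite (_ : 'D_h (fun=> c) = fun=> 0 : R) //.
by apply/funext => x; exact: derive_cst.
Qed.

Lemma CkD {V : normedModType R} k (f g : V -> R) :
  Ck k setT f -> Ck k setT g -> Ck k setT (fun x => f x + g x).
Proof.
elim: k f g => [|k IHk] f g [cf Hf] [cg Hg]; split => //;
  try by move=> x _; apply: continuousD; [exact: cf|exact: cg].
move=> h; have [df Df] := Hf h; have [dg Dg] := Hg h.
split => [x _|]; first by apply: derivableD; [exact: df|exact: dg].
rewrite (_ : (fun x => _) = fun x => 'D_h f x + 'D_h g x); first exact: IHk.
by apply/funext => x; apply: deriveD; [exact: df|exact: dg].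
Qed.

Lemma CkM {V : normedModType R} k (f g : V -> R) :
  Ck k setT f -> Ck k setT g -> Ck k setT (fun x => f x * g x).
Proof.
elim: k f g => [|k IHk] f g Hf Hg.
  case: Hf Hg => [cf _] [cg _]; split => //.
  by move=> x _; apply: continuousM; [exact: cf|exact: cg].
have Kf := CkS Hf; have Kg := CkS Hg.
case: Hf Hg => [cf Hf] [cg Hg]; split.
  by move=> x _; apply: continuousM; [exact: cf|exact: cg].
move=> h; have [df Df] := Hf h; have [dg Dg] := Hg h.
split => [x _|]; first by apply: derivableM; [exact: df|exact: dg].
rewrite (_ : (fun x => _) = fun x => f x * 'D_h g x + g x * 'D_h f x).
  by apply: CkD; apply: IHk.
by apply/funext => x; apply: deriveM; [exact: df|exact: dg].
Qed.

(** Directional derivatives become derivatives of functions of one real variable, so the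
    one-variable chain rule and slicing by coordinates apply without any total differentiability. *)
Lemma is_derive_line {V : normedModType R} (F : V -> R) x h d :
  is_derive x h F d <-> is_derive (0 : R) 1 (fun t : R => F (t *: h + x)) d.
Proof.
suff E : (fun t : R => t^-1 *: ((F \o shift x) (t *: h) - F x)) =
    (fun t : R => t^-1 *: (((fun t : R => F (t *: h + x)) \o shift 0) (t *: (1:R)) - F (0 *: h + x))).
  split => -[Hd Hv]; split; move: Hd Hv; rewrite /derivable /derive /= E //.
by apply/funext => t /=; rewrite scale0r !add0r addr0 scaler1.
Qed.

Lemma is_derive_comp {V : normedModType R} (G : R -> R) (F : V -> R) x h a b :
  is_derive (F x) 1 G a -> is_derive x h F b ->
  is_derive x h (fun y => G (F y)) (a * b).
Proof.
move=> HG /is_derive_line HF; apply/is_derive_line.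
apply: (@is_derive1_comp _ G (fun t => F (t *: h + x))) => //.
by rewrite scale0r add0r.
Qed.

(** The outer function comes with the whole sequence of its derivatives: differentiating [Gs j]
    after [F] produces [Gs j.+1] after [F], so the induction on [k] has to hold for all [j] at
    once. *)
Lemma Ck_comp {V : normedModType R} (Gs : nat -> R -> R) k (F : V -> R) :
  (forall j (x : R), is_derive x 1 (Gs j) (Gs j.+1 x)) ->
  Ck k setT F -> forall j, Ck k setT (fun x => Gs j (F x)).
Proof.
move=> dG; have cG j : continuous (Gs j).
  move=> x; apply: differentiable_continuous; apply/derivable1_diffP.
  by have [] := dG j x.
elim: k F => [|k IHk] F HF j.
  case: HF => cF _; split => // x _.
  by apply: (@continuous_comp _ _ _ F (Gs j)); [exact: cF|exact: cG].
have KF := CkS HF; case: HF => cF HF; split.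
  by move=> x _; apply: (@continuous_comp _ _ _ F (Gs j)); [exact: cF|exact: cG].
move=> h; have [dF DF] := HF h.
have D x : is_derive x h (fun y => Gs j (F y)) (Gs j.+1 (F x) * 'D_h F x).
  apply: is_derive_comp (dG j _) _; apply: DeriveDef; last by [].
  exact: dF.
split => [x _|]; first by have [] := D x.
rewrite (_ : (fun x => _) = fun x => Gs j.+1 (F x) * 'D_h F x).
  by apply: CkM => //; exact: IHk.
by apply/funext => x; have [] := D x.
Qed.

Lemma Ck_fst {V W : normedModType R} k (f : V -> R) :
  Ck k setT f -> Ck k [set: V * W] (fun p => f p.1).
Proof.
elim: k f => [|k IHk] f [cf Hf]; split => //;
  try by move=> p _; apply: (@continuous_comp _ _ _ fst f); [exact: cvg_fst|exact: cf].
move=> h; have [df Df] := Hf h.1; split => [p _|]; first exact: df.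
exact: IHk Df.
Qed.

Lemma Ck_snd {V W : normedModType R} k (f : W -> R) :
  Ck k setT f -> Ck k [set: V * W] (fun p => f p.2).
Proof.
elim: k f => [|k IHk] f [cf Hf]; split => //;
  try by move=> p _; apply: (@continuous_comp _ _ _ snd f); [exact: cvg_snd|exact: cf].
move=> h; have [df Df] := Hf h.2; split => [p _|]; first exact: df.
exact: IHk Df.
Qed.

Lemma is_derive_coord n (x h : 'rV[R]_n) i :
  is_derive x h (fun y : 'rV[R]_n => y ord0 i) (h ord0 i).
Proof.
apply/is_derive_line; rewrite (_ : (fun t => _) = fun t : R => t * h ord0 i + x ord0 i).
  by apply: is_derive_eq; rewrite /GRing.scale/=; ring.
by apply/funext => t; rewrite !mxE.
Qed.

Lemma Ck_coord n k i : Ck k setT (fun y : 'rV[R]_n => y ord0 i).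
Proof.
case: k => [|k]; split => //; try by move=> x _; exact: coord_continuous.
move=> h; split => [x _|]; first by have [] := is_derive_coord x h i.
rewrite (_ : (fun x => _) = fun=> h ord0 i); first exact: Ck_cst.
by apply/funext => x; have [_] := is_derive_coord x h i.
Qed.

Lemma Ck_sum {V : normedModType R} k (I : Type) (s : seq I) (f : I -> V -> R) :
  (forall i, Ck k setT (f i)) -> Ck k setT (fun x => \sum_(i <- s) f i x).
Proof.
move=> Hf; elim: s => [|i s IHs].
  rewrite (_ : (fun x => _) = fun=> 0); first exact: Ck_cst.
  by apply/funext => x; rewrite big_nil.
rewrite (_ : (fun x => _) = fun x => f i x + \sum_(i <- s) f i x); first exact: CkD.
by apply/funext => x; rewrite big_cons.
Qed.

End smooth.

(** * Flat functions [P(1/x) e^(-p/x)] *)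

Section flat.
Context {R : realType}.
Implicit Types (p x : R) (P : {poly R}).

Lemma is_derive_horner P x : is_derive x 1 (fun y => P.[y]) P^`().[x].
Proof.
elim/poly_ind: P => [|P c IHP].
  rewrite (_ : (fun y => _) = cst 0); first by rewrite deriv0 horner0; exact: is_derive_cst.
  by apply/funext => y; rewrite horner0.
rewrite (_ : (fun y => _) = (fun y => P.[y]) * id + cst c).
  apply: is_derive_eq; rewrite derivD derivM derivC derivX !hornerE /=.
  by rewrite /GRing.scale /=; ring.
by apply/funext => y; rewrite !hornerE /= !fctE.
Qed.

(** Take the [n]-th power of [x / n <= 1 + x / n <= expR (x / n)]. *)
Lemma exprn_le_expR (n : nat) x : 0 <= x -> x ^+ n <= n%:R ^+ n * expR x.
Proof.
case: n => [|n] x0; first by rewrite !expr0 mul1r -expR0 ler_expR.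
have -> : expR x = expR (x / n.+1%:R) ^+ n.+1.
  by rewrite -expRM_natl mulrCA divff ?mulr1// pnatr_eq0.
rewrite -exprMn lerXn2r ?nnegrE ?mulr_ge0 ?expR_ge0//.
rewrite -ler_pdivrMl ?ltr0n// mulrC (le_trans _ (expR_ge1Dx _))//.
by rewrite lerDr.
Qed.

Lemma poly_expR_bounded p P : 0 < p ->
  exists2 C, 0 <= C & forall y, 0 <= y -> `|P.[y]| * expR (- (p * y)) <= C.
Proof.
(* [exprn_le_expR] at [p * y] gives [y ^+ i * expR (- (p * y)) <= (i / p) ^+ i] for each
   monomial. *)
move=> p0; exists (\sum_(i < size P) `|P`_i| * (i%:R / p) ^+ i).
  by apply: sumr_ge0 => i _; rewrite mulr_ge0// exprn_ge0// divr_ge0// ltW.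
move=> y y0; rewrite horner_coef (le_trans (ler_wpM2r _ (ler_norm_sum _ _ _))) ?expR_ge0//.
rewrite mulr_suml ler_sum// => i _; rewrite normrM -mulrA ler_wpM2l//.
rewrite ger0_norm ?exprn_ge0// expRN ler_pdivrMr ?expR_gt0//.
have := exprn_le_expR i (mulr_ge0 (ltW p0) y0).
by rewrite exprMn expr_div_n mulrAC ler_pdivlMr ?exprn_gt0// mulrC.
Qed.

(** The family is stable under differentiation, which acts on the polynomial alone. One smoothness
    proof thus serves the time cutoffs ([P = 1]), the derivative [gG] of the convex function
    ([P = 1 + 'X]) and the barrier ([P = 1]). *)
Definition fexp p P x := if 0 < x then P.[x^-1] * expR (- (p / x)) else 0.

(* [y^2 (p P(y) - P'(y)) e^(-py)] with [y = 1/x] is the [x]-derivative of [P(y) e^(-py)]. *)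
Definition fexp_next p P : {poly R} := 'X^2 * (p%:P * P - P^`()).

Lemma fexp_bounded p P : 0 < p -> exists2 C, 0 <= C & forall x, `|fexp p P x| <= C.
Proof.
move=> p0; have [C C0 CP] := poly_expR_bounded P p0; exists C => // x.
rewrite /fexp; case: ifPn => x0; last by rewrite normr0.
by rewrite normrM (ger0_norm (expR_ge0 _)) CP// invr_ge0 ltW.
Qed.

(** An extra factor ['X] in the polynomial is traded for a factor [x] in front: this measures the
    flatness at 0. *)
Lemma fexpMX p P x : fexp p P x = x * fexp p (P * 'X) x.
Proof.
rewrite /fexp; case: ifPn => x0; last by rewrite mulr0.
by rewrite !hornerE /=; field; rewrite gt_eqF.
Qed.

Lemma fexp_le0 p P x : x <= 0 -> fexp p P x = 0.
Proof. by rewrite /fexp => x0; rewrite ltNge x0. Qed.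

Lemma fexp_gt0 p P x : 0 < x -> fexp p P x = P.[x^-1] * expR (- (p / x)).
Proof. by rewrite /fexp => ->. Qed.

Lemma cvg_is_derive (f : R -> R) x d :
  (h^-1 *: (f (h + x) - f x) @[h --> 0^'] --> d) -> is_derive x 1 f d.
Proof.
move=> H.
have E : (fun h : R => h^-1 *: ((f \o shift x) (h *: (1 : R)) - f x)) =
  (fun h : R => h^-1 *: (f (h + x) - f x)).
  by apply/funext => h; rewrite /= scaler1.
apply: DeriveDef; first by rewrite /derivable E; apply/cvg_ex; exists d.
by rewrite /derive E; exact: cvg_lim.
Qed.

Lemma near_eq_is_deriveR (f g : R -> R) (x d : R) :
  (\forall y \near x, f y = g y) -> is_derive x 1 f d -> is_derive x 1 g d.
Proof. exact: near_eq_is_derive. Qed.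

Lemma is_derive_fexp_lt0 p P x : x < 0 -> is_derive x 1 (fexp p P) 0.
Proof.
move=> x0; apply: (@near_eq_is_deriveR (fun=> 0 : R)).
by apply: filterS (lt_nbhsl x0) => y /ltW y0; rewrite fexp_le0.
Qed.

Lemma is_derive_fexp_gt0 p P x : 0 < x ->
  is_derive x 1 (fexp p P) (fexp p (fexp_next p P) x).
Proof.
move=> x0; rewrite (fexp_gt0 _ _ x0).
apply: (@near_eq_is_deriveR (fun y => P.[y^-1] * expR (- (p * y^-1)))).
  by apply: filterS (lt_nbhsr x0) => y y0; rewrite fexp_gt0.
have dV : is_derive x 1 (fun y : R => y^-1) (- x ^- 2).
  have -> : - x ^- 2 = - x ^- 2 *: (1 : R) by rewrite /GRing.scale /= mulr1.
  by apply: (@is_deriveV _ id); rewrite gt_eqF.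
have dP := @is_derive1_comp _ (fun y => P.[y]) (fun y => y^-1) x _ _ (is_derive_horner P _) dV.
have dN : is_derive x 1 (fun y : R => - (p * y^-1)) (p * x ^- 2).
  rewrite (_ : (fun y => _) = (- p) *: (fun y : R => y^-1)).
    by apply: is_derive_eq; rewrite /GRing.scale/= mulrNN.
  by apply/funext => y; rewrite -mulNr.
have dE := @is_derive1_comp _ expR _ x _ _ (is_derive_expR _) dN.
have dPE := is_deriveM dP dE.
apply: is_derive_eq.
by rewrite /fexp_next !hornerE /= /GRing.scale/= exprVn; ring.
Qed.

Lemma is_derive_fexp p P x : 0 < p ->
  is_derive x 1 (fexp p P) (fexp p (fexp_next p P) x).
Proof.
move=> p0; have [x0|x0|->] := ltgtP x 0.
- rewrite (fexp_le0 _ _ (ltW x0)); exact: is_derive_fexp_lt0.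
- exact: is_derive_fexp_gt0.
- rewrite fexp_le0//; apply: cvg_is_derive.
  (* Two uses of [fexpMX] write [fexp p P h] as [h * h] times a bounded function, so the difference
     quotient at 0 is [O(h)]. *)
  have [C C0 CP] := fexp_bounded (P * 'X * 'X) p0.
  have H : (fun h : R => h^-1 *: (fexp p P (h + 0) - fexp p P 0)) =
      (fun h : R => h^-1 * (h * (h * fexp p (P * 'X * 'X) h))).
    apply/funext => h; rewrite /GRing.scale /= addr0 (fexp_le0 _ _ (lexx 0)) subr0.
    by rewrite fexpMX [in LHS]fexpMX.
  rewrite H; apply/cvgrPdist_le => e e0.
  near=> h.
  have h0 : h != 0 by near: h; exact: nbhs_dnbhs_neq.
  rewrite sub0r normrN mulKf// normrM.
  apply: (@le_trans _ _ (`|h| * (C + 1))).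
    by rewrite ler_wpM2l// (le_trans (CP h))// lerDl.
  rewrite -ler_pdivlMr ?ltr_wpDl//.
  near: h; apply: dnbhs0_le; rewrite divr_gt0// ltr_wpDl//.
Unshelve. all: by end_near.
Qed.
End flat.

(** * Integrals of compactly supported partial derivatives *)

Section rV_calculus.
Context {R : realType}.

Lemma continuous_rVP n (T : topologicalType) (f : T -> 'rV[R]_n) :
  (forall i, continuous (fun t => f t ord0 i)) -> continuous f.
Proof.
move=> cf t; apply/cvg_ballP => e e0.
have : \forall s \near t, forall i : 'I_n, ball (f t ord0 i) e (f s ord0 i).
  apply: filter_forall => i.
  by move/cvg_ballP: (cf i t) => /(_ e e0).
by apply: filterS => s H; split => // i j; rewrite ord1; exact: H.
Qed.

Lemma cons_rV0 n (p : measurableTypeR R * 'rV[R]_n) : cons_rV p ord0 ord0 = p.1.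
Proof.
rewrite /cons_rV; have -> : (ord0 : 'I_n.+1) = lshift n (ord0 : 'I_1) by exact: val_inj.
by rewrite (@row_mxEl R 1 1 n) mxE.
Qed.

Lemma cons_rV_lift n (p : measurableTypeR R * 'rV[R]_n) j :
  cons_rV p ord0 (lift ord0 j) = p.2 ord0 j.
Proof.
rewrite /cons_rV; have -> : lift ord0 j = rshift 1 j :> 'I_n.+1 by exact: val_inj.
by rewrite (@row_mxEr R 1 1 n).
Qed.

Lemma ord_lift0P n (i : 'I_n.+1) : i = ord0 \/ exists j : 'I_n, i = lift ord0 j.
Proof. by case: (unliftP ord0 i) => [j|] ->; [right; exists j|left]. Qed.

Lemma continuous_cons_rVl n (y : 'rV[R]_n) :
  continuous (fun a : R => cons_rV ((a : measurableTypeR R), y)).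
Proof.
apply: continuous_rVP => i; case: (ord_lift0P i) => [->|[j ->]].
  by under eq_fun do rewrite cons_rV0; move=> x; exact: cvg_id.
by under eq_fun do rewrite cons_rV_lift; move=> x; exact: cst_continuous.
Qed.

Lemma continuous_cons_rVr n (a : R) :
  continuous (fun y : 'rV[R]_n => cons_rV ((a : measurableTypeR R), y)).
Proof.
apply: continuous_rVP => i; case: (ord_lift0P i) => [->|[j ->]].
  by under eq_fun do rewrite cons_rV0; move=> x; exact: cst_continuous.
by under eq_fun do rewrite cons_rV_lift; move=> x; exact: coord_continuous.
Qed.

Lemma compact_cbox n (C : R) : compact [set y : 'rV[R]_n | forall i, `|y ord0 i| <= C].
Proof.
rewrite (_ : [set _ | _] = [set y : 'rV[R]_n | forall i, `[- C, C]%classic (y ord0 i)]).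
  by apply: (@rV_compact R n (fun=> `[- C, C]%classic)) => i; exact: segment_compact.
by apply/seteqP; split => y /= yC i; move: (yC i); rewrite /= in_itv/= ler_norml.
Qed.

Lemma compact_bounded_fun (T : topologicalType) (A : set T) (f : T -> R) :
  {within A, continuous f} -> compact A -> exists2 M, 0 <= M & forall x, A x -> `|f x| <= M.
Proof.
move=> cf cA; have := compact_bounded (continuous_compact cf cA).
move=> [M [_ AM]]; exists (Num.max (M + 1) 0) => [|x Ax]; first by rewrite le_max lexx orbT.
by apply: (AM (Num.max (M + 1) 0)); [rewrite lt_max ltrDl ltr01|exists x].
Qed.

Lemma continuous_bounded_rV n (f : 'rV[R]_n -> R) C : continuous f ->
  exists2 M, 0 <= M & forall x : 'rV[R]_n, (forall i, `|x ord0 i| <= C) -> `|f x| <= M.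
Proof.
move=> cf; apply: (@compact_bounded_fun _ [set x : 'rV[R]_n | forall i, `|x ord0 i| <= C]).
  exact: continuous_subspaceT.
exact: compact_cbox.
Qed.

Lemma integrable_compact_support n (f : 'rV[R]_n -> R) C : continuous f ->
  (forall x : 'rV[R]_n, (exists i, C < `|x ord0 i|) -> f x = 0) ->
  (lebesgue_rV n).-integrable setT (EFin \o f).
Proof.
move=> cf f0; pose A := [set x : 'rV[R]_n | forall i, `|x ord0 i| <= C].
have mA : measurable A by exact: measurable_cbox.
have [M M0 fM] := continuous_bounded_rV C cf.
have Af : f = f \_ A.
  apply/funext => x; rewrite patchE; case: ifPn => //; rewrite notin_setE /A /= => nAx.
  by apply: f0; move/existsNP: nAx => [i] /negP; rewrite -ltNge; exists i.
rewrite Af (_ : EFin \o _ = (EFin \o f) \_ A); last by rewrite restrict_EFin.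
apply/(integrable_mkcond _ mA).1.
apply: measurable_bounded_integrable => //; first exact: lebesgue_rV_box.
  by apply: measurable_funS (continuous_measurable_rV cf).
exists M; split; first exact: num_real.
by move=> m Mm x /fM/le_trans; apply; exact: ltW.
Qed.

Lemma integral_derive_itv (g g' : R -> R) C :
  (forall x : R, is_derive x 1 g (g' x)) -> continuous g' ->
  (forall x, C < `|x| -> g x = 0) -> (forall x, C < `|x| -> g' x = 0) ->
  (\int[lebesgue_measure]_x (g' x)%:E = 0)%E.
Proof.
(* [D] must exceed [C] strictly, as [g] is only known to vanish beyond [C]; the absolute value keeps
   the interval non-degenerate when [C] is negative. *)
move=> dg cg' g0 g'0; pose D := `|C| + 1.
have CD : C < D by rewrite /D ltr_pwDr// ler_norm.
have D0 : 0 < D by rewrite /D ltr_wpDl.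
have cg : continuous g.
  by move=> x; apply/differentiable_continuous/derivable1_diffP; have [] := dg x.
have -> : (\int[lebesgue_measure]_x (g' x)%:E =
    \int[lebesgue_measure]_(x in `[(- D)%R, D]) (g' x)%:E)%E.
  rewrite [RHS]integral_mkcond; apply: eq_integral => x _.
  rewrite patchE; case: ifPn => //; rewrite notin_setE /= in_itv /= -ler_norml => /negP.
  by rewrite -ltNge => Dx; rewrite g'0// (lt_trans CD).
rewrite (@continuous_FTC2 _ g' g).
- by rewrite !g0 ?subee// ?normrN gtr0_norm.
- by rewrite -subr_gt0 opprK addr_gt0.
- exact: continuous_subspaceT.
- split => [x _||]; first by have [] := dg x.
  + exact/cvg_at_right_filter/cg.
  + exact/cvg_at_left_filter/cg.
- by move=> x _; rewrite derive1E; have [] := dg x.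
Qed.

Lemma cons_rV_line0 n (a t : R) (y : 'rV[R]_n) :
  t *: delta_mx ord0 ord0 + cons_rV ((a : measurableTypeR R), y) =
  cons_rV ((t *: (1 : R) + a : measurableTypeR R), y).
Proof.
apply/rowP => k; rewrite [LHS]mxE [X in X + _]mxE [delta_mx _ _ _ _]mxE.
case: (ord_lift0P k) => [->|[l ->]]; first by rewrite !cons_rV0 eqxx.
by rewrite !cons_rV_lift /= mulr0 add0r.
Qed.

Lemma cons_rV_linel n (a t : R) (y : 'rV[R]_n) j :
  t *: delta_mx ord0 (lift ord0 j) + cons_rV ((a : measurableTypeR R), y) =
  cons_rV ((a : measurableTypeR R), t *: delta_mx ord0 j + y).
Proof.
apply/rowP => k; rewrite [LHS]mxE [X in X + _]mxE [delta_mx _ _ _ _]mxE.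
case: (ord_lift0P k) => [->|[l ->]]; first by rewrite !cons_rV0 /= mulr0 add0r.
by rewrite !cons_rV_lift /= !mxE eqxx /= (inj_eq lift_inj).
Qed.

Lemma integrable_cons_rV n (f : 'rV[R]_n.+1 -> R) :
  (lebesgue_rV n.+1).-integrable setT (EFin \o f) ->
  ((@lebesgue_measure R) \x lebesgue_rV n)%E.-integrable setT
    ((EFin \o f) \o @cons_rV R n).
Proof.
move=> /integrableP[mf fi]; have mcons := @measurable_cons_rV R n.
apply/integrableP; split; first exact: (measurableT_comp mf mcons).
move: fi; rewrite [X in (X < _)%E -> _](_ : _ =
  \int[pushforward (lebesgue_measure \x lebesgue_rV n)%E (@cons_rV R n)]_x `|(f x)%:E|)%E //.
rewrite ge0_integral_pushforward//.
exact: measurableT_comp.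
Qed.

Lemma integral_cons_rV n (f : 'rV[R]_n.+1 -> R) :
  (lebesgue_rV n.+1).-integrable setT (EFin \o f) ->
  (\int[lebesgue_rV n.+1]_x (f x)%:E =
   \int[(@lebesgue_measure R) \x lebesgue_rV n]_p (f (cons_rV p))%:E)%E.
Proof.
move=> fi; have fic := integrable_cons_rV fi.
rewrite [LHS](_ : _ =
  \int[pushforward (lebesgue_measure \x lebesgue_rV n)%E (@cons_rV R n)]_x (f x)%:E)%E //.
by rewrite integral_pushforward//; case/integrableP: fi.
Qed.

(** Induction along the recursive definition of the measure. If the differentiated coordinate is the
    first one, it is integrated first and the fundamental theorem applies; otherwise the first
    coordinate is frozen and the slices are covered by the induction hypothesis. *)
Lemma integral_partial0 n (F F' : 'rV[R]_n -> R) i C :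
  (forall x, is_derive x (delta_mx ord0 i) F (F' x)) -> continuous F' ->
  (forall x : 'rV[R]_n, (exists j, C < `|x ord0 j|) -> F x = 0) ->
  (forall x : 'rV[R]_n, (exists j, C < `|x ord0 j|) -> F' x = 0) ->
  (\int[lebesgue_rV n]_x (F' x)%:E = 0)%E.
Proof.
elim: n F F' i => [|n IHn] F F' i dF cF' F0 F'0; first by case: i dF.
have iF' := integrable_compact_support cF' F'0.
rewrite integral_cons_rV//.
have iF'c := integrable_cons_rV iF'.
case: (ord_lift0P i) => [i0|[j ij]].
  rewrite -(integral21_prod_meas1 iF'c); apply: integral0_eq => y _.
  rewrite /fubini_G /=.
  apply: (@integral_derive_itv (fun a : R => F (cons_rV ((a : measurableTypeR R), y)))
    (fun a : R => F' (cons_rV ((a : measurableTypeR R), y))) C).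
  - move=> a; apply/is_derive_line => /=.
    have /is_derive_line := dF (cons_rV ((a : measurableTypeR R), y)).
    by rewrite i0; under eq_fun do rewrite cons_rV_line0.
  - move=> a; apply: (@continuous_comp _ _ _ (fun a : R => cons_rV ((a : measurableTypeR R), y)) F').
      exact: continuous_cons_rVl.
    exact: cF'.
  - by move=> a Ca; apply: F0; exists ord0; rewrite cons_rV0.
  - by move=> a Ca; apply: F'0; exists ord0; rewrite cons_rV0.
rewrite -(integral12_prod_meas1 iF'c); apply: integral0_eq => a _.
rewrite /fubini_F /=.
apply: (IHn (fun y => F (cons_rV (a, y))) (fun y => F' (cons_rV (a, y))) j) => [y|y|y [k]|y [k]].
- apply/is_derive_line => /=.
  have /is_derive_line := dF (cons_rV (a, y)).
  by rewrite ij; under eq_fun do rewrite cons_rV_linel.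
- apply: (@continuous_comp _ _ _ (fun y => cons_rV (a, y)) F').
    exact: continuous_cons_rVr.
  exact: cF'.
- by move=> Ck; apply: F0; exists (lift ord0 k); rewrite cons_rV_lift.
- by move=> Ck; apply: F'0; exists (lift ord0 k); rewrite cons_rV_lift.
Qed.
End rV_calculus.

(** * Real-valued integrals and square-integrable functions *)

Section L2_theory.
Context d (T : measurableType d) (R : realType) (m : {measure set T -> \bar R}).
Variable D : set T.
Hypothesis mD : measurable D.
Implicit Types f g : T -> R.

Lemma le_integrableR f g : measurable_fun D f -> (forall x, D x -> `|f x| <= g x) ->
  m.-integrable D (EFin \o g) -> m.-integrable D (EFin \o f).
Proof.
move=> mf fg; apply: le_integrable => //; first exact/measurable_EFinP.
move=> x Dx /=; rewrite lee_fin (le_trans (fg x Dx))//; exact: ler_norm.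
Qed.

Lemma integrableRZ (k : R) f : m.-integrable D (EFin \o f) ->
  m.-integrable D (EFin \o (fun x => k * f x)).
Proof. by move=> fi; have := integrableZl mD k fi; apply: eq_integrable. Qed.

Lemma integrableRD f g : m.-integrable D (EFin \o f) -> m.-integrable D (EFin \o g) ->
  m.-integrable D (EFin \o (fun x => f x + g x)).
Proof. by move=> fi gi; have := integrableD mD fi gi; apply: eq_integrable. Qed.

Lemma integrableRB f g : m.-integrable D (EFin \o f) -> m.-integrable D (EFin \o g) ->
  m.-integrable D (EFin \o (fun x => f x - g x)).
Proof. by move=> fi gi; have := integrableB mD fi gi; apply: eq_integrable. Qed.

Lemma integrableRsum (I : Type) (s : seq I) (h : I -> T -> R) :
  (forall i, m.-integrable D (EFin \o h i)) ->
  m.-integrable D (EFin \o (fun x => \sum_(i <- s) h i x)).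
Proof.
move=> hi; elim: s => [|i s IHs].
  by under eq_fun do rewrite big_nil; exact: integrable0.
by under eq_fun do rewrite big_cons; exact: integrableRD.
Qed.

Lemma Rintegral_scale (k : R) f : m.-integrable D (EFin \o f) ->
  \int[m]_(x in D) (k * f x) = k * \int[m]_(x in D) f x.
Proof. by move=> fi; rewrite RintegralZl. Qed.

Lemma Rintegral_sum (I : Type) (s : seq I) (h : I -> T -> R) :
  (forall i, m.-integrable D (EFin \o h i)) ->
  \int[m]_(x in D) (\sum_(i <- s) h i x) = \sum_(i <- s) \int[m]_(x in D) h i x.
Proof.
move=> hi; elim: s => [|i s IHs].
  under eq_Rintegral do rewrite big_nil.
  by rewrite Rintegral_cst// mul0r big_nil.
under eq_Rintegral do rewrite big_cons.
by rewrite RintegralD ?big_cons ?IHs//; exact: integrableRsum.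
Qed.

Lemma integrable_L2M f g : L2 m D f -> L2 m D g ->
  m.-integrable D (EFin \o (fun x => f x * g x)).
Proof.
move=> [mf f2] [mg g2]; apply: (@le_integrableR _ (fun x => f x ^+ 2 + g x ^+ 2)).
- exact: measurable_funM.
- move=> x _; rewrite normrM -(real_normK (num_real (f x))) -(real_normK (num_real (g x))).
  set a := `|f x|; set b := `|g x|.
  have a0 : 0 <= a by exact: normr_ge0.
  have b0 : 0 <= b by exact: normr_ge0.
  have := sqr_ge0 (a - b); nra.
- by have := integrableD mD f2 g2.
Qed.

Lemma L2D f g : L2 m D f -> L2 m D g -> L2 m D (fun x => f x + g x).
Proof.
move=> [mf f2] [mg g2]; split; first exact: measurable_funD.
apply: (@le_integrableR (fun x => (f x + g x) ^+ 2) (fun x => 2 * f x ^+ 2 + 2 * g x ^+ 2)).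
- by apply: measurable_funX; exact: measurable_funD.
- move=> x _; rewrite ger0_norm ?sqr_ge0//; have := sqr_ge0 (f x - g x); nra.
- have := integrableD mD (integrableZl mD 2 f2) (integrableZl mD 2 g2).
  by apply: eq_integrable => // x _.
Qed.

Lemma L2_Mbd f g M : L2 m D f -> measurable_fun D g -> (forall x, D x -> `|g x| <= M) ->
  L2 m D (fun x => g x * f x).
Proof.
move=> [mf f2] mg gM; split; first exact: measurable_funM.
apply: (@le_integrableR (fun x => (g x * f x) ^+ 2) (fun x => M ^+ 2 * f x ^+ 2)).
- by apply: measurable_funX; exact: measurable_funM.
- move=> x Dx; rewrite ger0_norm ?sqr_ge0// exprMn ler_wpM2r ?sqr_ge0//.
  rewrite -(real_normK (num_real (g x))) lerXn2r ?nnegrE ?(le_trans _ (gM x Dx))//.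
- have := integrableZl mD (M ^+ 2) f2.
  by apply: eq_integrable => // x _.
Qed.

Lemma L2Z f (k : R) : L2 m D f -> L2 m D (fun x => k * f x).
Proof. by move=> f2; apply: (@L2_Mbd f (fun=> k) `|k|) => //; exact: measurable_cst. Qed.

Lemma L2B f g : L2 m D f -> L2 m D g -> L2 m D (fun x => f x - g x).
Proof.
move=> f2 g2; have := L2D f2 (L2Z (- 1) g2).
by congr L2; apply/funext => x; rewrite mulN1r.
Qed.

Lemma L2_sum (I : Type) (s : seq I) (h : I -> T -> R) : (forall i, L2 m D (h i)) ->
  L2 m D (fun x => \sum_(i <- s) h i x).
Proof.
move=> h2; elim: s => [|i s IHs].
  under eq_fun do rewrite big_nil; split; first exact: measurable_cst.
  under eq_fun do rewrite expr0n/=; exact: integrable0.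
under eq_fun do rewrite big_cons; exact: L2D.
Qed.

Lemma integrable_bd f M : (m D < +oo)%E -> measurable_fun D f ->
  (forall x, D x -> `|f x| <= M) -> m.-integrable D (EFin \o f).
Proof.
move=> Doo mf fM; apply: measurable_bounded_integrable => //.
exists M; split; first exact: num_real.
by move=> k Mk x Dx /=; exact: le_trans (fM x Dx) (ltW Mk).
Qed.

Lemma L2_bd f M : (m D < +oo)%E -> measurable_fun D f ->
  (forall x, D x -> `|f x| <= M) -> L2 m D f.
Proof.
move=> Doo mf fM; split => //.
apply: (@integrable_bd (fun x => f x ^+ 2) (M ^+ 2)) => //; first exact: measurable_funX.
move=> x Dx; rewrite normrX lerXn2r ?nnegrE ?(le_trans _ (fM x Dx))//; exact: fM.
Qed.

Lemma integrable_L2 f : (m D < +oo)%E -> L2 m D f -> m.-integrable D (EFin \o f).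
Proof.
move=> Doo f2.
have c2 : L2 m D (fun=> 1) by apply: (@L2_bd _ 1) => // x _; rewrite normr1.
by have := integrable_L2M f2 c2; under eq_fun do rewrite mulr1.
Qed.

Lemma eq_Rintegral_ae f g : measurable_fun D f -> measurable_fun D g ->
  {ae m, forall x, D x -> f x = g x} -> \int[m]_(x in D) f x = \int[m]_(x in D) g x.
Proof.
move=> mf mg fg; congr fine; apply: ae_eq_integral => //.
- exact/measurable_EFinP.
- exact/measurable_EFinP.
- by apply: filterS fg => x fg Dx; rewrite fg.
Qed.

Lemma le_Rintegral_ae f g : m.-integrable D (EFin \o f) -> m.-integrable D (EFin \o g) ->
  {ae m, forall x, D x -> f x <= g x} -> \int[m]_(x in D) f x <= \int[m]_(x in D) g x.
Proof.
move=> fi gi fg; rewrite -subr_ge0 -RintegralB//.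
have mf : measurable_fun D f by apply/measurable_EFinP; exact: measurable_int fi.
have mg : measurable_fun D g by apply/measurable_EFinP; exact: measurable_int gi.
rewrite (@eq_Rintegral_ae _ (fun x => `|g x - f x|)).
- exact: Rintegral_ge0.
- exact: measurable_funB.
- by apply: measurableT_comp => //; exact: measurable_funB.
- by apply: filterS fg => x fg Dx; rewrite ger0_norm// subr_ge0 fg.
Qed.

(** The free weight [e] replaces Cauchy-Schwarz in the convergence proofs, where it is chosen
    according to the required precision. *)
Lemma Rintegral_Young f g e : L2 m D f -> L2 m D g -> 0 < e ->
  `|\int[m]_(x in D) (f x * g x)| <=
   e * \int[m]_(x in D) (f x ^+ 2) + e^-1 * \int[m]_(x in D) (g x ^+ 2).
Proof.
move=> f2 g2 e0; have fg := integrable_L2M f2 g2.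
have [mf fi] := f2; have [mg gi] := g2.
rewrite (le_trans (le_normr_Rintegral _ fg))//.
rewrite -!RintegralZl// -RintegralD//; last 2 first.
- by have := integrableZl mD e fi; apply: eq_integrable => // x _.
- by have := integrableZl mD e^-1 gi; apply: eq_integrable => // x _.
apply: le_Rintegral => //.
- exact: integrable_norm.
- have := integrableD mD (integrableZl mD e fi) (integrableZl mD e^-1 gi).
  by apply: eq_integrable => // x _.
- move=> x _; rewrite normrM -(real_normK (num_real (f x))) -(real_normK (num_real (g x))).
  set a := `|f x|; set b := `|g x|.
  have a0 : 0 <= a by exact: normr_ge0.
  have b0 : 0 <= b by exact: normr_ge0.
  have -> : e * a ^+ 2 + e^-1 * b ^+ 2 = e^-1 * ((e * a) ^+ 2 + b ^+ 2).
    by field; rewrite gt_eqF.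
  rewrite ler_pdivlMl//; have := sqr_ge0 (e * a - b); nra.
Qed.

(** The filter is arbitrary so that the lemma covers both sequences and times tending to [t] within
    [[0, +oo[]; in the latter case [L2] is only known on that half-line, hence the hypothesis for
    nearby indices only. *)
Lemma cvg_RintegralM (I : Type) (F : set_system I) {FF : Filter F}
    f g (h : I -> T -> R) : L2 m D f -> L2 m D g ->
  (\forall k \near F, L2 m D (h k)) ->
  (\int[m]_(x in D) ((h k x - g x) ^+ 2)%:E)%E @[k --> F] --> 0%E ->
  \int[m]_(x in D) (f x * h k x) @[k --> F] --> \int[m]_(x in D) (f x * g x).
Proof.
move=> f2 g2 h2 /fine_cvg /= hg; apply/cvgrPdist_lt => e e0.
pose A := \int[m]_(x in D) (f x ^+ 2).
have A0 : 0 <= A by apply: Rintegral_ge0 => x _; exact: sqr_ge0.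
pose dl := e / 2 / (A + 1).
have dl0 : 0 < dl by rewrite /dl !divr_gt0// ltr_wpDl.
have : \forall k \near F, `|0 - \int[m]_(x in D) ((h k x - g x) ^+ 2)| < dl * (e / 2).
  by move/cvgrPdist_lt : hg; apply; rewrite mulr_gt0// divr_gt0.
move: h2; apply: filterS2 => k h2 hk.
rewrite -RintegralB//; [|exact: integrable_L2M|exact: integrable_L2M].
have -> : \int[m]_(x in D) (f x * g x - f x * h k x) =
    - \int[m]_(x in D) (f x * (h k x - g x)).
  rewrite -mulN1r -RintegralZl//; last exact: integrable_L2M (L2B h2 g2).
  by apply: eq_Rintegral => x _; ring.
rewrite normrN (le_lt_trans (Rintegral_Young f2 (L2B h2 g2) dl0))//.
rewrite [ltRHS]splitr ler_ltD//.
  rewrite /dl mulrAC ler_pdivrMr ?ltr_wpDl// ler_wpM2l ?divr_ge0 ?ltW//.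
  by rewrite -/A ltrDl.
rewrite ltr_pdivrMl//; apply: le_lt_trans hk.
by rewrite sub0r normrN ler_norm.
Qed.

Lemma measurable_tail g (r : R) : measurable_fun D g ->
  measurable_fun D (fun x => if r < `|g x| then `|g x| else 0).
Proof.
move=> mg; have mng : measurable_fun D (fun x => `|g x|) by exact: measurableT_comp.
apply: measurable_fun_if => //; first by apply: measurable_fun_ltr => //; exact: measurable_cst.
by apply: measurable_funS mng.
Qed.

Lemma cvg_Rintegral_tail g : m.-integrable D (EFin \o g) ->
  \int[m]_(x in D) (if n%:R < `|g x| then `|g x| else 0) @[n --> \oo] --> 0.
Proof.
move=> gi; have mg : measurable_fun D g by apply/measurable_EFinP; exact: measurable_int gi.
have mif n : measurable_fun D (fun x => if n%:R < `|g x| then `|g x| else 0).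
  exact: measurable_tail.
have mF n : measurable_fun D (fun x => (if n%:R < `|g x| then `|g x| else 0)%:E).
  exact/measurable_EFinP.
have cv : {ae m, forall x, D x ->
    (if n%:R < `|g x| then `|g x| else 0)%:E @[n --> \oo] --> 0%:E}.
  apply: aeW => x Dx; apply: cvg_near_cst.
  exists (Num.truncn `|g x|).+1 => // n /= ngx; case: ifPn => //.
  by rewrite ltNge (le_trans (ltW (truncnS_gt _)))// ler_nat.
have dom : {ae m, forall x n, D x ->
    (`|(if n%:R < `|g x| then `|g x| else 0)%:E| <= (EFin \o (fun x : T => `|g x|%R)) x)%E}.
  by apply: aeW => x n Dx /=; rewrite lee_fin; case: ifP => _; rewrite ?normr_id// normr0.
have [_ _] := @dominated_convergence _ _ _ m D mD _ _ _ mF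
  (measurable_cst _) cv (integrable_norm gi) dom.
by rewrite integral0 => /fine_cvg.
Qed.

(** The coefficients [c k] are bounded and tend to 0 in L^2 only, while [g] is merely integrable.
    The domain is split according to [n < |g|]: the tail of [g] is small and is multiplied by at
    most [C]; on the rest [|c k * g|] is at most [n C |dl k|], which Young's inequality controls on
    a set of finite measure. No almost everywhere convergent subsequence is extracted. *)
Lemma cvg_Rintegral_bdM g (c dl : nat -> T -> R) C : (m D < +oo)%E ->
  m.-integrable D (EFin \o g) -> 0 <= C ->
  (forall k, measurable_fun D (c k)) -> (forall k x, D x -> `|c k x| <= C) ->
  (forall k x, D x -> `|c k x| <= C * `|dl k x|) ->
  (forall k, L2 m D (dl k)) ->
  (\int[m]_(x in D) ((dl k x) ^+ 2)%:E)%E @[k --> \oo] --> 0%E ->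
  \int[m]_(x in D) (c k x * g x) @[k --> \oo] --> 0.
Proof.
move=> Doo gi C0 mc cC cdl dl2 /fine_cvg /= dl0.
have mg : measurable_fun D g by apply/measurable_EFinP; exact: measurable_int gi.
have gt := cvg_Rintegral_tail gi.
apply/cvgrPdist_le => e e0.
have e3 : 0 < e / 3 by rewrite divr_gt0.
have [n hn] : exists n : nat,
    C * \int[m]_(x in D) (if n%:R < `|g x| then `|g x| else 0) <= e / 3.
  have : \forall n \near \oo, `|0 - \int[m]_(x in D) (if n%:R < `|g x| then `|g x| else 0)|
      <= e / 3 / (C + 1).
    by move/cvgrPdist_le : gt; apply; rewrite divr_gt0// ltr_wpDl.
  move=> [n _ /(_ n (leqnn _))] /=; rewrite sub0r normrN => H; exists n.
  rewrite (@le_trans _ _ ((C + 1) * (e / 3 / (C + 1))))//.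
    rewrite (le_trans (ler_wpM2l C0 (le_trans (ler_norm _) H)))// ler_wpM2r ?lerDl//.
    by rewrite divr_ge0 ?ltW// ltr_wpDl.
  by rewrite mulrC divfK// gt_eqF// ltr_wpDl.
pose t := \int[m]_(x in D) (if n%:R < `|g x| then `|g x| else 0).
pose mu := fine (m D).
have mu0 : 0 <= mu by exact: fine_ge0.
pose B := n%:R * C + 1.
have B0 : 0 < B by rewrite /B ltr_wpDl// mulr_ge0.
(* Young in the form [|dl| <= eta + eta^-1 * dl ^+ 2]: this [eta] makes the constant part contribute
   at most [e / 3] after multiplication by [B], and the quadratic part is then made as small by
   taking [k] large. *)
have [eta eta0 etaE] : exists2 eta, 0 < eta & eta * (mu + 1) = e / 3 / B.
  exists (e / 3 / B / (mu + 1)); first by rewrite !divr_gt0// ltr_wpDl.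
  by rewrite divfK// gt_eqF// ltr_wpDl.
have : \forall k \near \oo, `|0 - \int[m]_(x in D) (dl k x) ^+ 2| <= e / 3 / B * eta.
  by move/cvgrPdist_le : dl0; apply; rewrite mulr_gt0// divr_gt0.
apply: filterS => k; rewrite !sub0r !normrN => hk.
have ick : m.-integrable D (EFin \o (fun x => c k x * g x)).
  apply: (@le_integrableR _ (fun x => C * `|g x|)).
  - exact: measurable_funM.
  - by move=> x Dx; rewrite normrM ler_wpM2r// cC.
  - by have := integrableZl mD C (integrable_norm gi); apply: eq_integrable.
have it : m.-integrable D (EFin \o (fun x => if n%:R < `|g x| then `|g x| else 0)).
  apply: (@le_integrableR _ (fun x => `|g x|)).
  - exact: measurable_tail.
  - by move=> x Dx; case: ifP => _; rewrite ?normr_id ?normr0.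
  - exact: integrable_norm.
have i1 : m.-integrable D (EFin \o (fun=> eta)).
  by apply: (@integrable_bd _ `|eta|) => //; exact: measurable_cst.
have i2 : m.-integrable D (EFin \o (fun x => dl k x ^+ 2)) by case: (dl2 k).
have i3 : m.-integrable D (EFin \o (fun x => eta^-1 * dl k x ^+ 2)).
  by have := integrableZl mD eta^-1 i2; apply: eq_integrable.
have i4 : m.-integrable D (EFin \o (fun x => eta + eta^-1 * dl k x ^+ 2)).
  by have := integrableD mD i1 i3; apply: eq_integrable.
have i5 : m.-integrable D (EFin \o (fun x => B * (eta + eta^-1 * dl k x ^+ 2))).
  by have := integrableZl mD B i4; apply: eq_integrable.
have i6 : m.-integrable D (EFin \o (fun x => C * (if n%:R < `|g x| then `|g x| else 0))).
  by have := integrableZl mD C it; apply: eq_integrable.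
rewrite (le_trans (le_normr_Rintegral mD ick))//.
apply: (@le_trans _ _ (\int[m]_(x in D) (C * (if n%:R < `|g x| then `|g x| else 0) +
    B * (eta + eta^-1 * dl k x ^+ 2)))).
  apply: le_Rintegral => //.
  - exact: integrable_norm.
  - by have := integrableD mD i6 i5; apply: eq_integrable.
  move=> x Dx; rewrite normrM.
  have Y : `|dl k x| <= eta + eta^-1 * dl k x ^+ 2.
    rewrite -(real_normK (num_real (dl k x))); set a := `|dl k x|.
    have -> : eta + eta^-1 * a ^+ 2 = eta^-1 * (eta ^+ 2 + a ^+ 2) by field; rewrite gt_eqF.
    rewrite ler_pdivlMl//; have := sqr_ge0 (eta - a); have : 0 <= eta * a by rewrite mulr_ge0 ?normr_ge0// ltW.
    nra.
  have Y0 : 0 <= eta + eta^-1 * dl k x ^+ 2 by exact: le_trans Y.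
  case: ifPn => [gn|]; last rewrite -leNgt => gn.
    by rewrite (le_trans (ler_wpM2r (normr_ge0 _) (cC k x Dx)))// lerDl mulr_ge0// ltW.
  rewrite mulr0 add0r mulrC.
  apply: (@le_trans _ _ (n%:R * (C * `|dl k x|))).
    by apply: ler_pM => //; exact: cdl.
  rewrite mulrA; apply: (@le_trans _ _ (B * `|dl k x|)); last by rewrite ler_wpM2l// ltW.
  by rewrite ler_wpM2r// /B lerDl.
rewrite RintegralD// (Rintegral_scale _ it) (Rintegral_scale _ i4) (RintegralD mD i1 i3).
rewrite (Rintegral_scale _ i2) Rintegral_cst// -/mu -/t.
rewrite [leRHS](_ : e = e / 3 + (e / 3 + e / 3)); last by field.
have Y1 : eta * mu <= e / 3 / B by rewrite -etaE ler_wpM2l ?lerDl// ltW.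
have Y2 : eta^-1 * \int[m]_(x in D) dl k x ^+ 2 <= e / 3 / B.
  by rewrite ler_pdivrMl// mulrC; exact: le_trans (ler_norm _) hk.
have BK : B * (e / 3 / B) = e / 3 by rewrite mulrC divfK ?gt_eqF.
apply: lerD => //; rewrite mulrDr; apply: lerD; rewrite -BK.
  by apply: ler_wpM2l => //; exact: ltW.
by apply: ler_wpM2l => //; exact: ltW.
Qed.
End L2_theory.

(** * Weak derivatives on an interval *)

Section cutoff.
Context {R : realType}.
Implicit Types e a b x : R.

(** The function [e^(-e/x)] on [x > 0], which tends to the indicator of the positive half-line as
    [e] tends to 0. *)
Definition ramp e : R -> R := fexp e 1.
Definition ramp' e : R -> R := fexp e (fexp_next e 1).

Lemma ramp_itv e x : 0 < e -> 0 <= ramp e x <= 1.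
Proof.
move=> e0; rewrite /ramp /fexp; case: ifPn => x0; last by rewrite lexx ler01.
rewrite hornerC mul1r expR_ge0 /= -expR0 ler_expR oppr_le0 divr_ge0// ltW//.
Qed.

Lemma ramp'_ge0 e x : 0 < e -> 0 <= ramp' e x.
Proof.
move=> e0; rewrite /ramp' /fexp; case: ifPn => // x0.
rewrite /fexp_next derivC !hornerE /= mulr_ge0 ?expR_ge0// mulr_ge0 ?sqr_ge0//.
by rewrite subr0 ltW.
Qed.

Lemma ramp'_le e x dl : 0 < e -> 0 < dl -> dl <= x -> ramp' e x <= e / dl ^+ 2.
Proof.
move=> e0 dl0 dlx; have x0 : 0 < x by exact: lt_le_trans dlx.
rewrite /ramp' fexp_gt0// /fexp_next derivC !hornerE /= subr0.
rewrite (@le_trans _ _ (x^-1 ^+ 2 * e))//.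
  have E1 : expR (- (e / x)) <= 1.
    by rewrite -[leRHS]expR0 ler_expR oppr_le0 divr_ge0// ltW.
  by rewrite ler_piMr// mulr_ge0 ?sqr_ge0// ltW.
rewrite mulrC ler_wpM2l ?(ltW e0)// -exprVn lerXn2r ?nnegrE ?invr_ge0 ?(ltW x0) ?(ltW dl0)//.
by rewrite lef_pV2.
Qed.

Lemma is_derive_ramp e x : 0 < e -> is_derive x 1 (ramp e) (ramp' e x).
Proof. exact: is_derive_fexp. Qed.

Lemma contD {T : topologicalType} (f g : T -> R) :
  continuous f -> continuous g -> continuous (fun x : T => f x + g x).
Proof. by move=> cf cg x; exact: cvgD (cf x) (cg x). Qed.

Lemma contB {T : topologicalType} (f g : T -> R) :
  continuous f -> continuous g -> continuous (fun x : T => f x - g x).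
Proof. by move=> cf cg x; exact: cvgB (cf x) (cg x). Qed.

Lemma contM {T : topologicalType} (f g : T -> R) :
  continuous f -> continuous g -> continuous (fun x : T => f x * g x).
Proof. by move=> cf cg x; exact: cvgM (cf x) (cg x). Qed.

Lemma cont_cst {T : topologicalType} (c : R) : continuous (fun _ : T => c).
Proof. by move=> x; exact: cvg_cst. Qed.

Lemma cont_comp {T : topologicalType} (f : R -> R) (g : T -> R) :
  continuous f -> continuous g -> continuous (fun x : T => f (g x)).
Proof. by move=> cf cg x; apply: continuous_comp; [exact: cg|exact: cf]. Qed.

Lemma cont_id : continuous (fun x : R => x).
Proof. by move=> x; exact: cvg_id. Qed.

Lemma is_derive_affine c0 c1 a (s : R) : is_derive s 1 (fun s => c0 + c1 * (s - a)) c1.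
Proof.
have := is_derive_horner ((c0 - c1 * a)%:P + c1%:P * 'X) s.
rewrite derivD derivC derivM derivC derivX !hornerE /= => H.
rewrite [X in is_derive _ _ X](_ : _ = fun y => ((c0 - c1 * a)%:P + c1%:P * 'X).[y]) //.
by apply/funext => y; rewrite !hornerE /=; ring.
Qed.

Lemma continuous_is_derive (f f' : R -> R) :
  (forall x : R, is_derive x 1 f (f' x)) -> continuous f.
Proof.
by move=> df x; apply/differentiable_continuous/derivable1_diffP; have [] := df x.
Qed.

Lemma continuous_itv_integrable (f : R -> R) a b : continuous f ->
  lebesgue_measure.-integrable `[a, b] (EFin \o f).
Proof.
move=> cf; apply: continuous_compact_integrable; first exact: segment_compact.
exact: continuous_subspaceT.
Qed.

Lemma Rintegral_FTC (F f : R -> R) a b : a < b -> continuous f ->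
  (forall x : R, a <= x <= b -> is_derive x 1 F (f x)) ->
  \int[lebesgue_measure]_(s in `[a, b]) f s = F b - F a.
Proof.
move=> ab cf dF; have cF x : a <= x <= b -> {for x, continuous F}.
  by move=> /dF[dFx _]; apply/differentiable_continuous/derivable1_diffP.
rewrite /Rintegral (@continuous_FTC2 _ f F a b ab (continuous_subspaceT cf))//.
- split => [x||].
  + by rewrite in_itv/= => /andP[ax xb]; have [] := dF x; rewrite ?ltW.
  + by apply/cvg_at_right_filter/cF; rewrite lexx ltW.
  + by apply/cvg_at_left_filter/cF; rewrite lexx ltW.
- move=> x; rewrite in_itv/= => /andP[ax xb]; rewrite derive1E.
  by have [] := dF x; rewrite ?ltW.
Qed.

Lemma continuous_fexp p P : 0 < p -> continuous (fexp p P : R -> R).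
Proof. by move=> p0; apply: continuous_is_derive => x; exact: is_derive_fexp. Qed.

(** A smooth substitute for the indicator of []a, b[]: as [e] tends to 0, its derivative tends to a
    unit mass at [a] minus a unit mass at [b]. *)
Definition cutoff e a b s := ramp e (s - a) * ramp e (b - s).
Definition cutoff' e a b s :=
  ramp' e (s - a) * ramp e (b - s) - ramp e (s - a) * ramp' e (b - s).

Lemma is_derive_shiftl (f f' : R -> R) a (s : R) : (forall x : R, is_derive x 1 f (f' x)) ->
  is_derive s 1 (fun s => f (s - a)) (f' (s - a)).
Proof.
move=> df; rewrite -[f' _]mulr1; apply: is_derive_comp.
rewrite -[X in is_derive _ _ _ X]subr0.
by apply: is_deriveB.
Qed.

Lemma is_derive_shiftr (f f' : R -> R) b (s : R) : (forall x : R, is_derive x 1 f (f' x)) ->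
  is_derive s 1 (fun s => f (b - s)) (- f' (b - s)).
Proof.
move=> df; rewrite -mulrN1; apply: is_derive_comp.
rewrite -[X in is_derive _ _ _ X]sub0r.
by apply: is_deriveB.
Qed.

Lemma is_derive_cutoff e a b (s : R) : 0 < e ->
  is_derive s 1 (cutoff e a b) (cutoff' e a b s).
Proof.
move=> e0.
have da : is_derive s 1 (fun s => ramp e (s - a)) (ramp' e (s - a)).
  by apply: is_derive_shiftl => x; exact: is_derive_ramp.
have db : is_derive s 1 (fun s => ramp e (b - s)) (- ramp' e (b - s)).
  by apply: is_derive_shiftr => x; exact: is_derive_ramp.
have -> : cutoff' e a b s = ramp e (s - a) *: - ramp' e (b - s) +
    ramp e (b - s) *: ramp' e (s - a) by rewrite /GRing.scale /= /cutoff'; ring.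
exact: (is_deriveM da db).
Qed.

Lemma smooth_fexp_comp {V : normedModType R} p P (F : V -> R) :
  0 < p -> smooth F -> smooth (fun x : V => fexp p P (F x)).
Proof.
move=> p0 sF k; apply: (@Ck_comp _ _ (fun j => fexp p (iter j (fexp_next p) P)) _ _ _ (sF k) 0%N).
by move=> j x; rewrite iterS; exact: is_derive_fexp.
Qed.

Lemma smooth_id : smooth (id : R -> R).
Proof.
case=> [|k]; split => //; first by move=> x _; exact: cvg_id.
  by move=> x _; exact: cvg_id.
move=> h; split => [x _|]; first exact: derivable_id.
rewrite (_ : 'D_h id = fun=> h); first exact: Ck_cst.
by apply/funext => x; exact: derive_id.
Qed.

Lemma smooth_cutoff e a b : 0 < e -> smooth (cutoff e a b).
Proof.
move=> e0 k; apply: CkM.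
  apply: (@smooth_fexp_comp R e 1 (fun s => s - a)) => // j.
  by apply: CkD; [exact: smooth_id|exact: Ck_cst].
apply: (@smooth_fexp_comp R e 1 (fun s => b - s)) => // j.
apply: CkD; first exact: Ck_cst.
rewrite (_ : -%R = fun s : R => (- 1) * s); last by apply/funext => s; rewrite mulN1r.
by apply: CkM; [exact: Ck_cst|exact: smooth_id].
Qed.

Lemma cutoff_out e a b s : ~~ (a < s < b) -> cutoff e a b s = 0.
Proof.
rewrite negb_and -!leNgt /cutoff /ramp => /orP[sa|bs].
  by rewrite (fexp_le0 _ _ (_ : s - a <= 0)) ?mul0r// subr_le0.
by rewrite [X in _ * X]fexp_le0 ?mulr0// subr_le0.
Qed.

Lemma cutoff'_out e a b s : ~~ (a < s < b) -> cutoff' e a b s = 0.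
Proof.
rewrite negb_and -!leNgt /cutoff' /ramp /ramp' => /orP[sa|bs].
  by rewrite !(fexp_le0 _ _ (_ : s - a <= 0)) ?mul0r ?subrr// subr_le0.
have h : b - s <= 0 by rewrite subr_le0.
by rewrite !(fexp_le0 _ _ h) !mulr0 subrr.
Qed.

Lemma cutoff_itv e a b s : 0 < e -> 0 <= cutoff e a b s <= 1.
Proof.
move=> e0; have /andP[p0 p1] := ramp_itv (s - a) e0; have /andP[q0 q1] := ramp_itv (b - s) e0.
by rewrite /cutoff mulr_ge0//= mulr_ile1.
Qed.

Lemma cvg_ramp x : ramp k.+1%:R^-1 x @[k --> \oo] --> (if 0 < x then 1 else 0 : R).
Proof.
case: ifPn => x0; last first.
  rewrite (_ : (fun k : nat => ramp k.+1%:R^-1 x) = fun=> 0); first exact: cvg_cst.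
  by apply/funext => k; rewrite /ramp fexp_le0// leNgt.
rewrite (_ : (fun k : nat => ramp k.+1%:R^-1 x) = fun k => expR (- (k.+1%:R^-1 / x))).
  have : expR (- (k.+1%:R^-1 / x)) @[k --> \oo] --> expR (- (0 / x)).
    apply: continuous_cvg; first exact: continuous_expR.
    by apply: cvgN; apply: cvgMl; exact: cvg_harmonic.
  by rewrite mul0r oppr0 expR0.
by apply/funext => k; rewrite /ramp fexp_gt0// hornerC mul1r.
Qed.

Lemma cvg_cutoff a b s :
  cutoff k.+1%:R^-1 a b s @[k --> \oo] --> (if a < s < b then 1 else 0 : R).
Proof.
have -> : (if a < s < b then 1 else 0 : R) =
  (if 0 < s - a then 1 else 0) * (if 0 < b - s then 1 else 0).
  by rewrite !subr_gt0; case: (a < s); case: (s < b); rewrite /= ?mulr0 ?mulr1.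
by apply: cvgM; exact: cvg_ramp.
Qed.

Lemma continuous_cutoff e a b : 0 < e -> continuous (cutoff e a b : R -> R).
Proof. by move=> e0; apply: continuous_is_derive => s; exact: is_derive_cutoff. Qed.

Lemma continuous_cutoff' e a b : 0 < e -> continuous (cutoff' e a b : R -> R).
Proof.
move=> e0; have cl : continuous (fun s : R => s - a).
  by apply: contB; [exact: cont_id|exact: cont_cst].
have cr : continuous (fun s : R => b - s).
  by apply: contB; [exact: cont_cst|exact: cont_id].
apply: contB; apply: contM.
- by apply: (cont_comp (f := ramp' e)) cl; exact: continuous_fexp.
- by apply: (cont_comp (f := ramp e)) cr; exact: continuous_fexp.
- by apply: (cont_comp (f := ramp e)) cl; exact: continuous_fexp.
- by apply: (cont_comp (f := ramp' e)) cr; exact: continuous_fexp.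
Qed.

(** Integration by parts without boundary terms, since the cutoff vanishes at [a] and [b]. For
    affine functions the limit of the left side thus reduces to that of the cutoff itself. *)
Lemma integral_cutoff'_affine e a b c0 c1 : 0 < e -> a < b ->
  \int[lebesgue_measure]_(s in `[a, b]) (cutoff' e a b s * (c0 + c1 * (s - a))) =
  - (c1 * \int[lebesgue_measure]_(s in `[a, b]) cutoff e a b s).
Proof.
move=> e0 ab; pose l (s : R) := c0 + c1 * (s - a).
have dl (s : R) : is_derive s 1 l c1 by exact: is_derive_affine.
have cl : continuous l by apply: continuous_is_derive.
have cc := @continuous_cutoff e a b e0.
have cc' := @continuous_cutoff' e a b e0.
have dcl (s : R) : is_derive s 1 (cutoff e a b * l) (cutoff' e a b s * l s + c1 * cutoff e a b s).
  have ds := is_derive_cutoff a b s e0.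
  have -> : cutoff' e a b s * l s + c1 * cutoff e a b s =
     cutoff e a b s *: c1 + l s *: cutoff' e a b s by rewrite /GRing.scale/=; ring.
  exact: is_deriveM.
have cf : continuous (fun s => cutoff' e a b s * l s + c1 * cutoff e a b s).
  by apply: contD; apply: contM => //; exact: cont_cst.
have : \int[lebesgue_measure]_(s in `[a, b]) (cutoff' e a b s * l s + c1 * cutoff e a b s) = 0.
  rewrite (Rintegral_FTC ab cf (fun x _ => dcl x)).
  have ca : cutoff e a b a = 0 by rewrite cutoff_out// ltxx.
  have cb : cutoff e a b b = 0 by rewrite cutoff_out// ltxx andbF.
  by rewrite !fctE ca cb !mul0r subrr.
rewrite RintegralD//; last 2 first.
- by apply: continuous_itv_integrable; exact: contM.
- by apply: continuous_itv_integrable; apply: contM => //; exact: cont_cst.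
rewrite RintegralZl//; last exact: continuous_itv_integrable.
by move=> /eqP; rewrite addr_eq0 => /eqP.
Qed.

(** The mass of the derivative of the cutoff is bounded independently of [e], so it may multiply a
    remainder that is small near the ends. *)
Lemma integral_ramp'_le e a b : 0 < e -> a < b ->
  \int[lebesgue_measure]_(s in `[a, b]) (ramp' e (s - a) + ramp' e (b - s)) <= 2.
Proof.
move=> e0 ab; pose F (s : R) := ramp e (s - a) - ramp e (b - s).
have dF (s : R) : is_derive s 1 F (ramp' e (s - a) + ramp' e (b - s)).
  have da : is_derive s 1 (fun s => ramp e (s - a)) (ramp' e (s - a)).
    by apply: is_derive_shiftl => x; exact: is_derive_ramp.
  have db : is_derive s 1 (fun s => ramp e (b - s)) (- ramp' e (b - s)).
    by apply: is_derive_shiftr => x; exact: is_derive_ramp.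
  by rewrite -[X in _ + X]opprK; exact: (is_deriveB da db).
have cf : continuous (fun s : R => ramp' e (s - a) + ramp' e (b - s)).
  apply: contD.
    apply: (cont_comp (f := ramp' e)); first exact: continuous_fexp.
    by apply: contB; [exact: cont_id|exact: cont_cst].
  apply: (cont_comp (f := ramp' e)); first exact: continuous_fexp.
  by apply: contB; [exact: cont_cst|exact: cont_id].
rewrite (Rintegral_FTC ab cf (fun x _ => dF x)) /F !subrr.
have [h1 h2] := andP (ramp_itv (b - a) e0); have [h3 h4] := andP (ramp_itv (0 : R) e0).
by lra.
Qed.

Lemma lebesgue_oo_lty a b : (@lebesgue_measure R `]a, b[%classic < +oo)%E.
Proof. by rewrite lebesgue_measure_itv/=; case: ifP => _; rewrite -?EFinB ltry. Qed.

Lemma Rintegral_cst_oo a b (c : R) : a < b ->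
  \int[lebesgue_measure]_(s in `]a, b[) c = c * (b - a).
Proof.
move=> ab; have L : fine (@lebesgue_measure R `]a, b[%classic) = b - a.
  by rewrite lebesgue_measure_itv/= lte_fin ab.
by rewrite Rintegral_cst//; congr (_ * _).
Qed.

Lemma Rintegral_cst_cc a b (c : R) : a < b ->
  \int[lebesgue_measure]_(s in `[a, b]) c = c * (b - a).
Proof.
move=> ab; have L : fine (@lebesgue_measure R `[a, b]%classic) = b - a.
  by rewrite lebesgue_measure_itv/= lte_fin ab.
by rewrite Rintegral_cst//; congr (_ * _).
Qed.

Lemma Rintegral_cc_oo (f : R -> R) a b : (forall s, ~~ (a < s < b) -> f s = 0) ->
  \int[lebesgue_measure]_(s in `[a, b]) f s = \int[lebesgue_measure]_(s in `]a, b[) f s.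
Proof.
move=> f0; rewrite Rintegral_mkcond [RHS]Rintegral_mkcond; congr Rintegral.
apply/funext => s; rewrite !patchE !mem_setE !in_itv /=.
have [/andP[sa sb]|sab] := boolP (a < s < b); first by rewrite !ltW.
by case: ifP => // _; exact: f0.
Qed.

Lemma Rintegral_0T_oo (f : R -> R) T a b : 0 < a -> b < T ->
  (forall s, ~~ (a < s < b) -> f s = 0) ->
  \int[lebesgue_measure]_(s in `]0, T[) f s = \int[lebesgue_measure]_(s in `]a, b[) f s.
Proof.
move=> a0 bT f0; rewrite Rintegral_mkcond [RHS]Rintegral_mkcond; congr Rintegral.
apply/funext => s; rewrite !patchE !mem_setE !in_itv /=.
have [/andP[sa sb]|sab] := boolP (a < s < b).
  by rewrite (lt_trans a0)// (lt_trans sb).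
by case: ifP => // _; exact: f0.
Qed.

Lemma cvg_Rintegral_cutoff (g : R -> R) a b :
  lebesgue_measure.-integrable `]a, b[ (EFin \o g) ->
  \int[lebesgue_measure]_(s in `]a, b[) (cutoff k.+1%:R^-1 a b s * g s) @[k --> \oo]
    --> \int[lebesgue_measure]_(s in `]a, b[) g s.
Proof.
move=> gi; pose D : set R := `]a, b[%classic.
have mD : measurable D by exact: measurable_itv.
have mg : measurable_fun D g by apply/measurable_EFinP; exact: measurable_int gi.
have e0 k : 0 < k.+1%:R^-1 :> R by rewrite invr_gt0.
have mF k : measurable_fun D (fun s => (cutoff k.+1%:R^-1 a b s * g s)%:E).
  apply/measurable_EFinP; apply: measurable_funM => //.
  apply: measurable_funS (continuous_measurable_fun _) => //.
  exact: continuous_cutoff.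
have cv : {ae lebesgue_measure, forall s, D s ->
    (cutoff k.+1%:R^-1 a b s * g s)%:E @[k --> \oo] --> (g s)%:E}.
  apply: aeW => s; rewrite /D /= in_itv /= => sab; apply: cvg_EFin.
    by near=> k.
  rewrite -[X in _ --> X]mul1r; apply: cvgMl => /=.
  by have H := @cvg_cutoff a b s; rewrite sab in H.
have dom : {ae lebesgue_measure, forall s (k : nat), D s ->
    (`|(cutoff k.+1%:R^-1 a b s * g s)%:E| <= (EFin \o (fun s : R => `|g s|%R)) s)%E}.
  apply: aeW => s k Ds /=; rewrite lee_fin normrM.
  have /andP[c0 c1] := cutoff_itv a b s (e0 k).
  by rewrite ger0_norm// ler_piMl.
have [_ _] := @dominated_convergence _ _ _ lebesgue_measure D mD _ _ _ mF
  (measurable_int _ gi) cv (integrable_norm gi) dom.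
move=> H; apply: fine_cvg.
rewrite fineK; first exact: H.
exact: integrable_fin_num.
Unshelve. all: by end_near.
Qed.

(* Subtracting from [m] its affine interpolant leaves a remainder which vanishes at [a] and [b],
   where [cutoff'] concentrates. *)
Lemma cvg_Rintegral_cutoff' (m : R -> R) a b : continuous m -> a < b ->
  \int[lebesgue_measure]_(s in `]a, b[) (cutoff' k.+1%:R^-1 a b s * m s) @[k --> \oo]
    --> m a - m b.
Proof.
move=> cm ab; have ba0 : b - a != 0 by rewrite subr_eq0 gt_eqF.
pose c1 := (m b - m a) / (b - a).
pose l (s : R) := m a + c1 * (s - a).
have e0 k : 0 < k.+1%:R^-1 :> R by rewrite invr_gt0.
have cl : continuous l by apply: continuous_is_derive => s; exact: is_derive_affine.
pose r s := m s - l s.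
have cr : continuous r by exact: contB.
have ra : r a = 0 by rewrite /r /l subrr mulr0 addr0 subrr.
have rb : r b = 0 by rewrite /r /l /c1 divfK//; ring.
have [M M0 rM] : exists2 M, 0 <= M & forall s, a <= s <= b -> `|r s| <= M.
  have [M M0 rM] := compact_bounded_fun (continuous_subspaceT cr) (@segment_compact R a b).
  by exists M => // s sab; apply: rM; rewrite /= in_itv.
have ifin (f : R -> R) := @continuous_itv_integrable f a b.
have E k : \int[lebesgue_measure]_(s in `]a, b[) (cutoff' k.+1%:R^-1 a b s * m s) =
   - (c1 * \int[lebesgue_measure]_(s in `]a, b[) (cutoff k.+1%:R^-1 a b s * 1)) +
   \int[lebesgue_measure]_(s in `[a, b]) (cutoff' k.+1%:R^-1 a b s * r s).
  rewrite -Rintegral_cc_oo; last by move=> s sab; rewrite cutoff'_out// mul0r.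
  rewrite -[in RHS]Rintegral_cc_oo; last by move=> s sab; rewrite cutoff_out// mul0r.
  under [in RHS]eq_Rintegral do rewrite mulr1.
  rewrite -(integral_cutoff'_affine (m a))// -RintegralD//; last 2 first.
  - by apply: ifin; apply: contM => //; exact: continuous_cutoff'.
  - by apply: ifin; apply: contM => //; exact: continuous_cutoff'.
  by apply: eq_Rintegral => s _; rewrite /r /l; ring.
under eq_cvg do rewrite E.
have -> : m a - m b = - (c1 * \int[lebesgue_measure]_(s in `]a, b[) 1) + 0.
  rewrite Rintegral_cst_oo// /c1 mul1r divfK//; ring.
apply: cvgD.
  apply: cvgN; apply: cvgMr; apply: cvg_Rintegral_cutoff.
  apply: (@integrable_bd _ _ _ lebesgue_measure _ _ _ 1) => //; last by move=> s _; rewrite normr1.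
  exact: lebesgue_oo_lty.
apply/cvgrPdist_le => e ep.
(* Near the ends the remainder is at most [e / 4]; against a mass of at most 2 this contributes
   [e / 2]. *)
have [dl dl0 hdl] : exists2 dl, 0 < dl & forall s, a <= s <= b ->
    s - a < dl \/ b - s < dl -> `|r s| <= e / 4.
  have e4 : 0 < e / 4 by rewrite divr_gt0.
  move/cvgrPdist_le : (cr a) => /(_ _ e4) [da /= da0 hda].
  move/cvgrPdist_le : (cr b) => /(_ _ e4) [db /= db0 hdb].
  exists (Num.min da db); first by rewrite lt_min da0.
  move=> s /andP[sa sb] []; rewrite lt_min => /andP[h1 h2].
    have := hda s; rewrite /= ra sub0r normrN; apply.
    by rewrite distrC ger0_norm ?subr_ge0.
  have := hdb s; rewrite /= rb sub0r normrN; apply.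
  by rewrite ger0_norm ?subr_ge0.
have H : \forall k \near \oo, M * (2 * (k.+1%:R^-1 / dl ^+ 2)) * (b - a) <= e / 2.
  pose Q := M * 2 / dl ^+ 2 * (b - a) + 1.
  have Q0 : 0 < Q by rewrite /Q ltr_wpDl// !mulr_ge0 ?invr_ge0 ?sqr_ge0 ?subr_ge0 ?(ltW ab).
  have : \forall k \near \oo, k.+1%:R^-1 <= e / 2 / Q.
    have := @cvg_harmonic R; move=> /cvgrPdist_le /(_ (e / 2 / Q)).
    rewrite !divr_gt0// => /(_ isT); apply: filterS => k /=.
    by rewrite sub0r normrN ger0_norm// invr_ge0.
  apply: filterS => k hk.
  apply: (@le_trans _ _ (Q * k.+1%:R^-1)).
    have -> : M * (2 * (k.+1%:R^-1 / dl ^+ 2)) * (b - a) = (Q - 1) * k.+1%:R^-1.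
      by rewrite /Q; ring.
    by rewrite ler_wpM2r ?invr_ge0// gerBl.
  by rewrite mulrC -ler_pdivlMr.
move: H; apply: filterS => k hk; rewrite sub0r normrN.
pose kk s := ramp' k.+1%:R^-1 (s - a) + ramp' k.+1%:R^-1 (b - s).
have ckk : continuous kk.
  apply: contD.
    apply: (cont_comp (f := ramp' k.+1%:R^-1)); first exact: continuous_fexp.
    by apply: contB; [exact: cont_id|exact: cont_cst].
  apply: (cont_comp (f := ramp' k.+1%:R^-1)); first exact: continuous_fexp.
  by apply: contB; [exact: cont_cst|exact: cont_id].
have cc' := @continuous_cutoff' k.+1%:R^-1 a b (e0 k).
rewrite (le_trans (le_normr_Rintegral _ (ifin _ (contM cc' cr))))//.
(* [Kc] bounds the integrand where both ends are at distance at least [dl]: there [ramp'_le] makes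
   each of the two derivatives at most [k.+1%:R^-1 / dl ^+ 2]. *)
pose Kc := M * (2 * (k.+1%:R^-1 / dl ^+ 2)).
apply: (@le_trans _ _ (\int[lebesgue_measure]_(s in `[a, b]) (e / 4 * kk s + Kc))).
  apply: le_Rintegral => //.
  - by apply: integrable_norm; exact: ifin (contM cc' cr).
  - by apply: ifin; apply: contD; [apply: contM => //|]; exact: cont_cst.
  move=> s; rewrite /= in_itv /= => sab.
  have r1 := ramp'_ge0 (s - a) (e0 k); have r2 := ramp'_ge0 (b - s) (e0 k).
  have ckks : `|cutoff' k.+1%:R^-1 a b s| <= kk s.
    have /andP[q1 q2] := ramp_itv (s - a) (e0 k).
    have /andP[q3 q4] := ramp_itv (b - s) (e0 k).
    rewrite /cutoff' (le_trans (ler_normB _ _))// !normrM.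
    by rewrite !ger0_norm// lerD// ?ler_piMr// ler_piMl.
  have kk0 : 0 <= kk s by rewrite /kk addr_ge0.
  have Kc0 : 0 <= Kc by rewrite /Kc !mulr_ge0// ?invr_ge0// sqr_ge0.
  rewrite normrM; have [sd|sd] := pselect (s - a < dl \/ b - s < dl).
    rewrite mulrC; apply: (@le_trans _ _ (e / 4 * kk s)); last by rewrite lerDl.
    by apply: ler_pM => //; exact: hdl.
  have [d1 d2] : dl <= s - a /\ dl <= b - s.
    by split; rewrite leNgt; apply/negP => h; apply: sd; [left|right].
  apply: (@le_trans _ _ Kc); last by rewrite lerDr mulr_ge0// divr_ge0// ltW.
  rewrite mulrC /Kc; apply: ler_pM => //; first exact: rM.
  rewrite (le_trans ckks)// /kk mulr2n mulrDl !mul1r.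
  by apply: lerD; exact: ramp'_le.
rewrite RintegralD//; last 2 first.
- by apply: (ifin (fun s => e / 4 * kk s)); apply: contM => //; exact: cont_cst.
- by apply: (ifin (fun=> Kc)); exact: cont_cst.
rewrite RintegralZl//; last exact: ifin.
rewrite Rintegral_cst_cc//.
have I2 := integral_ramp'_le (e0 k) ab.
rewrite [leRHS](_ : e = e / 4 * 2 + e / 2); last by field.
by apply: lerD => //; apply: ler_wpM2l => //; rewrite divr_ge0// ltW.
Qed.

(** The cutoffs alone suffice as test functions, because their derivatives concentrate at [a] and
    [b]; continuity of [m] gives meaning to its values at these two times. *)
Lemma weak_derivative_itv (m n : R -> R) (T : R) : continuous m ->
  lebesgue_measure.-integrable `]0, T[ (EFin \o n) ->
  (forall e a b, 0 < e -> 0 < a -> a < b -> b < T ->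
    \int[lebesgue_measure]_(s in `]0, T[) (cutoff' e a b s * m s) =
    \int[lebesgue_measure]_(s in `]0, T[) (cutoff e a b s * n s)) ->
  forall a b, 0 < a -> a < b -> b < T ->
  m b - m a = - \int[lebesgue_measure]_(s in `]a, b[) n s.
Proof.
move=> cm ni H a b a0 ab bT; apply/eqP; rewrite -eqr_oppLR opprB; apply/eqP.
have e0 k : 0 < k.+1%:R^-1 :> R by rewrite invr_gt0.
have H1 := cvg_Rintegral_cutoff' cm ab.
have H2 : \int[lebesgue_measure]_(s in `]a, b[) (cutoff k.+1%:R^-1 a b s * n s) @[k --> \oo]
    --> \int[lebesgue_measure]_(s in `]a, b[) n s.
  apply: cvg_Rintegral_cutoff; apply: integrableS ni => //.
  by move=> s; rewrite /= !in_itv /= => /andP[sa sb]; rewrite (lt_trans a0)// (lt_trans sb).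
have E : (fun k : nat => \int[lebesgue_measure]_(s in `]a, b[) (cutoff' k.+1%:R^-1 a b s * m s)) =
    (fun k : nat => \int[lebesgue_measure]_(s in `]a, b[) (cutoff k.+1%:R^-1 a b s * n s)).
  apply/funext => k; rewrite -(Rintegral_0T_oo a0 bT); last first.
    by move=> s sab; rewrite cutoff'_out// mul0r.
  rewrite H//; apply: Rintegral_0T_oo => //.
  by move=> s sab; rewrite cutoff_out// mul0r.
by rewrite E in H1; exact: (cvg_unique _ H1 H2).
Qed.
End cutoff.

(** * Fubini on a rectangle *)

Section fubini_rectangle.
Context d1 d2 (T1 : measurableType d1) (T2 : measurableType d2) (R : realType).
Variables (m1 : {sigma_finite_measure set T1 -> \bar R}).
Variables (m2 : {sigma_finite_measure set T2 -> \bar R}).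
Variables (A : set T1) (D : set T2).
Hypotheses (mA : measurable A) (mD : measurable D).
Local Notation m12 := (m1 \x m2)%E.

Lemma mfine : measurable_fun [set: \bar R] (@fine R).
Proof. exact: fine_measurable. Qed.

Section integrable.
Variable f : T1 * T2 -> R.
Hypothesis fi : m12.-integrable (A `*` D) (EFin \o f).

Let fX := (EFin \o f) \_ (A `*` D).

Let fXi : m12.-integrable setT fX.
Proof. by apply/(integrable_mkcond _ (measurableX mA mD)).1. Qed.

Let fXE1 s : (\int[m2]_y fX (s, y) = if s \in A then \int[m2]_(y in D) (f (s, y))%:E else 0)%E.
Proof.
case: ifPn => sA; last first.
  apply: integral0_eq => y _; rewrite /fX patchE; case: ifPn => //.
  by rewrite inE /= => -[/mem_set]; rewrite (negbTE sA).
rewrite [RHS]integral_mkcond; apply: eq_integral => y _.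
by rewrite /fX !patchE in_setX/= sA.
Qed.

Let fXE2 y : (\int[m1]_s fX (s, y) = if y \in D then \int[m1]_(s in A) (f (s, y))%:E else 0)%E.
Proof.
case: ifPn => yD; last first.
  apply: integral0_eq => s _; rewrite /fX patchE; case: ifPn => //.
  by rewrite inE /= => -[_ /mem_set]; rewrite (negbTE yD).
rewrite [RHS]integral_mkcond; apply: eq_integral => s _.
by rewrite /fX !patchE in_setX/= yD andbT.
Qed.

Lemma ae_integrable_sect1 :
  {ae m1, forall s, A s -> m2.-integrable D (fun y => (f (s, y))%:E)}.
Proof.
apply: filterS (ae_integrable1 fXi) => s Hs As.
apply/(integrable_mkcond _ mD).2; apply: eq_integrable Hs => // y _.
by rewrite /fX !patchE in_setX/= mem_set.
Qed.

Lemma ae_integrable_sect2 :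
  {ae m2, forall y, D y -> m1.-integrable A (fun s => (f (s, y))%:E)}.
Proof.
apply: filterS (ae_integrable2 fXi) => y Hy Dy.
apply/(integrable_mkcond _ mA).2; apply: eq_integrable Hy => // s _.
by rewrite /fX !patchE in_setX/= (mem_set Dy) andbT.
Qed.

Lemma integrable_sect1 :
  m1.-integrable A (EFin \o (fun s => \int[m2]_(y in D) f (s, y))).
Proof.
have F := integrable_fubini_F fXi.
have /integrableP[mF _] := F.
apply/(integrable_mkcond _ mA).2.
(* [Rintegral] is [fine] of the extended integral and so takes the default value 0 where a section
   has an infinite integral. The domination survives because [fine] never increases the absolute
   value. *)
have -> : (EFin \o (fun s => \int[m2]_(y in D) f (s, y))) \_ A =
    EFin \o (fine \o fubini_F m2 fX).
  apply/funext => s; rewrite patchE /= /fubini_F fXE1 /Rintegral.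
  by case: ifP.
apply: le_integrable F => //.
  by apply/measurable_EFinP; apply: measurableT_comp => //; exact: mfine.
by move=> s _ /=; case: (fubini_F _ _ _) => [r||] //=; rewrite normr0 leey.
Qed.

Lemma Rintegral_sect1 : \int[m12]_(p in A `*` D) f p =
  \int[m1]_(s in A) \int[m2]_(y in D) f (s, y).
Proof.
have F := integrable_fubini_F fXi.
have /integrableP[mF _] := F.
rewrite /Rintegral (integral_mkcond (A `*` D)) -/fX -(integral12_prod_meas1 fXi).
congr fine; rewrite [RHS]integral_mkcond; apply: ae_eq_integral => //.
- apply/(measurable_restrictT _ mA).1.
  by have := measurable_int _ integrable_sect1.
- have := integrable_ae measurableT F; apply: filterS => s Fs _.
  rewrite patchE; move: (Fs I); rewrite /fubini_F fXE1.
  by case: ifP => // _ fs; rewrite /= fineK.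
Qed.

Let integrable_G : m2.-integrable setT (fubini_G m1 fX).
Proof.
have mfX : measurable_fun setT fX := measurable_int _ fXi.
have := (integrable21ltyP m1 m2 mfX).1 fXi => lty.
apply/integrableP; split; first exact: measurable_fubini_G fXi.
apply: le_lt_trans lty; apply: ge0_le_integral => //.
- by apply: measurableT_comp => //; exact: measurable_fubini_G fXi.
- apply: (measurable_fun_fubini_tonelli_G (abse \o fX)) => //=.
  exact: measurableT_comp.
- move=> y _; apply: le_abse_integral => //.
  exact: measurableT_comp.
Qed.

Lemma integrable_sect2 :
  m2.-integrable D (EFin \o (fun y => \int[m1]_(s in A) f (s, y))).
Proof.
have F := integrable_G.
have /integrableP[mF _] := F.
apply/(integrable_mkcond _ mD).2.
have -> : (EFin \o (fun y => \int[m1]_(s in A) f (s, y))) \_ D =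
    EFin \o (fine \o fubini_G m1 fX).
  apply/funext => s; rewrite patchE /= /fubini_G fXE2 /Rintegral.
  by case: ifP.
apply: le_integrable F => //.
  by apply/measurable_EFinP; apply: measurableT_comp => //; exact: mfine.
by move=> s _ /=; case: (fubini_G _ _ _) => [r||] //=; rewrite normr0 leey.
Qed.

Lemma Rintegral_sect2 : \int[m12]_(p in A `*` D) f p =
  \int[m2]_(y in D) \int[m1]_(s in A) f (s, y).
Proof.
have F := integrable_G.
have /integrableP[mF _] := F.
rewrite /Rintegral (integral_mkcond (A `*` D)) -/fX -(integral21_prod_meas1 fXi).
congr fine; rewrite [RHS]integral_mkcond; apply: ae_eq_integral => //.
- apply/(measurable_restrictT _ mD).1.
  by have := measurable_int _ integrable_sect2.
- have := integrable_ae measurableT F; apply: filterS => s Fs _.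
  rewrite patchE; move: (Fs I); rewrite /fubini_G fXE2.
  by case: ifP => // _ fs; rewrite /= fineK.
Qed.
End integrable.

Lemma measurable_sect1 (f : T1 * T2 -> R) s : measurable_fun (A `*` D) f -> A s ->
  measurable_fun D (fun y => f (s, y)).
Proof.
move=> mf As; apply: (@measurable_comp _ _ _ _ _ _ (A `*` D) f _ (pair s)) => //.
- exact: measurableX.
- by move=> _ [y Dy <-].
- exact: measurable_funS (measurable_pair1 _).
Qed.

Lemma ae_of_sect1 (P : T1 * T2 -> Prop) : measurable [set p | ~ P p] ->
  {ae m1, forall s, {ae m2, forall y, P (s, y)}} -> {ae m12, forall p, P p}.
Proof.
move=> mN H; exists [set p | ~ P p]; split => //.
rewrite [LHS](_ : _ = \int[m1]_s m2 (xsection [set p | ~ P p] s))%E//.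
rewrite (ae_eq_integral (cst 0%E)) ?integral0//.
  exact: measurable_fun_xsection.
apply: filterS H => s Hs _ /=.
have [N [mN' N0 PN]] := Hs.
apply/eqP; rewrite -measure_le0 -N0 le_measure ?inE//; first exact: measurable_xsection.
by move=> y; rewrite /xsection /= inE => /= nP; exact: PN.
Qed.

Lemma ae_of_sect2 (P : T1 * T2 -> Prop) : measurable [set p | ~ P p] ->
  {ae m2, forall y, {ae m1, forall s, P (s, y)}} -> {ae m12, forall p, P p}.
Proof.
move=> mN H; exists [set p | ~ P p]; split => //.
(* The product measure is defined through sections in one variable; by uniqueness it coincides with
   the one defined through sections in the other. *)
have -> : m12 [set p | ~ P p] = (m1 \x^ m2)%E [set p | ~ P p].
  apply: (@product_measure_unique _ _ _ _ _ m1 m2 (m1 \x^ m2)%E) => //.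
  by move=> B C mB mC; exact: product_measure2E.
rewrite [LHS](_ : _ = \int[m2]_y m1 (ysection [set p | ~ P p] y))%E//.
rewrite (ae_eq_integral (cst 0%E)) ?integral0//.
  exact: measurable_fun_ysection.
apply: filterS H => y Hy _ /=.
have [N [mN' N0 PN]] := Hy.
apply/eqP; rewrite -measure_le0 -N0 le_measure ?inE//; first exact: measurable_ysection.
by move=> s; rewrite /ysection /= inE => /= nP; exact: PN.
Qed.
End fubini_rectangle.

Section integral_complements.
Context d (T : measurableType d) (R : realType) (m : {measure set T -> \bar R}).
Variable D : set T.
Hypothesis mD : measurable D.
Implicit Types f g : T -> R.

Lemma integrable_ae_bd f M : (m D < +oo)%E -> measurable_fun D f ->
  {ae m, forall x, D x -> `|f x| <= M} -> m.-integrable D (EFin \o f).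
Proof.
move=> Doo mf fM; apply/integrableP; split; first exact/measurable_EFinP.
apply: (@le_lt_trans _ _ (\int[m]_(x in D) (`|M|)%:E)%E).
  apply: ae_ge0_le_integral => //.
  - by apply/measurable_EFinP; exact: measurableT_comp.
  - by apply: filterS fM => x fM Dx /=; rewrite lee_fin (le_trans (fM Dx))// ler_norm.
by rewrite integral_cst// lte_mul_pinfty.
Qed.

Lemma integrable_Mbd f g M : m.-integrable D (EFin \o f) -> measurable_fun D g ->
  (forall x, D x -> `|g x| <= M) -> m.-integrable D (EFin \o (fun x => g x * f x)).
Proof.
move=> fi mg gM; have mf : measurable_fun D f by apply/measurable_EFinP; exact: measurable_int fi.
apply: (@le_integrableR _ _ _ _ _ mD _ (fun x => M * `|f x|)).
- exact: measurable_funM.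
- by move=> x Dx; rewrite normrM ler_wpM2r// gM.
- exact: (integrableRZ mD M (integrable_norm fi)).
Qed.

Lemma Rintegral_restrict f (D' : set T) : D' `<=` D -> (forall x, D x -> ~ D' x -> f x = 0) ->
  \int[m]_(x in D) f x = \int[m]_(x in D') f x.
Proof.
move=> D'D f0; rewrite Rintegral_mkcond [RHS]Rintegral_mkcond; congr Rintegral.
apply/funext => x; rewrite !patchE.
case: ifPn => xD; case: ifPn => xD' //.
  by apply: f0; [exact: set_mem|move/mem_set; exact/negP].
by move: xD; rewrite (mem_set (D'D _ (set_mem xD'))).
Qed.
End integral_complements.

(** * The weak formulation between two times *)

Section signed_power.
Context {R : realType}.
Implicit Types g s M : R.

(** The nonlinearity in the form in which the weak formulation contains it. At [s = 0] the second
    factor kills whatever value the power takes. *)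
Definition spow g s : R := `|s| `^ (g - 1) * s.

Lemma measurable_spow g : measurable_fun setT (spow g).
Proof.
apply: measurable_funM => //.
by apply: (@measurableT_comp _ _ _ _ _ _ (@powR R ^~ (g - 1))) => //; exact: measurable_powR.
Qed.

Lemma spow_ge0 g s : 0 < g -> 0 <= s -> spow g s = s `^ g.
Proof.
by move=> g0 s0; rewrite /spow ger0_norm// mulrC mulr_powRB1.
Qed.

Lemma normr_spow g s : 0 < g -> `|spow g s| = `|s| `^ g.
Proof.
by move=> g0; rewrite /spow normrM (ger0_norm (powR_ge0 _ _)) mulrC mulr_powRB1.
Qed.

Lemma spow_bd g s M : 0 < g -> `|s| <= M -> `|spow g s| <= M `^ g.
Proof.
move=> g0 sM; rewrite normr_spow// ge0_ler_powR ?nnegrE ?(ltW g0)//.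
exact: le_trans sM.
Qed.
End signed_power.

Section test_functions.
Context {R : realType} {n : nat}.
Local Notation mu := (@lebesgue_rV R n).
Implicit Types (Omega : set 'rV[R]_n) (psi : 'rV[R]_n -> R).

Lemma cylinderE I Omega : cylinder I Omega = (I `*` Omega) :> set (measurableTypeR R * 'rV[R]_n).
Proof. by []. Qed.

Lemma is_derive0 {V : normedModType R} (f : V -> R) x : is_derive x 0 f 0.
Proof.
apply/is_derive_line; rewrite (_ : (fun t : R => _) = fun=> f x); first exact: is_derive_cst.
by apply/funext => t; rewrite scaler0 add0r.
Qed.

Section tensor.
Variables (e a b : R) (psi : 'rV[R]_n -> R).
Hypothesis e0 : 0 < e.
Hypothesis spsi : smooth psi.
Let phi (p : R * 'rV[R]_n) := cutoff e a b p.1 * psi p.2.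

Let dphi p h : is_derive p h phi
  (cutoff e a b p.1 * 'D_(h.2) psi p.2 + psi p.2 * (h.1 * cutoff' e a b p.1)).
Proof.
have [_ dpsi _] := smoothP spsi.
apply: (@is_deriveM _ _ (fun q : R * 'rV[R]_n => cutoff e a b q.1) (fun q => psi q.2)).
  have /is_derive_line H : is_derive p.1 h.1 (cutoff e a b) (h.1 * cutoff' e a b p.1).
    apply/is_derive_line; rewrite mulrC.
    apply: (@is_derive1_comp _ (cutoff e a b) (fun t : R => t *: h.1 + p.1)).
      by rewrite scale0r add0r; exact: is_derive_cutoff.
    have := @is_derive_affine R p.1 h.1 0 0.
    by congr is_derive; apply/funext => t; rewrite subr0 addrC /GRing.scale /= mulrC.
  by apply/is_derive_line.
apply/is_derive_line.
have /is_derive_line H : is_derive p.2 h.2 psi ('D_h.2 psi p.2) by apply: DeriveDef.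
exact: H.
Qed.

Lemma dt_tensor p : dt phi p = cutoff' e a b p.1 * psi p.2.
Proof.
rewrite /dt; have [_ ->] := dphi p (1, 0) => /=.
by have [_ ->] := is_derive0 psi p.2; rewrite mulr0 add0r mul1r mulrC.
Qed.

Lemma grad_x_tensor p : grad_x phi p = cutoff e a b p.1 *: grad psi p.2.
Proof.
apply/rowP => i; rewrite !mxE; have [_ ->] := dphi p (0, delta_mx ord0 i) => /=.
by rewrite mul0r mulr0 addr0.
Qed.

(** The support lies in [[a, b]] times that of [psi], a compact subset of the open cylinder because
    [a] is positive. *)
Lemma test_function_tensor Omega : 0 < a -> test_function Omega psi ->
  test_function (cylinder `]0, +oo[ Omega) phi.
Proof.
move=> a0 [_ cpsi psiO].
pose S := `[a, b]%classic `*` closure [set x | psi x != 0].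
have cS : compact S by apply: compact_setX => //; exact: segment_compact.
have clS : closed S by apply: compact_closed => //; exact: norm_hausdorff.
have sub : closure [set p | phi p != 0] `<=` S.
  rewrite [X in _ `<=` X]((closure_id S).1 clS); apply: closure_subset.
  move=> [s x] /=; rewrite /phi /= mulf_eq0 negb_or => /andP[cs px].
  split => /=; last exact: subset_closure.
  rewrite in_itv/=; have : a < s < b by apply: contraNT cs => h; rewrite cutoff_out.
  by move=> /andP[/ltW -> /ltW ->].
split.
- move=> k; apply: CkM.
    by apply: (@Ck_fst R R 'rV[R]_n k (cutoff e a b)); exact: smooth_cutoff.
  by apply: (@Ck_snd R R 'rV[R]_n k psi); exact: spsi.
- by apply: subclosed_compact cS sub; exact: closed_closure.
- move=> [s x] /sub[/= sab px]; split => /=; last exact: psiO.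
  move: sab; rewrite !in_itv /= andbT => /andP[sa _]; exact: lt_le_trans sa.
Qed.
End tensor.

Lemma smooth_bounded (f : 'rV[R]_n -> R) Omega : smooth f -> bounded_set Omega ->
  exists2 C, 0 <= C & forall x, Omega x -> `|f x| <= C.
Proof.
move=> /smoothP[cf _ _] /bounded_setP_rV[C OC].
have [M M0 fM] := continuous_bounded_rV C cf.
by exists M => // x Ox; apply: fM => i; exact: le_trans (ler_coord_rV _ _) (OC _ Ox).
Qed.

Lemma smooth_measurable (f : 'rV[R]_n -> R) : smooth f -> measurable_fun setT f.
Proof. by move=> /smoothP[cf _ _]; exact: continuous_measurable_rV. Qed.

Lemma smooth_L2 (f : 'rV[R]_n -> R) Omega : smooth f -> open Omega -> bounded_set Omega ->
  L2 mu Omega f.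
Proof.
move=> sf oO bO; have mO := open_measurable_rV oO.
have [C C0 fC] := smooth_bounded sf bO.
apply: (@L2_bd _ _ _ _ _ mO _ C) => //; first exact: bounded_lebesgue_rV.
exact: measurable_funS (smooth_measurable sf).
Qed.
End test_functions.

(** Continuity of the solution in time is relative to [[0, +oo[]. The constant extension to negative
    times is continuous on the whole line, as the one-variable lemmas require. *)
Lemma continuous_max0 {R : realType} (f : R -> R) :
  (forall s : R, 0 <= s -> f t @[t --> within `[0, +oo[%classic (nbhs s)] --> f s) ->
  continuous (fun t : R => f (Num.max t 0)).
Proof.
move=> cf s; have s0 : 0 <= Num.max s 0 by rewrite le_max lexx orbT.
have cmax : Num.max k 0 @[k --> s] --> within `[0, +oo[%classic (nbhs (Num.max s 0)).
  move=> A /= A1; have c : {for s, continuous (fun k : R => Num.max k 0)}.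
    by apply: continuous_max; [exact: cvg_id|exact: cst_continuous].
  have cA : \forall k \near s, `[0, +oo[%classic (Num.max k 0) -> A (Num.max k 0) := c _ A1.
  by apply: filterS cA => k; apply; rewrite /= in_itv/= andbT le_max lexx orbT.
exact: (cvg_comp _ _ cmax (cf _ s0)).
Qed.

Section time_identity.
Context {R : realType} {n : nat}.
Local Notation mu := (@lebesgue_rV R n).
Local Notation mu1 := (@lebesgue_measure R).
Local Notation mutx := (mu1 \x mu)%E.
Variables (Omega : set 'rV[R]_n) (alpha beta lambda M T : R).
Variables (v : R -> 'rV[R]_n -> R) (Dv : R -> 'rV[R]_n -> 'rV[R]_n).
Hypotheses (oO : open Omega) (bO : bounded_set Omega).
Hypotheses (alpha0 : 0 < alpha) (beta0 : 0 < beta).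
Hypothesis vm : measurable_fun (cylinder `]0, +oo[ Omega) (fun p => v p.1 p.2).
Hypothesis vb : {ae mutx, forall p, cylinder `]0, +oo[ Omega p -> 0 <= v p.1 p.2 <= M}.
Hypothesis v2 : forall t, 0 <= t -> L2 mu Omega (v t).
Hypothesis vc : forall t, 0 <= t ->
  (\int[mu]_(x in Omega) ((v s x - v t x) ^+ 2)%:E)%E
      @[s --> within `[0, +oo[%classic (nbhs t)] --> 0%E.
Hypothesis Dv2 : forall i, L2 mutx (cylinder `]0, T[ Omega) (fun p => Dv p.1 p.2 ord0 i).
Hypothesis veq : forall phi : R * 'rV[R]_n -> R,
  test_function (cylinder `]0, +oo[ Omega) phi ->
  \int[mutx]_(p in cylinder `]0, +oo[ Omega)
     (- (v p.1 p.2 * dt phi p) + dot (Dv p.1 p.2) (grad_x phi p)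
      + `|v p.1 p.2| `^ (alpha - 1) * v p.1 p.2 * phi p)
  = lambda * \int[mutx]_(p in cylinder `]0, +oo[ Omega)
     (`|v p.1 p.2| `^ (beta - 1) * v p.1 p.2 * phi p).

Definition reaction (s : R) := lambda * spow beta s - spow alpha s.

Let mO : measurable Omega := open_measurable_rV oO.
Let Ooo : (mu Omega < +oo)%E := bounded_lebesgue_rV mO bO.
Let Q : set (measurableTypeR R * 'rV[R]_n) := cylinder `]0, T[ Omega.
Let Qoo' : set (measurableTypeR R * 'rV[R]_n) := cylinder `]0, +oo[ Omega.
Let mQ : measurable Q.
Proof. by apply: (@measurableX _ _ (measurableTypeR R) 'rV[R]_n `]0, T[%classic Omega). Qed.
Let mQoo : measurable Qoo'.
Proof. by apply: (@measurableX _ _ (measurableTypeR R) 'rV[R]_n `]0, +oo[%classic Omega). Qed.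
Let mI : measurable (`]0, T[%classic : set (measurableTypeR R)).
Proof. exact: measurable_itv. Qed.
Let QQ : Q `<=` Qoo'.
Proof. by move=> p [p0 Op]; split => //; move: p0; rewrite /= !in_itv/= andbT => /andP[]. Qed.

Let Qlty : (mutx Q < +oo)%E.
Proof.
rewrite /Q cylinderE product_measure1E// lte_mul_pinfty//.
  by rewrite ge0_fin_numE//; exact: lebesgue_oo_lty.
Qed.

Lemma reaction_bd s : `|s| <= M -> `|reaction s| <= `|lambda| * M `^ beta + M `^ alpha.
Proof.
move=> sM; rewrite /reaction (le_trans (ler_normB _ _))// normrM.
by rewrite lerD ?spow_bd// ler_wpM2l// spow_bd.
Qed.

Lemma measurable_reaction : measurable_fun setT reaction.
Proof.
by apply: measurable_funB; [apply: measurable_funM => //|]; exact: measurable_spow.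
Qed.

Let vmQ : measurable_fun Q (fun p => v p.1 p.2).
Proof. exact: (measurable_funS mQoo QQ vm). Qed.

Let vMae : {ae mutx, forall p, Q p -> `|v p.1 p.2| <= M}.
Proof.
apply: filterS vb => p vp Qp; have /andP[v0 vM] := vp (QQ Qp).
by rewrite ger0_norm.
Qed.

Let integrableQ (h : R -> R) (w : R * 'rV[R]_n -> R) C W :
  measurable_fun setT h -> (forall s, `|s| <= M -> `|h s| <= C) ->
  measurable_fun Q w -> (forall p, Q p -> `|w p| <= W) ->
  mutx.-integrable Q (EFin \o (fun p => w p * h (v p.1 p.2))).
Proof.
move=> mh hC mw wW; apply: (@integrable_Mbd _ _ _ _ _ mQ _ _ W) => //.
apply: (@integrable_ae_bd _ _ _ _ _ mQ _ C) => //.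
  exact: (measurableT_comp mh vmQ).
by apply: filterS vMae => p vp Qp; apply: hC; exact: vp.
Qed.

Section test.
Variable psi : 'rV[R]_n -> R.
Hypothesis tpsi : test_function Omega psi.
Let spsi : smooth psi. Proof. by case: tpsi. Qed.

Let g (p : R * 'rV[R]_n) := dot (Dv p.1 p.2) (grad psi p.2) - reaction (v p.1 p.2) * psi p.2.

Let m s := \int[mu]_(x in Omega) (psi x * v (Num.max s 0) x).

Let sgrad i : smooth (fun x => grad psi x ord0 i).
Proof.
have [_ _ H] := smoothP spsi; have := H (delta_mx ord0 i).
by congr smooth; apply/funext => x; rewrite mxE.
Qed.

Let continuous_m : continuous m.
Proof.
apply: (continuous_max0 (f := fun t => \int[mu]_(x in Omega) (psi x * v t x))) => s s0.
have H : \forall t \near within `[0, +oo[%classic (nbhs s), `[0, +oo[%classic t.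
  exact: near_withinT.
have v2n : \forall t \near within `[0, +oo[%classic (nbhs s), L2 mu Omega (v t).
  by apply: filterS H => t; rewrite /= in_itv/= andbT; exact: v2.
exact: (cvg_RintegralM mO (smooth_L2 spsi oO bO) (v2 s0) v2n (vc s0)).
Qed.

Let mpsi2 : measurable_fun Q (fun p => psi p.2).
Proof.
apply: (@measurable_funS _ _ _ _ setT) => //.
apply: (measurableT_comp (f := psi)); last exact: measurable_snd.
exact: smooth_measurable.
Qed.

Let integrable_g : mutx.-integrable Q (EFin \o g).
Proof.
have [C C0 psiC] := smooth_bounded spsi bO.
apply: integrableRB => //.
- apply: (@integrableRsum _ _ _ _ _ mQ _ _ (fun i p => Dv p.1 p.2 ord0 i * grad psi p.2 ord0 i)) => i.
  apply: (integrable_L2M mQ (Dv2 i)).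
  have [D D0 gD] := smooth_bounded (sgrad i) bO.
  apply: (@L2_bd _ _ _ _ _ mQ _ D) => //.
    apply: (@measurable_funS _ _ _ _ setT) => //.
    apply: (measurableT_comp (f := fun x => grad psi x ord0 i)); last exact: measurable_snd.
    exact: smooth_measurable.
  by move=> p [_ Op]; exact: gD.
- have := @integrableQ reaction (fun p => psi p.2) _ C measurable_reaction reaction_bd mpsi2.
  have H : forall p, Q p -> `|psi p.2| <= C by move=> p [_ Op]; exact: psiC.
  by move=> /(_ H); congr (_.-integrable _ _); apply/funext => p /=; rewrite mulrC.
Qed.

Let N s := \int[mu]_(x in Omega) g (s, x).

(** Testing with the product of [cutoff] and [psi] and integrating in space first leaves the
    hypothesis of [weak_derivative_itv] for [m] and [N]. *)
Let weak_form e a b : 0 < e -> 0 < a -> a < b -> b < T ->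
  \int[mu1]_(s in `]0, T[) (cutoff' e a b s * m s) =
  \int[mu1]_(s in `]0, T[) (cutoff e a b s * N s).
Proof.
move=> e0 a0 ab bT.
have [C C0 psiC] := smooth_bounded spsi bO.
have := veq (test_function_tensor b e0 spsi a0 tpsi).
have outQ p : Qoo' p -> ~ Q p -> cutoff e a b p.1 = 0 /\ cutoff' e a b p.1 = 0.
  move=> [/= p0 Op] nQ; have h : ~~ (a < p.1 < b).
    apply/negP => /andP[pa pb]; apply: nQ; split => //=.
    by rewrite in_itv /= (lt_trans a0 pa) (lt_trans pb).
  by rewrite cutoff_out ?cutoff'_out.
rewrite (@Rintegral_restrict _ _ _ mutx Qoo' _ Q QQ); last first.
  move=> p Op nQ; have [c0 c'0] := outQ p Op nQ.
  rewrite dt_tensor// grad_x_tensor// c0 c'0 mul0r scale0r !mulr0 oppr0 add0r.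
  by rewrite addr0 /dot big1// => i _; rewrite mxE mulr0.
rewrite [X in _ = _ * X](@Rintegral_restrict _ _ _ mutx Qoo' _ Q QQ); last first.
  by move=> p Op nQ; have [c0 c'0] := outQ p Op nQ; rewrite c0 mul0r mulr0.
have cutE s : 0 <= cutoff e a b s <= 1 by exact: cutoff_itv.
have [C' C'0 cutC'] : exists2 C', 0 <= C' & forall s, `]0, T[%classic s -> `|cutoff' e a b s| <= C'.
  have [C' C'0 H] := compact_bounded_fun
    (continuous_subspaceT (@continuous_cutoff' R e a b e0)) (@segment_compact R 0 T).
  exists C' => // s; rewrite /= in_itv /= => /andP[s0 sT]; apply: H.
  by rewrite /= in_itv /= !ltW.
have mc : measurable_fun Q (fun p => cutoff e a b p.1).
  apply: (@measurable_funS _ _ _ _ setT) => //.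
  apply: (measurableT_comp (f := cutoff e a b)); last exact: measurable_fst.
  by apply: continuous_measurable_fun; exact: continuous_cutoff.
have mc' : measurable_fun Q (fun p => cutoff' e a b p.1).
  apply: (@measurable_funS _ _ _ _ setT) => //.
  apply: (measurableT_comp (f := cutoff' e a b)); last exact: measurable_fst.
  by apply: continuous_measurable_fun; exact: continuous_cutoff'.
have ic'v : mutx.-integrable Q (EFin \o (fun p => cutoff' e a b p.1 * psi p.2 * v p.1 p.2)).
  apply: (@integrableQ id _ M (C' * C)) => //.
    exact: measurable_funM.
  by move=> p [p0 Op]; rewrite normrM ler_pM// ?psiC// cutC'.
have icg : mutx.-integrable Q (EFin \o (fun p => cutoff e a b p.1 * g p)).
  apply: (@integrable_Mbd _ _ _ _ _ mQ _ _ 1) => //.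
  by move=> p _; have /andP[c0 c1] := cutE p.1; rewrite ger0_norm.
have ib : mutx.-integrable Q
    (EFin \o (fun p => `|v p.1 p.2| `^ (beta - 1) * v p.1 p.2 * (cutoff e a b p.1 * psi p.2))).
  have := @integrableQ (spow beta) (fun p => cutoff e a b p.1 * psi p.2) (M `^ beta) (1 * C)
    (@measurable_spow R beta).
  move=> H; have {H} : mutx.-integrable Q
    (EFin \o (fun p => cutoff e a b p.1 * psi p.2 * spow beta (v p.1 p.2))).
    apply: H.
    - by move=> s sM; exact: spow_bd.
    - exact: measurable_funM.
    - move=> p [p0 Op]; rewrite normrM ler_pM ?psiC//.
      by have /andP[c0 c1] := cutE p.1; rewrite ger0_norm.
  by congr (_.-integrable _ _); apply/funext => p /=; rewrite mulrC.
(* The left integrand is rearranged so that the whole right-hand side of the weak formulation splits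
   off and cancels, the source being already contained in [g]. *)
have -> : \int[mutx]_(p in Q)
   (- (v p.1 p.2 * dt (fun p0 : R * 'rV_n => cutoff e a b p0.1 * psi p0.2) p) +
    dot (Dv p.1 p.2) (grad_x (fun p0 : R * 'rV_n => cutoff e a b p0.1 * psi p0.2) p) +
    `|v p.1 p.2| `^ (alpha - 1) * v p.1 p.2 * (cutoff e a b p.1 * psi p.2)) =
   \int[mutx]_(p in Q) ((cutoff e a b p.1 * g p - cutoff' e a b p.1 * psi p.2 * v p.1 p.2) +
     lambda * (`|v p.1 p.2| `^ (beta - 1) * v p.1 p.2 * (cutoff e a b p.1 * psi p.2))).
  apply: eq_Rintegral => p _; rewrite dt_tensor// grad_x_tensor// /g /reaction /spow.
  have -> : dot (Dv p.1 p.2) (cutoff e a b p.1 *: grad psi p.2) =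
      cutoff e a b p.1 * dot (Dv p.1 p.2) (grad psi p.2).
    by rewrite /dot mulr_sumr; apply: eq_bigr => i _; rewrite mxE mulrCA.
  ring.
rewrite (RintegralD mQ (integrableRB mQ icg ic'v) (integrableRZ mQ lambda ib)).
rewrite (Rintegral_scale mQ _ ib) (RintegralB mQ icg ic'v).
move=> /(canRL (addrK _)); rewrite subrr => /eqP; rewrite subr_eq0 => /eqP.
rewrite {1 2}/Q !cylinderE => E.
have {E} : \int[mu1]_(s in `]0, T[) \int[mu]_(y in Omega) (cutoff e a b s * g (s, y)) =
    \int[mu1]_(s in `]0, T[) \int[mu]_(y in Omega) (cutoff' e a b s * psi y * v s y).
  by rewrite -(Rintegral_sect1 mI mO icg) -(Rintegral_sect1 mI mO ic'v).
move=> E.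
transitivity (\int[mu1]_(s in `]0, T[) \int[mu]_(y in Omega)
    (cutoff' e a b s * psi y * v s y)).
  apply: eq_Rintegral => s; rewrite inE /= in_itv /= => /andP[s0 sT].
  have maxs : Num.max s 0 = s by apply: max_l; exact: ltW.
  rewrite /m maxs -(Rintegral_scale mO _ (integrable_L2M mO (smooth_L2 spsi oO bO) (v2 (ltW s0)))).
  by apply: eq_Rintegral => y _; rewrite mulrA.
rewrite -E; have i1 := integrable_sect1 mI mO icg.
have i2 := integrable_sect1 mI mO integrable_g.
have m1 := measurable_int _ i1; have m2 := measurable_int _ i2.
have mcI : measurable_fun (`]0, T[%classic : set (measurableTypeR R)) (cutoff e a b).
  have mcT : measurable_fun [set: measurableTypeR R] (cutoff e a b : measurableTypeR R -> R).
    apply: continuous_measurable_fun; exact: continuous_cutoff.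
  exact: (measurable_funS measurableT (@subsetT _ _) mcT).
(* The cutoff can be taken out of the space integral only at times where the section of [g] is
   integrable, that is at almost every time. *)
apply: (eq_Rintegral_ae mI).
- exact/measurable_EFinP.
- by apply: (measurable_funM mcI); exact/measurable_EFinP.
have := ae_integrable_sect1 mI mO integrable_g.
by apply: filterS => s gs sT; exact: (Rintegral_scale mO _ (gs sT)).
Qed.

(** The weak formulation between two times, with a test function of space alone: this form gives
    access to the increments of [v], about whose time derivative nothing is known. *)
Lemma time_identity a b : 0 < a -> a < b -> b < T ->
  \int[mu]_(x in Omega) (psi x * v b x) - \int[mu]_(x in Omega) (psi x * v a x) =
  - \int[mu1]_(s in `]a, b[) \int[mu]_(x in Omega)
      (dot (Dv s x) (grad psi x) - reaction (v s x) * psi x).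
Proof.
move=> a0 ab bT.
have iN : mu1.-integrable `]0, T[ (EFin \o N) by exact: (integrable_sect1 mI mO integrable_g).
have := weak_derivative_itv continuous_m iN weak_form a0 ab bT.
have maxE t : 0 <= t -> Num.max t 0 = t by move=> t0; exact: max_l.
by rewrite /m !maxE// ltW// (lt_trans a0).
Qed.
End test.

End time_identity.

(** * Nonlinear test functions *)

Section mean_value.
Context {R : realType}.
Implicit Types f df : R -> R.

Lemma mean_value f df (a b : R) : (forall x : R, is_derive x 1 f (df x)) -> a <= b ->
  exists2 c, a <= c <= b & f b - f a = df c * (b - a).
Proof.
move=> fdf; rewrite le_eqVlt => /predU1P[->|ab].
  by exists b; rewrite ?lexx// !subrr mulr0.
have cf := continuous_is_derive fdf.
have [c cab fab] := MVT ab (fun x _ => fdf x) (continuous_subspaceT cf).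
by exists c => //; move: cab; rewrite in_itv/= => /andP[/ltW -> /ltW ->].
Qed.

Lemma lipschitz_derive f df C : (forall x : R, is_derive x 1 f (df x)) ->
  (forall x, `|df x| <= C) -> forall a b, `|f a - f b| <= C * `|a - b|.
Proof.
move=> fdf dfC a b; wlog ab : a b / b <= a => [H|].
  by have [/H//|/ltW/H] := leP b a; rewrite distrC [`|b - a|]distrC.
by have [c _ ->] := mean_value fdf ab; rewrite normrM ler_wpM2r.
Qed.

Lemma convex_tangent f df : (forall x : R, is_derive x 1 f (df x)) ->
  {homo df : x y / x <= y} -> forall a b, f a - f b <= df a * (a - b).
Proof.
move=> fdf dfm a b; have [ba|ab] := leP b a.
  have [c /andP[_ ca] ->] := mean_value fdf ba.
  by rewrite ler_wpM2r ?subr_ge0// dfm.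
have [c /andP[ac _] fba] := mean_value fdf (ltW ab).
rewrite -lerN2 opprB fba -mulrN opprB ler_wpM2r ?subr_ge0 ?(ltW ab)//.
exact: dfm.
Qed.

Lemma nondecreasing_derive f df : (forall x : R, is_derive x 1 f (df x)) ->
  (forall x, 0 <= df x) -> {homo f : x y / x <= y}.
Proof.
move=> fdf df0 a b ab; have [c _ fab] := mean_value fdf ab.
by rewrite -subr_ge0 fab mulr_ge0// subr_ge0.
Qed.
End mean_value.

Section convex_function.
Context {R : realType}.
Implicit Types s : R.

(* [gJ] is a smooth convex substitute for the positive part and [gG] is its derivative. *)
Definition gJ s := s * fexp 1 1 s.
Definition gG : R -> R := fexp 1 (1 + 'X).
Definition gG' : R -> R := fexp 1 (fexp_next 1 (1 + 'X)).
Definition gG'' : R -> R := fexp 1 (fexp_next 1 (fexp_next 1 (1 + 'X))).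

Lemma is_derive_gG s : is_derive s 1 gG (gG' s).
Proof. exact: is_derive_fexp. Qed.

Lemma is_derive_gG' s : is_derive s 1 gG' (gG'' s).
Proof. exact: is_derive_fexp. Qed.

Lemma is_derive_gJ s : is_derive s 1 gJ (gG s).
Proof.
have d1 : is_derive s 1 (fexp 1 1 : R -> R) (fexp 1 (fexp_next 1 1) s) by exact: is_derive_fexp.
have -> : gG s = s *: fexp 1 (fexp_next 1 1) s + fexp 1 1 s *: (1 : R).
  rewrite /gG /fexp /fexp_next /GRing.scale/=; case: ifPn => s0; last by rewrite mulr0 mul0r addr0.
  rewrite derivC !hornerE /=; field; by rewrite gt_eqF.
exact: (is_deriveM (is_derive_id s 1) d1).
Qed.

Lemma gG_le0 s : s <= 0 -> gG s = 0. Proof. exact: fexp_le0. Qed.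

Lemma gG_itv s : 0 <= gG s <= 1.
Proof.
rewrite /gG /fexp; case: ifPn => s0; last by rewrite lexx ler01.
rewrite hornerD hornerC hornerX div1r; have sV0 : 0 < s^-1 by rewrite invr_gt0.
rewrite mulr_ge0 ?expR_ge0 ?addr_ge0 ?(ltW sV0)//=.
by rewrite expRN ler_pdivrMr ?expR_gt0// mul1r expR_ge1Dx.
Qed.

Lemma gG'_ge0 s : 0 <= gG' s.
Proof.
rewrite /gG' /fexp; case: ifPn => // s0.
have sV0 : 0 < s^-1 by rewrite invr_gt0.
rewrite /fexp_next derivD derivC derivX !hornerE /= mulr_ge0 ?expR_ge0//.
have -> : 1 + s^-1 - 1 = s^-1 by ring.
by rewrite mulr_ge0 ?sqr_ge0// ltW.
Qed.

Lemma gJ_ge0 s : 0 <= gJ s.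
Proof.
rewrite /gJ /fexp; case: ifPn => s0; last by rewrite mulr0.
by rewrite mulr_ge0 ?(ltW s0)// hornerC mul1r expR_ge0.
Qed.

Lemma gJ_le0 s : s <= 0 -> gJ s = 0.
Proof. by move=> s0; rewrite /gJ fexp_le0// mulr0. Qed.

(** Strict positivity on the positive half-line is what turns a vanishing integral of [gJ] into an
    inequality almost everywhere. *)
Lemma gJ_eq0 s : gJ s = 0 -> s <= 0.
Proof.
move=> /eqP; apply: contraTT; rewrite -ltNge => s0.
by rewrite /gJ fexp_gt0// hornerC mul1r mulf_neq0// gt_eqF// expR_gt0.
Qed.

Lemma gJ_convex a b : gJ a - gJ b <= gG a * (a - b).
Proof.
apply: convex_tangent => [x|]; first exact: is_derive_gJ.
exact: nondecreasing_derive is_derive_gG gG'_ge0.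
Qed.

Lemma gJ_lipschitz a b : `|gJ a - gJ b| <= `|a - b|.
Proof.
rewrite -[leRHS]mul1r; apply: lipschitz_derive => [x|x]; first exact: is_derive_gJ.
by have /andP[g0 g1] := gG_itv x; rewrite ger0_norm.
Qed.

Lemma gG_bounds : exists2 C : R, 0 <= C &
  [/\ forall s, `|gG' s| <= C,
      forall a b, `|gG a - gG b| <= C * `|a - b| &
      forall a b, `|gG' a - gG' b| <= C * `|a - b|].
Proof.
have [C1 C10 H1] := @fexp_bounded R 1 (fexp_next 1 (1 + 'X)) ltr01.
have [C2 C20 H2] := @fexp_bounded R 1 (fexp_next 1 (fexp_next 1 (1 + 'X))) ltr01.
exists (C1 + C2); first exact: addr_ge0.
split => [s|a b|a b].
- by rewrite (le_trans (H1 s))// lerDl.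
- apply: lipschitz_derive => [x|x]; first exact: is_derive_gG.
  by rewrite (le_trans (H1 x))// lerDl.
- apply: lipschitz_derive => [x|x]; first exact: is_derive_gG'.
  by rewrite (le_trans (H2 x))// lerDr.
Qed.

Lemma continuous_gG : continuous gG. Proof. exact: continuous_fexp. Qed.
Lemma continuous_gG' : continuous gG'. Proof. exact: continuous_fexp. Qed.
Lemma continuous_gJ : continuous gJ.
Proof. by apply: continuous_is_derive => s; exact: is_derive_gJ. Qed.
End convex_function.

Section approximation.
Context {R : realType} {n : nat}.
Local Notation mu := (@lebesgue_rV R n).
Variables (Omega : set 'rV[R]_n) (u : 'rV[R]_n -> R) (Du : 'rV[R]_n -> 'rV[R]_n).
Variables (c : R) (w : 'rV[R]_n -> R).
Hypotheses (oO : open Omega) (bO : bounded_set Omega) (uH : H10 Omega u Du).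
Hypotheses (c0 : 0 <= c) (sw : smooth w) (w0 : forall x, 0 <= w x).

Let mO : measurable Omega := open_measurable_rV oO.
Let Ooo : (mu Omega < +oo)%E := bounded_lebesgue_rV mO bO.
Let psi x := gG (c * u x - w x).
(* [b] is the weak gradient of [psi]. *)
Let b x i := gG' (c * u x - w x) * (c * Du x ord0 i - grad w x ord0 i).

Lemma smooth_grad (f : 'rV[R]_n -> R) i : smooth f -> smooth (fun x => grad f x ord0 i).
Proof.
move=> sf; have [_ _ H] := smoothP sf; have := H (delta_mx ord0 i).
by congr smooth; apply/funext => x; rewrite mxE.
Qed.

Lemma is_derive_grad (f : 'rV[R]_n -> R) i x : smooth f ->
  is_derive x (delta_mx ord0 i) f (grad f x ord0 i).
Proof. by move=> /smoothP[_ df _]; rewrite mxE; apply: DeriveDef => //; exact: df. Qed.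

Lemma test_function_zero (f : 'rV[R]_n -> R) : test_function Omega f ->
  forall x, ~ Omega x -> f x = 0.
Proof.
move=> [_ _ fO] x nOx; apply: contrapT => /eqP fx; apply: nOx; apply: fO.
exact: subset_closure.
Qed.

(** Where [phi] vanishes the argument of [gG] is [- w x <= 0], so the support does not grow. *)
Lemma test_function_comp (phi : 'rV[R]_n -> R) : test_function Omega phi ->
  test_function Omega (fun x => gG (c * phi x - w x)).
Proof.
move=> [sphi cphi phiO].
have sub : [set x | gG (c * phi x - w x) != 0] `<=` [set x | phi x != 0].
  move=> x /=; apply: contraNN => /eqP ->; rewrite mulr0 add0r gG_le0// oppr_le0; exact: w0.
have csub := closure_subset sub.
split.
- apply: (@smooth_fexp_comp R _ 1 (1 + 'X) (fun x => c * phi x - w x)) => // k.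
  apply: CkD; first by apply: CkM; [exact: Ck_cst|exact: sphi].
  rewrite (_ : (fun x => _) = fun x => (- 1) * w x); last by apply/funext => x; rewrite mulN1r.
  by apply: CkM; [exact: Ck_cst|exact: sw].
- by apply: subclosed_compact cphi csub; exact: closed_closure.
- exact: subset_trans csub phiO.
Qed.

Lemma grad_comp (phi : 'rV[R]_n -> R) x i : smooth phi ->
  grad (fun x => gG (c * phi x - w x)) x ord0 i =
  gG' (c * phi x - w x) * (c * grad phi x ord0 i - grad w x ord0 i).
Proof.
move=> sphi; rewrite mxE.
have dp := is_derive_grad i x sphi; have dw := is_derive_grad i x sw.
have dl : is_derive x (delta_mx ord0 i) (fun x => c * phi x - w x)
    (c * grad phi x ord0 i - grad w x ord0 i).
  by have := is_deriveB (is_deriveZ c dp) dw.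
by have [] := is_derive_comp (is_derive_gG _) dl.
Qed.

Lemma coord_le_enorm (x : 'rV[R]_n) i : x ord0 i ^+ 2 <= enorm x ^+ 2.
Proof.
rewrite /enorm sqr_sqrtr; last by apply: sumr_ge0 => j _; rewrite -expr2 sqr_ge0.
rewrite /dot (bigD1 i)//= -expr2 lerDl; apply: sumr_ge0 => j _.
by rewrite -expr2 sqr_ge0.
Qed.

Lemma squeeze0_ereal (a f : nat -> \bar R) : (forall k, (0 <= f k <= a k)%E) ->
  a k @[k --> \oo] --> 0%E -> f k @[k --> \oo] --> 0%E.
Proof.
move=> fa a0; apply: (@squeeze_cvge _ _ _ _ (fun=> 0%E) _ a) => //; last exact: cvg_cst.
by near=> k; exact: fa.
Unshelve. all: by end_near.
Qed.

(** The gradient of the composition is a coefficient times a gradient, and along the approximating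
    sequence both factors are known to converge in L^2 only. Convergence is therefore stated weakly,
    against a fixed function of L^2; this is all that a formulation linear in the test function
    needs. *)
Lemma test_approximation : exists2 psik : nat -> 'rV[R]_n -> R,
  forall k, test_function Omega (psik k) &
  forall f, L2 mu Omega f ->
    (\int[mu]_(x in Omega) (f x * psik k x) @[k --> \oo]
       --> \int[mu]_(x in Omega) (f x * psi x)) /\
    (forall i, \int[mu]_(x in Omega) (f x * grad (psik k) x ord0 i) @[k --> \oo]
       --> \int[mu]_(x in Omega) (f x * b x i)).
Proof.
have [u2 Du2 [phi [tphi phiu phiDu]]] := uH.
have [C C0 [G'C GC G'L]] := @gG_bounds R.
pose psik k x := gG (c * phi k x - w x).
have sphi k : smooth (phi k) by have [] := tphi k.
have phi2 k : L2 mu Omega (phi k) by exact: smooth_L2.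
have w2 : L2 mu Omega w by exact: smooth_L2.
have mg (g : R -> R) (h : 'rV[R]_n -> R) : continuous g -> L2 mu Omega h ->
    measurable_fun Omega (fun x => g (c * h x - w x)).
  move=> cg [mh _]; apply: (measurableT_comp (continuous_measurable_fun cg)).
  apply: measurable_funB; last by case: w2.
  by apply: measurable_funM => //; exact: measurable_cst.
have psi2 (h : 'rV[R]_n -> R) : L2 mu Omega h -> L2 mu Omega (fun x => gG (c * h x - w x)).
  move=> h2; apply: (@L2_bd _ _ _ _ _ mO _ 1) => //; first by apply: mg => //; exact: continuous_gG.
  by move=> x _; have /andP[g0 g1] := gG_itv (c * h x - w x); rewrite ger0_norm.
exists psik => [k|f f2]; first exact: test_function_comp.
split.
  apply: (cvg_RintegralM mO) => //; first exact: psi2.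
    by near=> k; exact: psi2.
  apply: (@squeeze0_ereal (fun k => ((C * c) ^+ 2)%:E *
     \int[mu]_(x in Omega) ((phi k x - u x) ^+ 2)%:E)%E).
    move=> k; apply/andP; split; first by apply: integral_ge0 => x _; rewrite lee_fin sqr_ge0.
    rewrite -ge0_integralZl//; last 3 first.
    - apply/measurable_EFinP; apply: measurable_funX; apply: measurable_funB.
        by case: (phi2 k).
      by case: u2.
    - by move=> x _; rewrite lee_fin sqr_ge0.
    - by rewrite lee_fin sqr_ge0.
    apply: ge0_le_integral => //.
    - by move=> x _; rewrite lee_fin sqr_ge0.
    - apply/measurable_EFinP; apply: measurable_funX; apply: measurable_funB.
        by apply: mg => //; exact: continuous_gG.
      by apply: mg => //; exact: continuous_gG.
    - apply: measurable_funeM; apply/measurable_EFinP; apply: measurable_funX.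
      by apply: measurable_funB; [case: (phi2 k)|case: u2].
    - move=> x _; rewrite -EFinM lee_fin -exprMn.
      rewrite -(real_normK (num_real (_ - _))) -(real_normK (num_real (_ * (_ - _)))).
      rewrite lerXn2r ?nnegrE// (le_trans (GC _ _))//.
      rewrite !normrM (ger0_norm C0) (ger0_norm c0) -mulrA ler_wpM2l//.
      have -> : c * phi k x - w x - (c * u x - w x) = c * (phi k x - u x) by ring.
      by rewrite normrM (ger0_norm c0).
  by rewrite -(mule0 ((C * c) ^+ 2)%:E); apply: cvgeM => //; exact: cvg_cst.
move=> i.
(* The error of the gradient has two parts: [h], the coefficient at [phi k] times the error of the
   gradients, tends to 0 in L^2; [ck], the error of the coefficient, multiplies the integrable
   product [g] and is left to [cvg_Rintegral_bdM]. *)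
pose h k x := gG' (c * phi k x - w x) * (c * (grad (phi k) x ord0 i - Du x ord0 i)).
pose ck k x := gG' (c * phi k x - w x) - gG' (c * u x - w x).
pose g x := f x * (c * Du x ord0 i - grad w x ord0 i).
have gw2 : L2 mu Omega (fun x => grad w x ord0 i) by apply: smooth_L2 => //; exact: smooth_grad.
have gphi2 k : L2 mu Omega (fun x => grad (phi k) x ord0 i).
  by apply: smooth_L2 => //; exact: smooth_grad.
have d2 : L2 mu Omega (fun x => c * Du x ord0 i - grad w x ord0 i).
  by apply: (L2B mO _ gw2); exact: (L2Z mO c (Du2 i)).
have h2 k : L2 mu Omega (h k).
  apply: (@L2_Mbd _ _ _ _ _ mO _ _ C) => //.
    by apply: (L2Z mO c); exact: (L2B mO (gphi2 k) (Du2 i)).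
  by apply: mg => //; exact: continuous_gG'.
have b2 : L2 mu Omega (b ^~ i).
  apply: (@L2_Mbd _ _ _ _ _ mO _ _ C) => //.
  by apply: mg => //; exact: continuous_gG'.
have ig := integrable_L2M mO f2 d2.
have mck k : measurable_fun Omega (ck k).
  by apply: measurable_funB; apply: mg => //; exact: continuous_gG'.
(* The constant [C * (c + 2)] serves twice: it exceeds the uniform bound [2 * C] and, below, the
   Lipschitz factor [C * c]. *)
have ckC k x : `|ck k x| <= C * (c + 2).
  rewrite (le_trans (ler_normB _ _))// (le_trans (lerD (G'C _) (G'C _)))//.
  have := mulr_ge0 C0 c0; lra.
have E k : \int[mu]_(x in Omega) (f x * grad (psik k) x ord0 i) =
    \int[mu]_(x in Omega) (f x * h k x) + \int[mu]_(x in Omega) (ck k x * g x) +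
    \int[mu]_(x in Omega) (f x * b x i).
  have i1 := integrable_L2M mO f2 (h2 k).
  have i2 : mu.-integrable Omega (EFin \o (fun x => ck k x * g x)).
    by apply: (@integrable_Mbd _ _ _ _ _ mO _ _ (C * (c + 2))).
  have i3 := integrable_L2M mO f2 b2.
  rewrite -(RintegralD mO i1 i2) -(RintegralD mO (integrableRD mO i1 i2) i3).
  apply: eq_Rintegral => x _; rewrite grad_comp// /h /ck /g /b; ring.
suff H : \int[mu]_(x in Omega) (f x * h k x) + \int[mu]_(x in Omega) (ck k x * g x) +
    \int[mu]_(x in Omega) (f x * b x i) @[k --> \oo] --> 0 + 0 + \int[mu]_(x in Omega) (f x * b x i).
  by rewrite !add0r in H; under eq_cvg do rewrite E.
apply: cvgD; last exact: cvg_cst.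
apply: cvgD.
  have z2 : L2 mu Omega (fun=> 0).
    by apply: (@L2_bd _ _ _ _ _ mO _ 0) => // x _; rewrite normr0.
  have := @cvg_RintegralM _ _ _ mu _ mO nat \oo _ f (fun=> 0) h f2 z2.
  have -> : \int[mu]_(x in Omega) (f x * 0) = 0.
    by under eq_Rintegral do rewrite mulr0; rewrite Rintegral_cst// mul0r.
  apply; first by near=> k; exact: h2.
  apply: (@squeeze0_ereal (fun k => ((C * c) ^+ 2)%:E *
     \int[mu]_(x in Omega) (enorm (grad (phi k) x - Du x) ^+ 2)%:E)%E); last first.
    by rewrite -(mule0 ((C * c) ^+ 2)%:E); apply: cvgeM => //; exact: cvg_cst.
  have me k : measurable_fun Omega (fun x => enorm (grad (phi k) x - Du x) ^+ 2).
    rewrite (_ : (fun x => _) = fun x => \sum_j (grad (phi k) x ord0 j - Du x ord0 j) ^+ 2).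
      apply: measurable_sum => j; apply: measurable_funX; apply: measurable_funB.
        have s := smooth_grad j (sphi k).
        exact: measurable_funTS (smooth_measurable s).
      by case: (Du2 j).
    apply/funext => x; rewrite /enorm sqr_sqrtr; last by apply: sumr_ge0 => j _; rewrite -expr2 sqr_ge0.
    by rewrite /dot; apply: eq_bigr => j _; rewrite !mxE expr2.
  move=> k; apply/andP; split; first by apply: integral_ge0 => x _; rewrite lee_fin sqr_ge0.
  rewrite -ge0_integralZl//; last 3 first.
  - exact/measurable_EFinP.
  - by move=> x _; rewrite lee_fin sqr_ge0.
  - by rewrite lee_fin sqr_ge0.
  apply: ge0_le_integral => //.
  - by move=> x _; rewrite lee_fin sqr_ge0.
  - apply/measurable_EFinP; apply: measurable_funX; apply: measurable_funB => //.
    by case: (h2 k).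
  - by apply: measurable_funeM; apply/measurable_EFinP.
  - move=> x _; rewrite -EFinM lee_fin subr0 /h mulrA exprMn.
    apply: ler_pM; rewrite ?sqr_ge0//.
      rewrite -(real_normK (num_real (_ * _))) lerXn2r ?nnegrE ?mulr_ge0//.
      by rewrite normrM (ger0_norm c0) ler_wpM2r.
    have -> : grad (phi k) x ord0 i - Du x ord0 i = (grad (phi k) x - Du x) ord0 i.
      by rewrite [RHS]mxE [X in _ = _ + X]mxE.
    exact: coord_le_enorm.
apply: (@cvg_Rintegral_bdM _ _ _ _ _ mO g ck (fun k x => phi k x - u x) (C * (c + 2))) => //.
- by rewrite mulr_ge0// addr_ge0.
- move=> k x _; rewrite (le_trans (G'L _ _))// -mulrA ler_wpM2l//.
  have -> : c * phi k x - w x - (c * u x - w x) = c * (phi k x - u x) by ring.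
  by rewrite normrM (ger0_norm c0) ler_wpM2r// lerDl.
- by move=> k; exact: (L2B mO (phi2 k) u2).
Unshelve. all: by end_near.
Qed.
End approximation.

(** * Time averages *)

Section parametric.
Context d1 d2 (T1 : measurableType d1) (T2 : measurableType d2) (R : realType).
Variable m2 : {sigma_finite_measure set T2 -> \bar R}.

Lemma measurable_Rintegral_param (f : T1 * T2 -> R) : measurable_fun setT f ->
  measurable_fun setT (fun x => \int[m2]_y f (x, y)).
Proof.
move=> mf; have mfE : measurable_fun setT (EFin \o f) by exact/measurable_EFinP.
apply: measurableT_comp; first exact: fine_measurable.
rewrite (_ : (fun x => _) = (fun x => \int[m2]_y ((EFin \o f)^\+ (x, y)) -
    \int[m2]_y ((EFin \o f)^\- (x, y)))%E).
  apply: emeasurable_funB.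
    apply: measurable_fun_fubini_tonelli_F => //; exact: measurable_funepos.
  apply: measurable_fun_fubini_tonelli_F => //; exact: measurable_funeneg.
apply/funext => x; rewrite integralE; congr (_ - _)%E.
  by apply: eq_integral => y _; rewrite !funeposE.
by apply: eq_integral => y _; rewrite !funenegE.
Qed.

End parametric.

Section cauchy.
Context d2 (T2 : measurableType d2) (R : realType).
Variable m2 : {measure set T2 -> \bar R}.

(** Expand the integral of the squared deviation of [f] from its mean. A null domain is treated
    apart, since the mean divides by the measure. *)
Lemma Rintegral_Cauchy (D : set T2) (f : T2 -> R) : measurable D -> (m2 D < +oo)%E ->
  L2 m2 D f -> (\int[m2]_(y in D) f y) ^+ 2 <= fine (m2 D) * \int[m2]_(y in D) (f y ^+ 2).
Proof.
move=> mD Doo f2; have fi := integrable_L2 mD Doo f2.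
have [mf f2i] := f2.
have [D0|D0] := eqVneq (fine (m2 D)) 0.
  have I0 : \int[m2]_(y in D) f y = 0.
    transitivity (\int[m2]_(y in D) (0 : R)); last by rewrite Rintegral_cst// mul0r.
    apply: (eq_Rintegral_ae mD) => //; exists D; split => //.
      by rewrite -(@fineK _ (m2 D)) ?ge0_fin_numE// D0.
    by move=> y /= /not_implyP[].
  by rewrite I0 D0 mul0r expr0n.
have mD0 : 0 < fine (m2 D) by rewrite lt_neqAle eq_sym D0 fine_ge0.
set k := fine (m2 D) in mD0 *; set I1 := \int[m2]_(y in D) f y.
set I2 := \int[m2]_(y in D) (f y ^+ 2).
have ic : m2.-integrable D (EFin \o (fun=> (I1 / k) ^+ 2)).
  by apply: (@integrable_bd _ _ _ _ _ mD _ `|(I1 / k) ^+ 2|) => //; exact: measurable_cst.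
have : 0 <= \int[m2]_(y in D) ((f y - I1 / k) ^+ 2).
  by apply: Rintegral_ge0 => y _; exact: sqr_ge0.
have -> : \int[m2]_(y in D) ((f y - I1 / k) ^+ 2) =
    \int[m2]_(y in D) ((f y ^+ 2 + (- (2 * (I1 / k))) * f y) + (I1 / k) ^+ 2).
  by apply: eq_Rintegral => y _; ring.
have iZ := integrableRZ mD (- (2 * (I1 / k))) fi.
rewrite (RintegralD mD (integrableRD mD f2i iZ) ic) (RintegralD mD f2i iZ).
rewrite (Rintegral_scale mD _ fi) Rintegral_cst// -/I1 -/I2 -/k => H.
have E : I2 + - (2 * (I1 / k)) * I1 + (I1 / k) ^+ 2 * k = k^-1 * (k * I2 - I1 ^+ 2).
  by field; rewrite gt_eqF.
by move: H; rewrite E pmulr_rge0 ?invr_gt0// subr_ge0.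
Qed.
End cauchy.

Section convergence_set.
Context d (X : measurableType d) (R : realType).

Lemma measurable_cvg_set (u : nat -> X -> R) (l : X -> R) :
  (forall k, measurable_fun setT (u k)) -> measurable_fun setT l ->
  measurable [set x | u k x @[k --> \oo] --> l x].
Proof.
move=> mu ml.
have -> : [set x | u k x @[k --> \oo] --> l x] =
    \bigcap_i \bigcup_j \bigcap_k [set x | `|l x - u (j + k)%N x| <= i.+1%:R^-1].
  apply/seteqP; split => x /=.
    move=> /cvgrPdist_le H i _; have [|N _ HN] := H i.+1%:R^-1; first by rewrite invr_gt0.
    by exists N => // k _; apply: HN; rewrite /= leq_addr.
  move=> H; apply/cvgrPdist_le => e e0.
  have [N _ HN] := H (Num.truncn e^-1) I.
  exists N => // k /= Nk; have := HN (k - N)%N I; rewrite /= subnKC// => /le_trans; apply.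
  by rewrite invf_ple ?posrE// ltW// truncnS_gt.
apply: bigcap_measurable => // i _; apply: bigcup_measurable => // j _.
apply: bigcap_measurable => // k _.
rewrite -[X in measurable X]setTI.
have -> : [set x | `|l x - u (j + k)%N x| <= i.+1%:R^-1] =
    (fun x => `|l x - u (j + k)%N x|) @^-1` `]-oo, i.+1%:R^-1]%classic.
  by apply/seteqP; split => x /=; rewrite in_itv.
have mn : measurable_fun setT (fun x => `|l x - u (j + k)%N x|).
  by apply: measurableT_comp => //; exact: measurable_funB.
exact: mn.
Qed.

Lemma cvg_backward_quotient (F : R -> R) (t l : R) : is_derive t 1 F l ->
  k.+1%:R * (F t - F (t - k.+1%:R^-1)) @[k --> \oo] --> l.
Proof.
move=> [dF Fl].
have H : h^-1 *: ((F \o shift t) (h *: (1 : R)) - F t) @[h --> 0^'] --> l by rewrite -Fl.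
have mk : - k.+1%:R^-1 @[k --> \oo] --> (0 : R)^'.
  move=> A; rewrite /nbhs /= => A0.
  have : \forall h \near (0 : R), h != 0 -> A h by exact: A0.
  move=> A1; have c0 : - k.+1%:R^-1 @[k --> \oo] --> (0 : R).
    by rewrite -[X in _ --> X]oppr0; apply: cvgN; exact: cvg_harmonic.
  have cA : \forall k \near \oo, (- k.+1%:R^-1 : R) != 0 -> A (- k.+1%:R^-1) := c0 _ A1.
  by apply: filterS cA => k; apply; rewrite oppr_eq0 invr_eq0 pnatr_eq0.
have := cvg_comp _ _ mk H; apply: cvg_trans; apply: near_eq_cvg; near=> k.
rewrite /= /GRing.scale /= mulr1 invrN invrK mulNr -mulrN opprB.
by rewrite [- _ + t]addrC.
Unshelve. all: by end_near.
Qed.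
End convergence_set.

Section time_average.
Context d (X : measurableType d) (R : realType).
Variable m : {sigma_finite_measure set X -> \bar R}.
Local Notation mu1 := (@lebesgue_measure R).
Local Notation mutx := (mu1 \x m)%E.
Variables (T : R) (D : set X).
Hypothesis mD : measurable D.
Let Q : set (measurableTypeR R * X) := `]0, T[%classic `*` D.
Let mQ : measurable Q.
Proof. by apply: (@measurableX _ _ (measurableTypeR R) X `]0, T[%classic D). Qed.

(* [f] is extended by 0, so that [tavg h f] is an honest mean only where [h < p.1 < T]. *)
Definition tavg (h : R) (f : measurableTypeR R * X -> R) (p : measurableTypeR R * X) : R :=
  h^-1 * \int[mu1]_(s in `](p.1 - h), p.1[) (f \_ Q) (s, p.2).

Variable f : measurableTypeR R * X -> R.
Hypothesis mf : measurable_fun Q f.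

Let fQ := f \_ Q.
Let mfQ : measurable_fun setT fQ.
Proof. exact: ((measurable_restrictT f mQ).1 mf). Qed.

(** The indicator is kept as a function of both times, because Tonelli's theorem integrates it over
    [t] with [s] fixed as well as the other way round. *)
Definition window (h t s : R) : R := if (t - h < s) && (s < t) then 1 else 0.

Lemma windowE h t s (r : R) :
  (if s \in (`](t - h), t[%classic : set R) then r else 0) = window h t s * r.
Proof.
by rewrite /window mem_setE in_itv /=; case: ifP; rewrite ?mul1r ?mul0r.
Qed.

Let tavgE h p : tavg h f p = h^-1 * \int[mu1]_s (window h p.1 s * fQ (s, p.2)).
Proof.
rewrite /tavg Rintegral_mkcond; congr (_ * _); apply: eq_Rintegral => s _.
by rewrite patchE -windowE.
Qed.

Let mwin h : measurable_fun setT
  (fun q : (measurableTypeR R * X) * measurableTypeR R => window h q.1.1 q.2).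
Proof.
have m11 : measurable_fun setT (fun q : (measurableTypeR R * X) * measurableTypeR R => q.1.1).
  exact: (measurableT_comp measurable_fst measurable_fst).
have m2 : measurable_fun setT (fun q : (measurableTypeR R * X) * measurableTypeR R => q.2).
  exact: measurable_snd.
apply: measurable_fun_ifT; [|exact: measurable_cst|exact: measurable_cst].
apply: measurable_and; apply: measurable_fun_ltr => //.
by apply: measurable_funB => //; exact: measurable_cst.
Qed.

Let mfQq : measurable_fun setT
  (fun q : (measurableTypeR R * X) * measurableTypeR R => fQ (q.2, q.1.2)).
Proof.
apply: (measurableT_comp mfQ).
apply/measurable_fun_pairP; split; first exact: measurable_snd.
exact: (measurableT_comp measurable_snd measurable_fst).
Qed.

Lemma measurable_tavg h : measurable_fun setT (tavg h f).
Proof.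
rewrite (_ : tavg h f = fun p => h^-1 * \int[mu1]_s (window h p.1 s * fQ (s, p.2))); last first.
  by apply/funext => p; exact: tavgE.
apply: measurable_funM => //.
apply: (@measurable_Rintegral_param _ _ _ _ _ mu1
  (fun q : (measurableTypeR R * X) * measurableTypeR R => window h q.1.1 q.2 * fQ (q.2, q.1.2))).
exact: (measurable_funM (mwin h) mfQq).
Qed.

Let mfQ2 x : measurable_fun [set: measurableTypeR R] (fun s => fQ (s, x)).
Proof. exact: (measurableT_comp mfQ (measurable_pair2 x)). Qed.

Let lebesgue_win (h t : R) : 0 < h -> fine (mu1 `](t - h), t[%classic) = h.
Proof.
move=> h0; rewrite lebesgue_measure_itv/= lte_fin ltrBlDr ltrDl h0/=; ring.
Qed.

Let tavg_sqr h p : 0 < h ->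
  ((tavg h f p ^+ 2)%:E <= h^-1%:E * \int[mu1]_s (window h p.1 s * fQ (s, p.2) ^+ 2)%:E)%E.
Proof.
move=> h0; pose W : set (measurableTypeR R) := `](p.1 - h), p.1[%classic.
have mW : measurable W by exact: measurable_itv.
have -> : (\int[mu1]_s (window h p.1 s * fQ (s, p.2) ^+ 2)%:E =
    \int[mu1]_(s in W) (fQ (s, p.2) ^+ 2)%:E)%E.
  rewrite [RHS]integral_mkcond; apply: eq_integral => s _.
  by rewrite patchE /W -windowE; case: ifP.
have I0 : (0 <= \int[mu1]_(s in W) (fQ (s, p.2) ^+ 2)%:E)%E.
  by apply: integral_ge0 => s _; rewrite lee_fin sqr_ge0.
have [Ioo|] := eqVneq (\int[mu1]_(s in W) (fQ (s, p.2) ^+ 2)%:E)%E +oo%E.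
  by rewrite Ioo gt0_muley ?leey// lte_fin invr_gt0.
rewrite -ltey => Ilty.
have f2 : L2 mu1 W (fun s => fQ (s, p.2)).
  split; first exact: measurable_funTS.
  apply/integrableP; split.
    by apply/measurable_EFinP; apply: measurable_funX; exact: measurable_funTS.
  by under eq_integral do rewrite gee0_abs ?lee_fin ?sqr_ge0//.
have Woo : (mu1 W < +oo)%E by exact: lebesgue_oo_lty.
have := Rintegral_Cauchy mW Woo f2.
rewrite (lebesgue_win _ h0) => C.
rewrite -(@fineK _ (\int[mu1]_(s in W) (fQ (s, p.2) ^+ 2)%:E)%E) ?ge0_fin_numE//.
rewrite -EFinM lee_fin /tavg exprMn expr2 -mulrA ler_wpM2l ?invr_ge0 ?(ltW h0)//.
by rewrite ler_pdivrMl.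
Qed.

Let integral_window h s (c : R) : 0 < h -> 0 <= c ->
  (\int[mu1]_t (window h t s * c)%:E = (h * c)%:E)%E.
Proof.
move=> h0 c0.
have -> : (\int[mu1]_t (window h t s * c)%:E = \int[mu1]_(t in `]s, (s + h)%R[%classic) c%:E)%E.
  rewrite [RHS]integral_mkcond; apply: eq_integral => t _.
  rewrite patchE /window mem_setE in_itv/= ltrBlDr andbC.
  by case: ifP; rewrite ?mul1r ?mul0r.
rewrite integral_cst//= lebesgue_measure_itv/= lte_fin ltrDl h0.
by rewrite -EFinB -EFinM; congr (_%:E); ring.
Qed.

(** Cauchy-Schwarz on a window of length [h] bounds the square of the mean by the mean of the square
    ([tavg_sqr]). After exchanging the integrals, each [s] lies in the windows of a set of times [t]
    of length [h], which cancels [h^-1]. *)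
Lemma integral_tavg_sqr h : 0 < h ->
  (\int[mutx]_p (tavg h f p ^+ 2)%:E <= \int[mutx]_p (fQ p ^+ 2)%:E)%E.
Proof.
move=> h0.
pose g q := (window h q.1.1 q.2 * fQ (q.2, q.1.2) ^+ 2)%:E : \bar R.
have g0 q : (0 <= g q)%E.
  by rewrite /g lee_fin mulr_ge0 ?sqr_ge0// /window; case: ifP.
have mg : measurable_fun setT
    (g : (measurableTypeR R * X) * measurableTypeR R -> \bar R).
  apply/measurable_EFinP; apply: measurable_funM; first exact: mwin.
  exact: (measurable_funX _ mfQq).
have mG : measurable_fun setT (fun p => \int[mu1]_s g (p, s))%E.
  exact: (measurable_fun_fubini_tonelli_F (m2 := mu1) g).
apply: (@le_trans _ _ (\int[mutx]_p (h^-1%:E * \int[mu1]_s g (p, s)))%E).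
  apply: ge0_le_integral => //.
  - by move=> p _; rewrite lee_fin sqr_ge0.
  - by apply/measurable_EFinP; apply: measurable_funX; exact: measurable_tavg.
  - exact: measurable_funeM.
  - by move=> p _; exact: tavg_sqr.
rewrite ge0_integralZl//; last 2 first.
- by move=> p _; apply: integral_ge0.
- by rewrite lee_fin invr_ge0 ltW.
have mfsqr : measurable_fun setT (fun p => (fQ p ^+ 2)%:E).
  by apply/measurable_EFinP; exact: measurable_funX.
have mGf : measurable_fun setT (fun x => \int[mu1]_s (fQ (s, x) ^+ 2)%:E)%E.
  apply: (measurable_fun_fubini_tonelli_G (m1 := mu1) (fun p => (fQ p ^+ 2)%:E)) => //.
  by move=> p; rewrite lee_fin sqr_ge0.
rewrite (fubini_tonelli2 (m1 := mu1) (m2 := m) (fun p => \int[mu1]_s g (p, s))%E)//; last first.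
  by move=> p; exact: integral_ge0.
rewrite (fubini_tonelli2 (m1 := mu1) (m2 := m) (fun p => (fQ p ^+ 2)%:E))//; last first.
  by move=> p; rewrite lee_fin sqr_ge0.
have -> : (\int[m]_x \int[mu1]_t \int[mu1]_s g ((t, x), s) =
    \int[m]_x (h%:E * \int[mu1]_s (fQ (s, x) ^+ 2)%:E))%E.
  apply: eq_integral => x _.
  pose k (q : measurableTypeR R * measurableTypeR R) := g ((q.1, x), q.2).
  have mk : measurable_fun setT k.
    apply: (measurableT_comp mg).
    apply/measurable_fun_pairP; split; last exact: measurable_snd.
    apply/measurable_fun_pairP; split; first exact: measurable_fst.
    exact: measurable_cst.
  have := @fubini_tonelli _ _ _ _ _ mu1 mu1 k mk (fun q => g0 _).
  rewrite /k /= => ->.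
  have mfs : measurable_fun [set: measurableTypeR R] (fun s => (fQ (s, x) ^+ 2)%:E).
    by apply/measurable_EFinP; apply: measurable_funX; exact: mfQ2.
  rewrite -ge0_integralZl//; last 2 first.
  - by move=> s _; rewrite lee_fin sqr_ge0.
  - by rewrite lee_fin ltW.
  apply: eq_integral => s _; rewrite /g /= integral_window ?sqr_ge0//.
rewrite ge0_integralZl//; last 2 first.
- by move=> x _; apply: integral_ge0 => s _; rewrite lee_fin sqr_ge0.
- by rewrite lee_fin ltW.
by rewrite muleA -EFinM mulVf ?gt_eqF// mul1e.
Qed.

Hypothesis f2 : L2 mutx Q f.

Lemma L2_tavg h : 0 < h -> L2 mutx Q (tavg h f).
Proof.
move=> h0; split; first exact: measurable_funTS (measurable_tavg h).
apply: (integrableS (E := setT)) => //.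
apply/integrableP; split.
  by apply/measurable_EFinP; apply: measurable_funX; exact: measurable_tavg.
under eq_integral do rewrite gee0_abs ?lee_fin ?sqr_ge0//.
apply: le_lt_trans (integral_tavg_sqr h0) _.
have [_ /integrableP[_]] := f2.
rewrite integral_mkcond => H; apply: le_lt_trans H.
rewrite le_eqVlt; apply/orP; left; apply/eqP; apply: eq_integral => p _.
rewrite /fQ !patchE; case: ifP => _; last by rewrite expr0n.
by rewrite gee0_abs// lee_fin sqr_ge0.
Qed.

Lemma Rintegral_tavg_sqr h : 0 < h ->
  \int[mutx]_(p in Q) (tavg h f p ^+ 2) <= \int[mutx]_(p in Q) (f p ^+ 2).
Proof.
move=> h0; have [_ ti] := L2_tavg h0; have [_ fi] := f2.
apply: fine_le.
- by have := integrable_fin_num mQ ti.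
- by have := integrable_fin_num mQ fi.
apply: (@le_trans _ _ (\int[mutx]_p (tavg h f p ^+ 2)%:E)%E).
  apply: ge0_subset_integral => //.
  - by apply/measurable_EFinP; apply: measurable_funX; exact: measurable_tavg.
  - by move=> p _; rewrite lee_fin sqr_ge0.
apply: le_trans (integral_tavg_sqr h0) _.
rewrite [leRHS]integral_mkcond le_eqVlt; apply/orP; left; apply/eqP; apply: eq_integral => p _.
by rewrite /fQ !patchE; case: ifP => // _; rewrite expr0n.
Qed.

Hypothesis fi : mutx.-integrable Q (EFin \o f).

Let tavg_primitive x : mu1.-integrable setT (EFin \o (fun s => fQ (s, x))) ->
  forall h t, 0 < h -> tavg h f (t, x) = h^-1 *
    (\int[mu1]_(s in `]-oo, t]) fQ (s, x) - \int[mu1]_(s in `]-oo, t - h]) fQ (s, x)).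
Proof.
move=> gi h t h0; rewrite /tavg /= -/fQ; congr (_ * _).
have giS (A : set R) : measurable A -> mu1.-integrable A (EFin \o (fun s => fQ (s, x))).
  by move=> mA; apply: integrableS gi.
rewrite Rintegral_itvB//.
- by apply: Rintegral_itv_bndo_bndc; exact: giS.
- exact: giS.
- by rewrite bnd_simp gerBl ltW.
Qed.

(** Lebesgue differentiation on the lines of constant [x]: almost every section is integrable, and
    at almost every time the mean is a backward difference quotient of its primitive. Measurability
    of the set of convergence allows the return to the product measure. *)
Lemma cvg_tavg : {ae mutx, forall p, Q p -> tavg k.+1%:R^-1 f p @[k --> \oo] --> f p}.
Proof.
have fQi : mutx.-integrable setT (EFin \o fQ).
  rewrite /fQ (_ : _ \o _ = (EFin \o f) \_ Q); last by rewrite restrict_EFin.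
  by apply/(integrable_mkcond _ mQ).1.
suff : {ae mutx, forall p, tavg k.+1%:R^-1 f p @[k --> \oo] --> fQ p}.
  apply: filterS => p H Qp; move: H; rewrite /fQ patchE.
  by case: ifPn => //; rewrite notin_setE.
apply: ae_of_sect2.
  rewrite (_ : [set p | _] = ~` [set p | tavg k.+1%:R^-1 f p @[k --> \oo] --> fQ p]) //.
  apply: measurableC; apply: measurable_cvg_set => // k; exact: measurable_tavg.
apply: filterS (ae_integrable2 fQi) => x gi.
have giS (A : set R) : measurable A -> mu1.-integrable A (EFin \o (fun s => fQ (s, x))).
  by move=> mA; apply: integrableS gi.
have loc : locally_integrable [set: R] (fun s => fQ (s, x)).
  by apply: open_integrable_locally => //; exact: openT.
have [N [mN N0 PN]] := @FTC1Ny R (fun s => fQ (s, x)) (fun y => giS _ (measurable_itv _)) loc.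
exists N; split => // t nP; apply: PN; apply: contra_not nP => -[dF Ft].
have H : is_derive t 1 (fun y => \int[mu1]_(s in `]-oo, y]) fQ (s, x)) (fQ (t, x)).
  by rewrite derive1E in Ft; exact: (DeriveDef dF Ft).
have := cvg_backward_quotient H; apply: cvg_trans; apply: near_eq_cvg; near=> k.
by rewrite tavg_primitive// invrK.
Unshelve. all: by end_near.
Qed.
End time_average.

(** * The energy identity for time averages *)

Section fubini_weight.
Context d1 d2 (T1 : measurableType d1) (T2 : measurableType d2) (R : realType).
Variables (m1 : {sigma_finite_measure set T1 -> \bar R}).
Variables (m2 : {sigma_finite_measure set T2 -> \bar R}).
Variables (A : set T1) (D : set T2).
Hypotheses (mA : measurable A) (mD : measurable D).
Local Notation m12 := (m1 \x m2)%E.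

Lemma measurable_comp_snd (g : T2 -> R) : measurable_fun D g ->
  measurable_fun (A `*` D) (fun p => g p.2).
Proof.
move=> mg; apply: (@measurable_comp _ _ _ _ _ _ D g (A `*` D) snd) => //.
- by move=> _ [p [_ Dp] <-].
- exact: measurable_funTS measurable_snd.
Qed.

Lemma Rintegral_weight2 (f : T1 * T2 -> R) (g : T2 -> R) C :
  m12.-integrable (A `*` D) (EFin \o f) -> measurable_fun D g ->
  (forall y, D y -> `|g y| <= C) ->
  \int[m12]_(p in A `*` D) (f p * g p.2) =
  \int[m2]_(y in D) ((\int[m1]_(s in A) f (s, y)) * g y).
Proof.
move=> fi mg gC; have mAD : measurable (A `*` D) by exact: measurableX.
have fgi : m12.-integrable (A `*` D) (EFin \o (fun p => f p * g p.2)).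
  have := @integrable_Mbd _ _ _ m12 _ mAD f (fun p => g p.2) C fi (measurable_comp_snd mg).
  have H p : (A `*` D) p -> `|g p.2| <= C by move=> [_]; exact: gC.
  by move=> /(_ H); congr (_.-integrable _ _); apply/funext => p /=; rewrite mulrC.
rewrite (Rintegral_sect2 mA mD fgi).
have i1 := integrable_sect2 mA mD fgi; have i2 := integrable_sect2 mA mD fi.
apply: (eq_Rintegral_ae mD).
- by apply/measurable_EFinP; exact: measurable_int i1.
- by apply: measurable_funM => //; apply/measurable_EFinP; exact: measurable_int i2.
apply: filterS (ae_integrable_sect2 mA mD fi) => y fy Dy.
rewrite mulrC -(Rintegral_scale mA _ (fy Dy)).
by apply: eq_Rintegral => s _; rewrite mulrC.
Qed.
End fubini_weight.

Section green.
Context {R : realType} {n : nat}.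
Local Notation mu := (@lebesgue_rV R n).
Variables (Omega : set 'rV[R]_n).
Hypotheses (oO : open Omega) (bO : bounded_set Omega).

Lemma test_function_grad_zero (f : 'rV[R]_n -> R) i : test_function Omega f ->
  forall x, ~ Omega x -> grad f x ord0 i = 0.
Proof.
move=> [_ _ fO] x nOx; rewrite mxE.
have nx : nbhs x (~` closure [set x | f x != 0]).
  apply: open_nbhs_nbhs; split; first by apply: closed_openC; exact: closed_closure.
  by move=> /fO.
have H : \forall y \near x, (fun=> 0 : R) y = f y.
  apply: filterS nx => y; apply: contra_notP => fy; apply: subset_closure => /=.
  by apply/eqP => fy0; apply: fy; rewrite fy0.
by rewrite -(near_eq_derive (delta_mx ord0 i) H); exact: derive_cst.
Qed.

(** The product rule and [integral_partial0]: the product of [psi] with the partial derivative of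
    [w] vanishes outside [Omega], so no boundary term appears. *)
Lemma green_test (w psi : 'rV[R]_n -> R) i : smooth w -> test_function Omega psi ->
  \int[mu]_(x in Omega) (grad w x ord0 i * grad psi x ord0 i) =
  - \int[mu]_(x in Omega) (grad (fun y => grad w y ord0 i) x ord0 i * psi x).
Proof.
move=> sw tpsi; have mO := open_measurable_rV oO.
have [spsi _ _] := tpsi; have sg := smooth_grad i sw; have sgg := smooth_grad i sg.
have sgp := smooth_grad i spsi.
pose F x := grad w x ord0 i * psi x.
pose F' x := grad w x ord0 i * grad psi x ord0 i + psi x * grad (fun y => grad w y ord0 i) x ord0 i.
have dF x : is_derive x (delta_mx ord0 i) F (F' x).
  exact: is_deriveM (is_derive_grad i x sg) (is_derive_grad i x spsi).
have [C OC] := bounded_setP_rV bO.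
have out (x : 'rV[R]_n) : (exists j, C < `|x ord0 j|) -> ~ Omega x.
  by move=> [j Cj] /OC; apply/negP; rewrite -ltNge (lt_le_trans Cj)// ler_coord_rV.
have F'0 x : ~ Omega x -> F' x = 0.
  move=> nO; rewrite /F' (test_function_zero tpsi nO) (test_function_grad_zero i tpsi nO).
  by rewrite mulr0 mul0r addr0.
have cF' : continuous F'.
  have [c1 _ _] := smoothP sg; have [c2 _ _] := smoothP sgp.
  have [c3 _ _] := smoothP spsi; have [c4 _ _] := smoothP sgg.
  by apply: contD; apply: contM.
have I0 : \int[mu]_(x in Omega) F' x = 0.
  rewrite -(@Rintegral_restrict _ _ _ mu setT F' Omega (@subsetT _ _)); last by move=> x _; exact: F'0.
  rewrite /Rintegral (@integral_partial0 R n F F' i C)// => x /out nO; last exact: F'0.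
  by rewrite /F (test_function_zero tpsi nO) mulr0.
have i1 := integrable_L2M mO (smooth_L2 sg oO bO) (smooth_L2 sgp oO bO).
have i2 := integrable_L2M mO (smooth_L2 spsi oO bO) (smooth_L2 sgg oO bO).
apply/eqP; rewrite -addr_eq0; apply/eqP; rewrite -[RHS]I0 (RintegralD mO i1 i2).
by congr (_ + _); apply: eq_Rintegral => x _; rewrite mulrC.
Qed.
End green.

Section green_limit.
Context {R : realType} {n : nat}.
Local Notation mu := (@lebesgue_rV R n).
Variables (Omega : set 'rV[R]_n) (u : 'rV[R]_n -> R) (Du : 'rV[R]_n -> 'rV[R]_n).
Variables (c : R) (w : 'rV[R]_n -> R).
Hypotheses (oO : open Omega) (bO : bounded_set Omega) (uH : H10 Omega u Du).
Hypotheses (c0 : 0 <= c) (sw : smooth w) (w0 : forall x, 0 <= w x).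

Lemma green_H10 i :
  \int[mu]_(x in Omega)
    (grad w x ord0 i * (gG' (c * u x - w x) * (c * Du x ord0 i - grad w x ord0 i))) =
  - \int[mu]_(x in Omega) (grad (fun y => grad w y ord0 i) x ord0 i * gG (c * u x - w x)).
Proof.
have [psik tpsi H] := test_approximation oO bO uH c0 sw w0.
have sg := smooth_grad i sw.
have [_ /(_ i) H1] := H _ (smooth_L2 sg oO bO).
have [/cvgN H2 _] := H _ (smooth_L2 (smooth_grad i sg) oO bO).
have E : (fun k => \int[mu]_(x in Omega) (grad w x ord0 i * grad (psik k) x ord0 i)) =
  - (fun k => \int[mu]_(x in Omega) (grad (fun y => grad w y ord0 i) x ord0 i * psik k x)).
  by apply/funext => k; rewrite green_test.
by rewrite E in H1; exact: (cvg_unique _ H1 H2).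
Qed.
End green_limit.

Section energy_identity.
Context {R : realType} {n : nat}.
Local Notation mu := (@lebesgue_rV R n).
Local Notation mu1 := (@lebesgue_measure R).
Local Notation mutx := (mu1 \x mu)%E.
Variables (Omega : set 'rV[R]_n) (alpha beta lambda M T : R).
Variables (v : R -> 'rV[R]_n -> R) (Dv : R -> 'rV[R]_n -> 'rV[R]_n).
Hypotheses (oO : open Omega) (bO : bounded_set Omega).
Hypotheses (alpha0 : 0 < alpha) (beta0 : 0 < beta).
Hypothesis vm : measurable_fun (cylinder `]0, +oo[ Omega) (fun p => v p.1 p.2).
Hypothesis vb : {ae mutx, forall p, cylinder `]0, +oo[ Omega p -> 0 <= v p.1 p.2 <= M}.
Hypothesis v2 : forall t, 0 <= t -> L2 mu Omega (v t).
Hypothesis vc : forall t, 0 <= t ->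
  (\int[mu]_(x in Omega) ((v s x - v t x) ^+ 2)%:E)%E
      @[s --> within `[0, +oo[%classic (nbhs t)] --> 0%E.
Hypothesis Dv2 : forall i, L2 mutx (cylinder `]0, T[ Omega) (fun p => Dv p.1 p.2 ord0 i).
Hypothesis veq : forall phi : R * 'rV[R]_n -> R,
  test_function (cylinder `]0, +oo[ Omega) phi ->
  \int[mutx]_(p in cylinder `]0, +oo[ Omega)
     (- (v p.1 p.2 * dt phi p) + dot (Dv p.1 p.2) (grad_x phi p)
      + `|v p.1 p.2| `^ (alpha - 1) * v p.1 p.2 * phi p)
  = lambda * \int[mutx]_(p in cylinder `]0, +oo[ Omega)
     (`|v p.1 p.2| `^ (beta - 1) * v p.1 p.2 * phi p).

Let mO : measurable Omega := open_measurable_rV oO.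
Let Ooo : (mu Omega < +oo)%E := bounded_lebesgue_rV mO bO.
Let Q : set (measurableTypeR R * 'rV[R]_n) := cylinder `]0, T[ Omega.
Let mI : measurable (`]0, T[%classic : set (measurableTypeR R)).
Proof. exact: measurable_itv. Qed.
Let mQ : measurable Q.
Proof. by rewrite /Q cylinderE; exact: (measurableX mI mO). Qed.
Let QQ : Q `<=` cylinder `]0, +oo[ Omega.
Proof. by move=> p [p0 Op]; split => //; move: p0; rewrite /= !in_itv/= andbT => /andP[]. Qed.
Let Qlty : (mutx Q < +oo)%E.
Proof.
rewrite /Q cylinderE product_measure1E// lte_mul_pinfty//.
  by rewrite ge0_fin_numE//; exact: lebesgue_oo_lty.
Qed.

Definition Dv_coord i (p : measurableTypeR R * 'rV[R]_n) := Dv p.1 p.2 ord0 i.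
Definition source (p : measurableTypeR R * 'rV[R]_n) := reaction alpha beta lambda (v p.1 p.2).

Lemma measurable_source : measurable_fun Q source.
Proof.
have mv : measurable_fun Q (fun p => v p.1 p.2).
  by apply: (measurable_funS _ QQ vm); rewrite cylinderE; exact: measurableX.
exact: (measurableT_comp (measurable_reaction alpha beta lambda) mv).
Qed.

Lemma source_bounded : {ae mutx, forall p, Q p ->
  `|source p| <= `|lambda| * M `^ beta + M `^ alpha}.
Proof.
apply: filterS vb => p vp Qp; have /andP[v0 vM] := vp (QQ Qp).
by apply: reaction_bd => //; rewrite ger0_norm.
Qed.

Lemma source_L2 : L2 mutx Q source.
Proof.
split; first exact: measurable_source.
apply: (@integrable_ae_bd _ _ _ _ _ mQ (fun p => source p ^+ 2)
  ((`|lambda| * M `^ beta + M `^ alpha) ^+ 2)) => //.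
  by apply: measurable_funX; exact: measurable_source.
apply: filterS source_bounded => p sp Qp; rewrite normrX lerXn2r ?nnegrE ?sp//.
by rewrite addr_ge0 ?mulr_ge0 ?powR_ge0.
Qed.

Variables (h t : R).
Hypotheses (h0 : 0 < h) (ht : h < t) (tT : t < T).
Let W : set (measurableTypeR R) := `](t - h), t[%classic.
Let mW : measurable W. Proof. exact: measurable_itv. Qed.
Let WI : W `<=` `]0, T[%classic.
Proof.
move=> s; rewrite /W /= !in_itv /= => /andP[s1 s2].
by rewrite (le_lt_trans _ s1) ?subr_ge0 ?(ltW ht)// (lt_trans s2).
Qed.
Let WQ : W `*` Omega `<=` Q.
Proof. by move=> p [/= /WI pI Op]. Qed.

Let tavgE f x : Omega x -> tavg T Omega h f (t, x) = h^-1 * \int[mu1]_(s in W) f (s, x).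
Proof.
move=> Ox; rewrite /tavg; congr (_ * _); apply: eq_Rintegral => s; rewrite inE /= => Ws.
by rewrite patchE mem_set//; split => //=; exact: WI.
Qed.

Hypothesis AL2 : forall i, L2 mu Omega (fun x => tavg T Omega h (Dv_coord i) (t, x)).
Hypothesis FL2 : L2 mu Omega (fun x => tavg T Omega h source (t, x)).

(** [time_identity] on the window []t - h, t[]. As [psi] does not depend on time, exchanging the
    integrals replaces [Dv] and the source by their time averages. *)
Let energy_test psi : test_function Omega psi ->
  h^-1 * (\int[mu]_(x in Omega) (v t x * psi x) - \int[mu]_(x in Omega) (v (t - h) x * psi x)) =
  - \sum_i \int[mu]_(x in Omega) (tavg T Omega h (Dv_coord i) (t, x) * grad psi x ord0 i) +
  \int[mu]_(x in Omega) (tavg T Omega h source (t, x) * psi x).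
Proof.
move=> tpsi; have [spsi _ _] := tpsi.
have th0 : 0 < t - h by rewrite subr_gt0.
have tht : t - h < t by rewrite gtrBl.
have := time_identity oO bO alpha0 beta0 vm vb v2 vc Dv2 veq tpsi th0 tht tT.
under eq_Rintegral do rewrite mulrC.
under [X in _ - X]eq_Rintegral do rewrite mulrC.
move=> ->.
have mWO : measurable (W `*` Omega) by exact: measurableX.
have iD i : mutx.-integrable (W `*` Omega) (EFin \o Dv_coord i).
  by apply: (integrableS mQ mWO WQ); exact: (integrable_L2 mQ Qlty (Dv2 i)).
have iF : mutx.-integrable (W `*` Omega) (EFin \o source).
  by apply: (integrableS mQ mWO WQ); exact: (integrable_L2 mQ Qlty source_L2).
have gbd i := smooth_bounded (smooth_grad i spsi) bO.
have mg i : measurable_fun Omega (fun x => grad psi x ord0 i).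
  exact: measurable_funTS (smooth_measurable (smooth_grad i spsi)).
have [C _ psiC] := smooth_bounded spsi bO.
have mpsi : measurable_fun Omega psi by exact: measurable_funTS (smooth_measurable spsi).
have iDg i : mutx.-integrable (W `*` Omega)
    (EFin \o (fun p => Dv_coord i p * grad psi p.2 ord0 i)).
  have [Ci _ gC] := gbd i.
  have := @integrable_Mbd _ _ _ mutx _ mWO (Dv_coord i) (fun p => grad psi p.2 ord0 i) Ci (iD i)
    (measurable_comp_snd mO (mg i)).
  have H p : (W `*` Omega) p -> `|grad psi p.2 ord0 i| <= Ci by move=> [_]; exact: gC.
  by move=> /(_ H); congr (_.-integrable _ _); apply/funext => p /=; rewrite mulrC.
have iFp : mutx.-integrable (W `*` Omega) (EFin \o (fun p => source p * psi p.2)).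
  have := @integrable_Mbd _ _ _ mutx _ mWO source (fun p => psi p.2) C iF
    (measurable_comp_snd mO mpsi).
  have H p : (W `*` Omega) p -> `|psi p.2| <= C by move=> [_]; exact: psiC.
  by move=> /(_ H); congr (_.-integrable _ _); apply/funext => p /=; rewrite mulrC.
have isum := @integrableRsum _ _ _ _ _ mWO _ (index_enum _)
  (fun i p => Dv_coord i p * grad psi p.2 ord0 i) iDg.
have ig := integrableRB mWO isum iFp.
rewrite -(Rintegral_sect1 mW mO ig) (RintegralB mWO isum iFp).
rewrite (Rintegral_sum mWO _ iDg) (Rintegral_weight2 mW mO iF mpsi psiC).
rewrite opprB addrC mulrDr; congr (_ + _).
  rewrite mulrN mulr_sumr; congr (- _); apply: eq_bigr => i _.
  have [Ci _ gC] := gbd i; rewrite (Rintegral_weight2 mW mO (iD i) (mg i) gC).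
  have ia := integrable_L2M mO (AL2 i) (smooth_L2 (smooth_grad i spsi) oO bO).
  rewrite -[RHS](mulKf (lt0r_neq0 h0)) -(Rintegral_scale mO _ ia); congr (_ * _).
  apply: eq_Rintegral => x; rewrite inE => Ox.
  by rewrite tavgE// mulrA mulVKf// gt_eqF.
have ia := integrable_L2M mO FL2 (smooth_L2 spsi oO bO).
rewrite -[RHS](mulKf (lt0r_neq0 h0)) -(Rintegral_scale mO _ ia); congr (_ * _).
apply: eq_Rintegral => x; rewrite inE => Ox.
by rewrite tavgE// mulrA mulVKf// gt_eqF.
Qed.

Variables (c : R) (w : 'rV[R]_n -> R).
Hypotheses (uH : H10 Omega (v t) (Dv t)).
Hypotheses (c0 : 0 <= c) (sw : smooth w) (w0 : forall x, 0 <= w x).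

(** Both sides of [energy_test] are linear in [psi], with coefficients in L^2 that are fixed once
    [t] and [h] are. The weak convergence of [test_approximation] therefore suffices to insert
    [gG (c * v t - w)]. *)
Lemma energy_identity :
  h^-1 * \int[mu]_(x in Omega) ((v t x - v (t - h) x) * gG (c * v t x - w x)) =
  - \sum_i \int[mu]_(x in Omega) (tavg T Omega h (Dv_coord i) (t, x) *
       (gG' (c * v t x - w x) * (c * Dv t x ord0 i - grad w x ord0 i))) +
  \int[mu]_(x in Omega) (tavg T Omega h source (t, x) * gG (c * v t x - w x)).
Proof.
have [psik tpsi H] := test_approximation oO bO uH c0 sw w0.
have t0 : 0 <= t by rewrite ltW// (lt_trans h0).
have th0 : 0 <= t - h by rewrite subr_ge0 ltW.
have [vt2 _ _] := uH.
have psi2 : L2 mu Omega (fun x => gG (c * v t x - w x)).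
  apply: (@L2_bd _ _ _ _ _ mO _ 1) => //.
    apply: (measurableT_comp (continuous_measurable_fun (@continuous_gG R))).
    apply: measurable_funB; last exact: measurable_funTS (smooth_measurable sw).
    by apply: measurable_funM => //; case: vt2.
  by move=> x _; have /andP[g0 g1] := gG_itv (c * v t x - w x); rewrite ger0_norm.
have [H1 _] := H _ (v2 t0); have [H2 _] := H _ (v2 th0); have [H3 _] := H _ FL2.
have H4 i := (H _ (AL2 i)).2 i.
have L : (- \sum_i \int[mu]_(x in Omega)
        (tavg T Omega h (Dv_coord i) (t, x) * grad (psik k) x ord0 i) +
      \int[mu]_(x in Omega) (tavg T Omega h source (t, x) * psik k x)) @[k --> \oo] -->
    h^-1 * (\int[mu]_(x in Omega) (v t x * gG (c * v t x - w x)) -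
      \int[mu]_(x in Omega) (v (t - h) x * gG (c * v t x - w x))).
  under eq_cvg => k do rewrite -(energy_test (tpsi k)).
  by apply: cvgM; [exact: cvg_cst|exact: (cvgB H1 H2)].
have S : \sum_i \int[mu]_(x in Omega)
      (tavg T Omega h (Dv_coord i) (t, x) * grad (psik k) x ord0 i) @[k --> \oo] -->
    \sum_i \int[mu]_(x in Omega) (tavg T Omega h (Dv_coord i) (t, x) *
       (gG' (c * v t x - w x) * (c * Dv t x ord0 i - grad w x ord0 i))).
  by apply: cvg_big => [|i _]; [exact: add_continuous|exact: H4].
have i1 := integrable_L2M mO (v2 t0) psi2; have i2 := integrable_L2M mO (v2 th0) psi2.
have -> : \int[mu]_(x in Omega) ((v t x - v (t - h) x) * gG (c * v t x - w x)) =
  \int[mu]_(x in Omega) (v t x * gG (c * v t x - w x)) -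
  \int[mu]_(x in Omega) (v (t - h) x * gG (c * v t x - w x)).
  by rewrite -(RintegralB mO i1 i2); apply: eq_Rintegral => x _; rewrite mulrBl.
exact: (cvg_unique _ L (cvgD (cvgN S) H3)).
Qed.
End energy_identity.

(** * Comparison with a smooth supersolution *)

Section fatou.
Context d (T : measurableType d) (R : realType) (m : {measure set T -> \bar R}).
Variable D : set T.
Hypothesis mD : measurable D.

(* [Num.min (Sk k) S] converges to [S] and is dominated by [`|S|]. *)
Lemma Rintegral_fatou (Sk : nat -> T -> R) S (b : nat -> R) B :
  (forall k, m.-integrable D (EFin \o Sk k)) -> m.-integrable D (EFin \o S) ->
  {ae m, forall x, D x -> forall k, 0 <= Sk k x} ->
  {ae m, forall x, D x -> Sk k x @[k --> \oo] --> S x} ->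
  (forall k, \int[m]_(x in D) Sk k x <= b k) -> b k @[k --> \oo] --> B ->
  \int[m]_(x in D) S x <= B.
Proof.
move=> Ski Si Sk0 SkS Sb bB.
have mSk k : measurable_fun D (Sk k) by apply/measurable_EFinP; exact: measurable_int (Ski k).
have mS : measurable_fun D S by apply/measurable_EFinP; exact: measurable_int Si.
pose g k x := Num.min (Sk k x) (S x).
have mg k : measurable_fun D (g k) by exact: measurable_minr.
have mgE k : measurable_fun D (EFin \o g k) by exact/measurable_EFinP.
have cg : {ae m, forall x, D x -> (EFin \o g k) x @[k --> \oo] --> (EFin \o S) x}.
  apply: filterS SkS => x H Dx; apply: cvg_EFin; first by near=> k.
  apply/cvgrPdist_le => e e0; have := H Dx => /cvgrPdist_le/(_ e e0).
  apply: filterS => k /= Hk; rewrite /g; apply: le_trans Hk.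
  by rewrite minEle; case: ifPn => // _; rewrite subrr normr0.
have dom : {ae m, forall x k, D x -> (`|(EFin \o g k) x| <= (EFin \o (fun x => `|S x|%R)) x)%E}.
  apply: filterS Sk0 => x H k Dx; rewrite /= lee_fin /g.
  have := H Dx k; rewrite minEle; case: ifPn => // le1 S0; rewrite ger0_norm//.
  by rewrite (le_trans le1)// ler_norm.
have [_ _] := dominated_convergence mD mgE (measurable_int _ Si) cg (integrable_norm Si) dom.
rewrite -(fineK (integrable_fin_num mD Si)) => /fine_cvg H.
apply: (ler_cvg_to H bB); near=> k.
apply: le_trans (Sb k); apply: le_Rintegral => //.
  apply: (@le_integrableR _ _ _ _ _ mD (g k) (fun x => `|Sk k x| + `|S x|)) => //.
    by move=> x _; rewrite /g minEle; case: ifP => _; rewrite ?lerDl ?lerDr.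
  by apply: (integrableRD mD); exact: integrable_norm.
by move=> x _; rewrite /g ge_min lexx.
Unshelve. all: by end_near.
Qed.
End fatou.

Section mean_difference.
Context {R : realType}.
Local Notation mu1 := (@lebesgue_measure R).

(** The shifted integrals overlap: what remains is the mean of [Phi] over [[T - h, T]] minus its
    mean over [[0, h]], and continuity gives the two limits. *)
Lemma cvg_mean_difference (Phi : R -> R) (T : R) : continuous Phi -> 0 < T ->
  k.+1%:R * \int[mu1]_(s in `]k.+1%:R^-1, T[) (Phi s - Phi (s - k.+1%:R^-1)) @[k --> \oo]
    --> Phi T - Phi 0.
Proof.
move=> cP T0; have ifin a b := continuous_itv_integrable a b cP.
(* The primitive starts at [-1], so that 0 is an interior point. *)
pose P (y : R) := \int[mu1]_(s in `[-1, y]) Phi s.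
have dP (y : R) : -1 < y -> is_derive y 1 P (Phi y).
  move=> y1; have yu : y < y + 1 by rewrite ltrDl.
  have [dPy] := continuous_FTC1_closed yu (ifin _ _) y1 (cP y).
  by rewrite derive1E => Py; exact: (DeriveDef dPy Py).
(* Reflection turns the forward quotient of [P] at 0 into a backward one, so [cvg_backward_quotient]
   serves both ends. *)
have dP' : is_derive (0 : R) 1 (fun y : R => - P (- y)) (Phi 0).
  have d0 : is_derive (- (0 : R)) 1 P (Phi 0) by rewrite oppr0; apply: dP; rewrite ltrN10.
  have dN : is_derive (0 : R) 1 (fun y : R => - y) (-1) by exact: is_deriveNid.
  have := is_deriveN (is_derive_comp d0 dN).
  by rewrite mulrN1 opprK.
have L1 := cvg_backward_quotient (dP T (lt_trans (ltrN10 R) T0)).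
have L2 := cvg_backward_quotient dP'.
have L : k.+1%:R * (P T - P (T - k.+1%:R^-1)) -
    k.+1%:R * (- P (- (0 : R)) - - P (- (0 - k.+1%:R^-1))) @[k --> \oo] --> Phi T - Phi 0.
  exact: (cvgB L1 L2).
move: L; apply: cvg_trans; apply: near_eq_cvg; near=> k.
have hT : k.+1%:R^-1 < T.
  near: k; have : \forall k \near \oo, `|(0 : R) - k.+1%:R^-1| < T.
    by have /cvgrPdist_lt := @cvg_harmonic R; apply.
  by apply: filterS => k; rewrite sub0r normrN ger0_norm.
set h : R := k.+1%:R^-1 in hT *.
have h0 : 0 < h by rewrite invr_gt0.
rewrite /= -mulrBr; congr (_ * _).
pose G (y : R) := P y - P (y - h).
have dG (y : R) : 0 <= y - h -> is_derive y 1 G (Phi y - Phi (y - h)).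
  move=> yh; apply: is_deriveB.
    by apply: dP; rewrite (lt_le_trans (ltrN10 R))// (le_trans yh)// gerBl ltW.
  rewrite -[Phi _]mulr1; apply: (is_derive_comp (G := P) (F := fun y : R => y - h)).
    by apply: dP; exact: lt_le_trans (ltrN10 R) yh.
  have := @is_derive_affine R (- h) 1 0 y; congr is_derive.
  by apply/funext => z; rewrite subr0 mul1r addrC.
have cF : continuous (fun y => Phi y - Phi (y - h)).
  apply: contB => //; apply: (cont_comp (f := Phi)) => //.
  by apply: contB; [exact: cont_id|exact: cont_cst].
have iF := continuous_itv_integrable h T cF.
have -> : \int[mu1]_(s in `]h, T[) (Phi s - Phi (s - h)) =
    \int[mu1]_(s in `[h, T]) (Phi s - Phi (s - h)).
  have io : mu1.-integrable `]h, T[ (EFin \o (fun y => Phi y - Phi (y - h))).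
    by apply: integrableS iF => //; exact: subset_itv_oo_cc.
  have ioc : mu1.-integrable `]h, T] (EFin \o (fun y => Phi y - Phi (y - h))).
    by apply: integrableS iF => //; exact: subset_itv_oc_cc.
  by rewrite (Rintegral_itv_bndo_bndc io) (Rintegral_itv_obnd_cbnd ioc).
have -> : \int[mu1]_(s in `[h, T]) (Phi s - Phi (s - h)) = G T - G h.
  by apply: (Rintegral_FTC hT cF) => y /andP[hy _]; apply: dG; rewrite subr_ge0.
rewrite /G subrr !sub0r !opprK oppr0; ring.
Unshelve. all: by end_near.
Qed.
End mean_difference.

Section fatou_average.
Context d (X : measurableType d) (R : realType).
Variable m : {sigma_finite_measure set X -> \bar R}.
Local Notation mu1 := (@lebesgue_measure R).
Local Notation mutx := (mu1 \x m)%E.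
Variables (T C : R) (D : set X) (J : eqType) (s : seq J).
Variables (f g : J -> measurableTypeR R * X -> R).
Variables (E Y : nat -> measurableTypeR R * X -> R) (E' Y' : measurableTypeR R * X -> R).
Hypotheses (mD : measurable D) (Doo : (m D < +oo)%E).
Let Q : set (measurableTypeR R * X) := `]0, T[%classic `*` D.
Hypotheses (f2 : forall j, L2 mutx Q (f j)) (g2 : forall j, L2 mutx Q (g j)).
Hypotheses (mE : forall k, measurable_fun Q (E k)) (mE' : measurable_fun Q E').
Hypotheses (mY : forall k, measurable_fun Q (Y k)) (mY' : measurable_fun Q Y').
Hypotheses (E1 : forall k p, Q p -> `|E k p| <= 1) (E'1 : forall p, Q p -> `|E' p| <= 1).
Hypotheses (YC : {ae mutx, forall p, Q p -> forall k, `|Y k p| <= C}).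
Hypotheses (Y'C : {ae mutx, forall p, Q p -> `|Y' p| <= C}).
Hypotheses (EE' : forall p, Q p -> E k p @[k --> \oo] --> E' p).
Hypotheses (YY' : forall p, Q p -> Y k p @[k --> \oo] --> Y' p).

Let mQ : measurable Q.
Proof. by apply: (@measurableX _ _ (measurableTypeR R) X `]0, T[%classic D). Qed.
Let Qlty : (mutx Q < +oo)%E.
Proof.
rewrite product_measure1E// lte_mul_pinfty//.
by rewrite ge0_fin_numE//; exact: lebesgue_oo_lty.
Qed.

Let A k j p := tavg T D k.+1%:R^-1 (f j) p.
Let h0 k : 0 < k.+1%:R^-1 :> R. Proof. by rewrite invr_gt0. Qed.
Let A2 k j : L2 mutx Q (A k j). Proof. exact: (L2_tavg mD (f2 j).1 (f2 j) (h0 k)). Qed.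

(** The Young majorant of the bilinear form, plus the bound [C] of the remaining term: added to the
    integrand it makes it non-negative, as Fatou's lemma requires. *)
Let half_sum (a : J -> measurableTypeR R * X -> R) p :=
  2^-1 * (\sum_(j <- s) (a j p ^+ 2 + g j p ^+ 2)) + C.

Let integrable_cstQ (r : R) : mutx.-integrable Q (EFin \o (fun=> r)).
Proof. by apply: (@integrable_bd _ _ _ _ _ mQ _ `|r|). Qed.

Let integrable_half_sum a : (forall j, L2 mutx Q (a j)) ->
  mutx.-integrable Q (EFin \o half_sum a).
Proof.
move=> a2; apply: (integrableRD mQ) => //; apply: (integrableRZ mQ).
apply: (integrableRsum mQ) => j; apply: (integrableRD mQ).
  by case: (a2 j).
by case: (g2 j).
Qed.

Let integrable_form (e y : measurableTypeR R * X -> R) a : (forall j, L2 mutx Q (a j)) ->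
  measurable_fun Q e -> (forall p, Q p -> `|e p| <= 1) -> measurable_fun Q y ->
  {ae mutx, forall p, Q p -> `|y p| <= C} ->
  mutx.-integrable Q (EFin \o (fun p => e p * (\sum_(j <- s) a j p * g j p) + y p)).
Proof.
move=> a2 me e1 my yC; apply: (integrableRD mQ).
  apply: (integrable_Mbd mQ _ me e1).
  by apply: (integrableRsum mQ) => j; exact: (integrable_L2M mQ (a2 j) (g2 j)).
exact: (integrable_ae_bd mQ Qlty my yC).
Qed.

Let form_ge (e y : R) a p : `|e| <= 1 -> `|y| <= C ->
  0 <= e * (\sum_(j <- s) a j p * g j p) + y + half_sum a p.
Proof.
move=> e1 yC; rewrite /half_sum addrACA; apply: addr_ge0; last first.
  by move: yC; rewrite ler_norml => /andP[]; lra.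
rewrite !mulr_sumr -big_split /=; apply: sumr_ge0 => j _.
have : `|e * (a j p * g j p)| <= 2^-1 * (a j p ^+ 2 + g j p ^+ 2).
  rewrite normrM (@le_trans _ _ (1 * `|a j p * g j p|))// ?ler_wpM2r// mul1r normrM.
  rewrite -(real_normK (num_real (a j p))) -(real_normK (num_real (g j p))).
  have := sqr_ge0 (`|a j p| - `|g j p|); nra.
by rewrite ler_norml => /andP[]; lra.
Qed.

(** The products of averages with [g j] converge almost everywhere but have no evident majorant.
    Fatou is applied after adding [half_sum], whose integral for the averages is at most its
    integral for [f] since averaging contracts; the added term then cancels. *)
Lemma fatou_average (e : nat -> R) (l : R) :
  (forall k, \int[mutx]_(p in Q) (E k p * (\sum_(j <- s) A k j p * g j p) + Y k p) <= e k) ->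
  e k @[k --> \oo] --> l ->
  \int[mutx]_(p in Q) (E' p * (\sum_(j <- s) f j p * g j p) + Y' p) <= l.
Proof.
move=> Ie el.
have YCk k : {ae mutx, forall p, Q p -> `|Y k p| <= C}.
  by apply: filterS YC => p H Qp; exact: H.
have iR k := integrable_form (A2 k) (mE k) (E1 k) (mY k) (YCk k).
have iR' := integrable_form f2 mE' E'1 mY' Y'C.
have iN k := integrable_half_sum (A2 k).
have iN' := integrable_half_sum f2.
rewrite -(lerD2r (\int[mutx]_(p in Q) half_sum f p)) -(RintegralD mQ iR' iN').
apply: (@Rintegral_fatou _ _ _ mutx Q mQ
  (fun k p => E k p * (\sum_(j <- s) A k j p * g j p) + Y k p + half_sum (A k) p) _
  (fun k => e k + \int[mutx]_(p in Q) half_sum f p)).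
- by move=> k; exact: (integrableRD mQ (iR k) (iN k)).
- exact: (integrableRD mQ iR' iN').
- by apply: filterS YC => p H Qp k; apply: form_ge; [exact: E1|exact: H].
- have cA : {ae mutx, forall p, forall j, j \in s -> Q p -> A k j p @[k --> \oo] --> f j p}.
    elim: s => [|j s' IHs]; first by apply: aeW => p j; rewrite in_nil.
    have := cvg_tavg mD (f2 j).1 (integrable_L2 mQ Qlty (f2 j)).
    apply: filterS2 IHs => p H1 H2 i; rewrite in_cons => /predU1P[->|]; first exact: H2.
    exact: H1.
  apply: filterS cA => p cA Qp.
  have cS (F : J -> R -> R) : (forall j, continuous (F j)) ->
      \sum_(j <- s) F j (A k j p) @[k --> \oo] --> \sum_(j <- s) F j (f j p).
    move=> cF; rewrite [X in _ --> X]big_seq; under eq_cvg do rewrite big_seq.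
    apply: cvg_big; first exact: add_continuous.
    by move=> j js; exact: (cvg_comp (fun k => A k j p) (F j) (cA j js Qp) (cF j (f j p))).
  apply: cvgD.
    apply: cvgD; last exact: YY'.
    apply: cvgM; first exact: EE'.
    apply: (cS (fun j r => r * g j p)) => j; apply: contM; [exact: cont_id|exact: cont_cst].
  apply: cvgD; last exact: cvg_cst.
  apply: cvgM; first exact: cvg_cst.
  apply: (cS (fun j r => r ^+ 2 + g j p ^+ 2)) => j; apply: contD; last exact: cont_cst.
  by rewrite (_ : (fun r => _) = (fun r => r * r)); [apply: contM; exact: cont_id|apply/funext => r; rewrite expr2].
- move=> k; rewrite (RintegralD mQ (iR k) (iN k)); apply: lerD; first exact: Ie.
  have iS a : (forall j, L2 mutx Q (a j)) -> \int[mutx]_(p in Q) half_sum a p =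
      2^-1 * (\sum_(j <- s) (\int[mutx]_(p in Q) (a j p ^+ 2) + \int[mutx]_(p in Q) (g j p ^+ 2))) +
      \int[mutx]_(p in Q) C.
    move=> a2.
    have ia j : mutx.-integrable Q (EFin \o (fun p => a j p ^+ 2)) by case: (a2 j).
    have ig j : mutx.-integrable Q (EFin \o (fun p => g j p ^+ 2)) by case: (g2 j).
    have iag j : mutx.-integrable Q (EFin \o (fun p => a j p ^+ 2 + g j p ^+ 2)).
      exact: (integrableRD mQ (ia j) (ig j)).
    have iss := integrableRsum mQ s iag.
    rewrite /half_sum (RintegralD mQ (integrableRZ mQ _ iss) (integrable_cstQ C)).
    rewrite (Rintegral_scale mQ _ iss) (Rintegral_sum mQ s iag); congr (_ * _ + _).
    by apply: eq_bigr => j _; rewrite (RintegralD mQ (ia j) (ig j)).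
  rewrite (iS _ (A2 k)) (iS _ f2) lerD2r ler_wpM2l ?invr_ge0// ler_sum// => j _.
  by rewrite lerD2r; exact: (Rintegral_tavg_sqr mD (f2 j).1 (f2 j) (h0 k)).
- by apply: cvgD => //; exact: cvg_cst.
Qed.
End fatou_average.

(** * Entropy inequality and comparison principle *)

Section comparison.
Context {R : realType} {n : nat}.
Local Notation mu := (@lebesgue_rV R n).
Local Notation mu1 := (@lebesgue_measure R).
Local Notation mutx := (mu1 \x mu)%E.
Local Notation RX := (measurableTypeR R * 'rV[R]_n)%type.
Variables (Omega : set 'rV[R]_n) (alpha beta lambda M T K L : R).
Variables (v : R -> 'rV[R]_n -> R) (Dv : R -> 'rV[R]_n -> 'rV[R]_n).
Variables (W Wt : R -> 'rV[R]_n -> R).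
Hypotheses (oO : open Omega) (bO : bounded_set Omega).
Hypotheses (alpha0 : 0 < alpha) (beta0 : 0 < beta) (T0 : 0 < T) (K0 : 0 <= K) (L0 : 0 <= L).
Hypothesis vm : measurable_fun (cylinder `]0, +oo[ Omega) (fun p => v p.1 p.2).
Hypothesis vb : {ae mutx, forall p, cylinder `]0, +oo[ Omega p -> 0 <= v p.1 p.2 <= M}.
Hypothesis v_ge0 : forall t, 0 <= t -> {ae mu, forall x, Omega x -> 0 <= v t x}.
Hypothesis v2 : forall t, 0 <= t -> L2 mu Omega (v t).
Hypothesis vc : forall t, 0 <= t ->
  (\int[mu]_(x in Omega) ((v s x - v t x) ^+ 2)%:E)%E
      @[s --> within `[0, +oo[%classic (nbhs t)] --> 0%E.
Hypothesis Dv2 : forall i, L2 mutx (cylinder `]0, T[ Omega) (fun p => Dv p.1 p.2 ord0 i).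
Hypothesis vH : {ae mu1, forall t, 0 < t -> H10 Omega (v t) (Dv t)}.
Hypothesis veq : forall phi : R * 'rV[R]_n -> R,
  test_function (cylinder `]0, +oo[ Omega) phi ->
  \int[mutx]_(p in cylinder `]0, +oo[ Omega)
     (- (v p.1 p.2 * dt phi p) + dot (Dv p.1 p.2) (grad_x phi p)
      + `|v p.1 p.2| `^ (alpha - 1) * v p.1 p.2 * phi p)
  = lambda * \int[mutx]_(p in cylinder `]0, +oo[ Omega)
     (`|v p.1 p.2| `^ (beta - 1) * v p.1 p.2 * phi p).
Hypothesis sW : forall t, smooth (W t).
Hypothesis W_ge0 : forall t x, 0 <= W t x.
Hypothesis mW : measurable_fun [set: RX] (fun p => W p.1 p.2).
Hypothesis mgW : forall i, measurable_fun [set: RX] (fun p => grad (W p.1) p.2 ord0 i).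
Hypothesis gWL : forall i t x, 0 < t < T -> Omega x -> `|grad (W t) x ord0 i| <= L.
Hypothesis mWt : measurable_fun [set: RX] (fun p => Wt p.1 p.2).
Hypothesis WtL : forall t x, `|Wt t x| <= L.
Hypothesis W_lip : forall s t x, `|W s x - W t x| <= L * `|s - t|.
Hypothesis dW : forall (t : R) x, is_derive t 1 (fun s : R => W s x) (Wt t x).
Hypothesis supersolution : forall t x s, 0 < t < T -> Omega x -> 0 <= s ->
  W t x < expR (- (K * t)) * s ->
  0 <= Wt t x - \sum_i grad (fun y => grad (W t) y ord0 i) x ord0 i
       + K * (expR (- (K * t)) * s) - expR (- (K * t)) * reaction alpha beta lambda s.

Let mO : measurable Omega := open_measurable_rV oO.
Let Ooo : (mu Omega < +oo)%E := bounded_lebesgue_rV mO bO.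
Let Q : set RX := `]0, T[%classic `*` Omega.
Let mI : measurable (`]0, T[%classic : set (measurableTypeR R)).
Proof. exact: measurable_itv. Qed.
Let mQ : measurable Q.
Proof. exact: (measurableX mI mO). Qed.
Let QQ : Q `<=` cylinder `]0, +oo[ Omega.
Proof. by move=> p [p0 Op]; split => //; move: p0; rewrite /= !in_itv/= andbT => /andP[]. Qed.
Let Qlty : (mutx Q < +oo)%E.
Proof.
rewrite product_measure1E// lte_mul_pinfty//.
by rewrite ge0_fin_numE//; exact: lebesgue_oo_lty.
Qed.

Let E (t : R) := expR (- (K * t)).
Let z t x := E t * v t x - W t x.
Let Phi t := \int[mu]_(x in Omega) gJ (z t x).

Let continuous_E : continuous E.
Proof.
apply: (cont_comp (f := @expR R)); first exact: continuous_expR.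
rewrite (_ : (fun t => _) = (fun t => - K * t)); last by apply/funext => t; rewrite mulNr.
by apply: contM; [exact: cont_cst|exact: cont_id].
Qed.

Let E_ge0 t : 0 <= E t. Proof. exact: expR_ge0. Qed.
Let E_le1 t : 0 <= t -> E t <= 1.
Proof. by move=> t0; rewrite -expR0 ler_expR oppr_le0 mulr_ge0. Qed.

Let W2 t : L2 mu Omega (W t). Proof. exact: smooth_L2. Qed.
Let z2 t : 0 <= t -> L2 mu Omega (z t).
Proof. by move=> t0; apply: (L2B mO _ (W2 t)); exact: (L2Z mO _ (v2 t0)). Qed.

Let integrable_gJ t : 0 <= t -> mu.-integrable Omega (EFin \o (fun x => gJ (z t x))).
Proof.
move=> t0; have [mz _] := z2 t0; have iz := integrable_L2 mO Ooo (z2 t0).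
apply: (@le_integrableR _ _ _ _ _ mO _ (fun x => `|z t x|)).
- exact: (measurableT_comp (continuous_measurable_fun (@continuous_gJ R))).
- move=> x _; have := gJ_lipschitz (z t x) 0.
  by rewrite (gJ_le0 (lexx 0)) !subr0.
- exact: integrable_norm.
Qed.

(** [gJ] is 1-Lipschitz, and the increment of [z] is a sum of three terms, due to [v], to [E] and to
    [W]; the factor 3 bounds the square of their sum. Each term tends to 0 as [t] tends to [s],
    which gives the continuity of [Phi]. *)
Let Phi_dist s t : 0 <= s -> 0 <= t -> (Phi t - Phi s) ^+ 2 <=
  fine (mu Omega) * (3 * (\int[mu]_(x in Omega) ((v t x - v s x) ^+ 2) +
    (E t - E s) ^+ 2 * \int[mu]_(x in Omega) (v s x ^+ 2) +
    (L * `|t - s|) ^+ 2 * fine (mu Omega))).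
Proof.
move=> s0 t0; have zz := L2B mO (z2 t0) (z2 s0).
have izz := integrable_L2 mO Ooo zz.
have nzz : L2 mu Omega (fun x => `|z t x - z s x|).
  case: zz => mz iz; split; first exact: measurableT_comp.
  by apply: eq_integrable iz => // x _; rewrite real_normK// num_real.
have : `|Phi t - Phi s| <= \int[mu]_(x in Omega) `|z t x - z s x|.
  rewrite /Phi -(RintegralB mO (integrable_gJ t0) (integrable_gJ s0)).
  have iJ := integrableRB mO (integrable_gJ t0) (integrable_gJ s0).
  apply: le_trans (le_normr_Rintegral mO iJ) _.
  apply: le_Rintegral => //; first exact: integrable_norm.
    exact: integrable_norm.
  by move=> x _; exact: gJ_lipschitz.
move=> H; rewrite -(real_normK (num_real (Phi t - Phi s))).
apply: (@le_trans _ _ ((\int[mu]_(x in Omega) `|z t x - z s x|) ^+ 2)).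
  by rewrite lerXn2r ?nnegrE// (le_trans _ H).
apply: le_trans (Rintegral_Cauchy mO Ooo nzz) _.
rewrite ler_wpM2l ?fine_ge0//.
have vv : L2 mu Omega (fun x => v t x - v s x) := L2B mO (v2 t0) (v2 s0).
have i1 : mu.-integrable Omega (EFin \o (fun x => (v t x - v s x) ^+ 2)) by case: vv.
have i2 : mu.-integrable Omega (EFin \o (fun x => v s x ^+ 2)) by case: (v2 s0).
have i3 := integrableRZ mO ((E t - E s) ^+ 2) i2.
have i4 : mu.-integrable Omega (EFin \o (fun=> (L * `|t - s|) ^+ 2)).
  by apply: (@integrable_bd _ _ _ _ _ mO _ `|(L * `|t - s|) ^+ 2|).
have i5 := integrableRD mO (integrableRD mO i1 i3) i4.
have <- : \int[mu]_(x in Omega) (3 * ((v t x - v s x) ^+ 2 + (E t - E s) ^+ 2 * v s x ^+ 2 +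
    (L * `|t - s|) ^+ 2)) = 3 * (\int[mu]_(x in Omega) ((v t x - v s x) ^+ 2) +
    (E t - E s) ^+ 2 * \int[mu]_(x in Omega) (v s x ^+ 2) +
    (L * `|t - s|) ^+ 2 * fine (mu Omega)).
  rewrite (Rintegral_scale mO _ i5) (RintegralD mO (integrableRD mO i1 i3) i4).
  by rewrite (RintegralD mO i1 i3) (Rintegral_scale mO _ i2) Rintegral_cst.
apply: le_Rintegral => //.
- by case: nzz.
- exact: (integrableRZ mO 3 i5).
move=> x _; rewrite real_normK ?num_real//.
have -> : z t x - z s x = E t * (v t x - v s x) + (E t - E s) * v s x - (W t x - W s x).
  by rewrite /z; ring.
have Wl : (W t x - W s x) ^+ 2 <= (L * `|t - s|) ^+ 2.
  rewrite -(real_normK (num_real (_ - _))) lerXn2r ?nnegrE ?mulr_ge0//.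
have El : (E t * (v t x - v s x)) ^+ 2 <= (v t x - v s x) ^+ 2.
  by rewrite exprMn ler_piMl ?sqr_ge0// exprn_ile1// E_le1.
rewrite -exprMn.
set a := E t * _ in El *; set b := _ * v s x; set c := W t x - _ in Wl *.
have := sqr_ge0 (a - b); have := sqr_ge0 (a + c); have := sqr_ge0 (b + c).
have -> : (a + b - c) ^+ 2 = 3 * (a ^+ 2 + b ^+ 2 + c ^+ 2) - (a - b) ^+ 2 - (a + c) ^+ 2 -
    (b + c) ^+ 2 by ring.
move: Wl El; set d := (L * _) ^+ 2; set e := (_ - _) ^+ 2; lra.
Qed.

Let continuous_Phi : continuous (fun t : R => Phi (Num.max t 0)).
Proof.
apply: continuous_max0 => s s0.
pose D t := fine (mu Omega) * (3 * (\int[mu]_(x in Omega) ((v t x - v s x) ^+ 2) +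
    (E t - E s) ^+ 2 * \int[mu]_(x in Omega) (v s x ^+ 2) +
    (L * `|t - s|) ^+ 2 * fine (mu Omega))).
pose G t := (E t - E s) ^+ 2 * \int[mu]_(x in Omega) (v s x ^+ 2) +
    (L * `|t - s|) ^+ 2 * fine (mu Omega).
have sqr_cont (f : R -> R) : continuous f -> continuous (fun t => f t ^+ 2).
  move=> cf; rewrite (_ : (fun t => _) = (fun t => f t * f t)); first exact: contM.
  by apply/funext => r; rewrite expr2.
have cG : continuous G.
  apply: contD; apply: contM; try exact: cont_cst; apply: sqr_cont.
    by apply: contB; [exact: continuous_E|exact: cont_cst].
  apply: contM; first exact: cont_cst.
  apply: (cont_comp (f := fun r : R => `|r|)); first exact: norm_continuous.
  by apply: contB; [exact: cont_id|exact: cont_cst].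
have Gs : G s = 0 by rewrite /G !subrr normr0 mulr0 !expr0n/= !mul0r addr0.
have D0 : D t @[t --> within `[0, +oo[%classic (nbhs s)] --> 0.
  have Gw : G t @[t --> within `[0, +oo[%classic (nbhs s)] --> (0 : R).
    by rewrite -Gs; apply: cvg_within_filter; exact: cG.
  have : fine (mu Omega) * (3 * (\int[mu]_(x in Omega) ((v t x - v s x) ^+ 2) + G t))
      @[t --> within `[0, +oo[%classic (nbhs s)] --> fine (mu Omega) * (3 * (0 + 0)).
    apply: cvgM; first exact: cvg_cst.
    apply: cvgM; first exact: cvg_cst.
    by apply: cvgD => //; have /fine_cvg := vc s0.
  have -> : D = fun t => fine (mu Omega) * (3 * (\int[mu]_(x in Omega) ((v t x - v s x) ^+ 2) + G t)).
    by apply/funext => t; rewrite /D /G addrA.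
  by rewrite addr0 !mulr0.
apply/cvgrPdist_le => e e0.
have e2 : 0 < e ^+ 2 by rewrite exprn_gt0.
move/cvgrPdist_le : D0 => /(_ _ e2) H.
have : \forall t \near within `[0, +oo[%classic (nbhs s), 0 <= t.
  have H0 : \forall t \near within `[0, +oo[%classic (nbhs s), `[0, +oo[%classic t.
    exact: near_withinT.
  by apply: filterS H0 => t; rewrite /= in_itv/= andbT.
apply: filterS2 H => t; rewrite sub0r normrN => Dt t0.
rewrite -(@ler_pXn2r _ 2)// ?nnegrE ?(ltW e0)// real_normK ?num_real// -sqrrN opprB.
by rewrite (le_trans (Phi_dist s0 t0))// (le_trans _ Dt)// ler_norm.
Qed.
Let psi (p : RX) := gG (z p.1 p.2).
Let bco i (p : RX) := gG' (z p.1 p.2) * (E p.1 * Dv p.1 p.2 ord0 i - grad (W p.1) p.2 ord0 i).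
(* The index [None] carries the source term, so that it is averaged together with the gradient. *)
Let indices : seq (option 'I_n) := None :: map Some (index_enum 'I_n).
Let fj (j : option 'I_n) : RX -> R :=
  if j is Some i then Dv_coord Dv i else source alpha beta lambda v.
(** The minus sign moves the source to the side of the gradient terms. *)
Let gj (j : option 'I_n) (p : RX) : R := if j is Some i then bco i p else - psi p.

Let sum_indices (F : option 'I_n -> R) : \sum_(j <- indices) F j = F None + \sum_i F (Some i).
Proof. by rewrite big_cons big_map. Qed.

Let mE : measurable_fun [set: RX] (fun p => E p.1).
Proof.
apply: (measurableT_comp (f := E)); last exact: measurable_fst.
exact: continuous_measurable_fun continuous_E.
Qed.

Let mv : measurable_fun Q (fun p => v p.1 p.2).
Proof. by apply: (measurable_funS _ QQ vm); rewrite cylinderE; exact: measurableX. Qed.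

Let mz : measurable_fun Q (fun p => z p.1 p.2).
Proof.
apply: measurable_funB; last exact: measurable_funTS.
by apply: measurable_funM; [exact: measurable_funTS mE|exact: mv].
Qed.

Let mpsi : measurable_fun Q psi.
Proof. exact: (measurableT_comp (continuous_measurable_fun (@continuous_gG R))). Qed.

Let psi01 p : 0 <= psi p <= 1. Proof. exact: gG_itv. Qed.

Let normr_psi p : `|psi p| <= 1.
Proof. by have /andP[p0 p1] := psi01 p; rewrite ger0_norm. Qed.

Let f2 j : L2 mutx Q (fj j).
Proof.
case: j => [i|]; first exact: Dv2.
exact: (@source_L2 R n Omega alpha beta lambda M T v oO bO alpha0 beta0 vm vb).
Qed.

Let g2 j : L2 mutx Q (gj j).
Proof.
case: j => [i|]; last first.
  apply: (@L2_bd _ _ _ _ _ mQ _ 1) => //=; first exact: measurable_funN.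
  by move=> p _; rewrite normrN.
have [C C0 [G'C _ _]] := @gG_bounds R.
apply: (@L2_Mbd _ _ _ _ _ mQ _ _ C) => //; last first.
  exact: (measurableT_comp (continuous_measurable_fun (@continuous_gG' R))).
apply: (L2B mQ).
  apply: (@L2_Mbd _ _ _ mutx _ mQ (fun p => Dv p.1 p.2 ord0 i) (fun p => E p.1) 1).
  - exact: Dv2.
  - exact: measurable_funTS mE.
  - move=> p [p0 _]; rewrite ger0_norm// E_le1//.
    by move: p0; rewrite /= in_itv/= => /andP[/ltW].
apply: (@L2_bd _ _ _ _ _ mQ _ L) => //; first exact: measurable_funTS.
by move=> p [p0 Op]; apply: gWL => //; move: p0; rewrite /= in_itv.
Qed.

Section step.
Variables (h t : R).
Hypotheses (h0 : 0 < h) (ht : h < t) (tT : t < T) (tH : H10 Omega (v t) (Dv t)).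
Hypothesis tA : forall j, L2 mu Omega (fun x => tavg T Omega h (fj j) (t, x)).

Let t0 : 0 <= t. Proof. by rewrite ltW// (lt_trans h0). Qed.
Let th0 : 0 <= t - h. Proof. by rewrite subr_ge0 ltW. Qed.

Let psi_t2 : L2 mu Omega (fun x => psi (t, x)).
Proof.
apply: (@L2_bd _ _ _ _ _ mO _ 1) => //.
apply: (measurableT_comp (continuous_measurable_fun (@continuous_gG R))).
by have [] := z2 t0.
Qed.

Let gj_t2 j : L2 mu Omega (fun x => gj j (t, x)).
Proof.
case: j => [i|]; last first.
  by have := L2Z mO (-1) psi_t2; congr L2; apply/funext => x; rewrite mulN1r.
have [C C0 [G'C _ _]] := @gG_bounds R; have [_ D2 _] := tH.
apply: (@L2_Mbd _ _ _ _ _ mO _ _ C) => //; last first.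
  by apply: (measurableT_comp (continuous_measurable_fun (@continuous_gG' R))); have [] := z2 t0.
exact: (L2B mO (L2Z mO (E t) (D2 i)) (smooth_L2 (smooth_grad i (sW t)) oO bO)).
Qed.

(** By convexity the increment of [gJ] is at most [psi] times that of [z]. The latter is split as
    [E (t - h) * (v t - v (t - h))], to which the energy identity applies, minus
    [(E (t - h) - E t) * v t], minus the increment of [W]. This splitting is the reason for the
    weight at the earlier time [t - h]. *)
Lemma convexity_step : \int[mu]_(x in Omega)
    (E (t - h) * (\sum_(j <- indices) tavg T Omega h (fj j) (t, x) * gj j (t, x)) +
     psi (t, x) * (K * (E t * v t x) + h^-1 * (W t x - W (t - h) x))) <=
  - (h^-1 * (Phi t - Phi (t - h))).
Proof.
have iJ := integrableRB mO (integrable_gJ t0) (integrable_gJ th0).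
have dv2 := L2B mO (v2 t0) (v2 th0).
have dW2 := L2B mO (W2 t) (W2 (t - h)).
have y2 : L2 mu Omega (fun x => K * (E t * v t x) + h^-1 * (W t x - W (t - h) x)).
  apply: (L2D mO); last exact: (L2Z mO h^-1 dW2).
  by apply: (L2Z mO K); exact: (L2Z mO _ (v2 t0)).
have iY := integrable_L2M mO psi_t2 y2.
have idv := integrable_L2M mO dv2 psi_t2.
have iAg j := integrable_L2M mO (tA j) (gj_t2 j).
have iS := integrableRsum mO indices iAg.
have en : h^-1 * \int[mu]_(x in Omega) ((v t x - v (t - h) x) * psi (t, x)) =
    - \int[mu]_(x in Omega) (\sum_(j <- indices) tavg T Omega h (fj j) (t, x) * gj j (t, x)).
  have [tAi tAF] : (forall i, L2 mu Omega (fun x => tavg T Omega h (Dv_coord Dv i) (t, x))) /\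
      L2 mu Omega (fun x => tavg T Omega h (source alpha beta lambda v) (t, x)).
    by split => [i|]; [exact: (tA (Some i))|exact: (tA None)].
  rewrite (energy_identity oO bO alpha0 beta0 vm vb v2 vc Dv2 veq h0 ht tT tAi tAF tH
    (E_ge0 t) (sW t) (W_ge0 t)).
  rewrite (Rintegral_sum mO indices iAg) sum_indices opprD addrC; congr (_ + _).
  rewrite -mulN1r -(Rintegral_scale mO _ (iAg None)); apply: eq_Rintegral => x _.
  by rewrite /= mulrN mulN1r opprK.
rewrite (RintegralD mO (integrableRZ mO _ iS) iY) (Rintegral_scale mO _ iS).
rewrite -[X in _ * X + _]opprK -en.
rewrite -(Rintegral_scale mO _ idv) mulrN -(Rintegral_scale mO _ (integrableRZ mO _ idv)).
rewrite addrC -(RintegralB mO iY (integrableRZ mO _ (integrableRZ mO _ idv))).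
have -> : - (h^-1 * (Phi t - Phi (t - h))) =
    \int[mu]_(x in Omega) (- h^-1 * (gJ (z t x) - gJ (z (t - h) x))).
  rewrite (Rintegral_scale mO _ iJ) (RintegralB mO (integrable_gJ t0) (integrable_gJ th0)).
  by rewrite mulNr.
apply: (le_Rintegral_ae mO (integrableRB mO iY (integrableRZ mO _ (integrableRZ mO _ idv)))
  (integrableRZ mO _ iJ)).
apply: filterS (v_ge0 t0) => x vx Ox; have {}vx := vx Ox.
have J := gJ_convex (z t x) (z (t - h) x).
(* With [v t >= 0], this bounds [(E (t - h) - E t) * v t] from below by [K * h * E t * v t]: the
   linear term that compensates the growth of the reaction. *)
have EE : E t * (1 + K * h) <= E (t - h).
  rewrite (_ : E (t - h) = E t * expR (K * h)) ?ler_wpM2l ?expR_ge1Dx//.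
  by rewrite /E -expRD; congr expR; ring.
have p0 : 0 <= psi (t, x) by have /andP[] := psi01 (t, x).
rewrite -subr_ge0.
have -> : - h^-1 * (gJ (z t x) - gJ (z (t - h) x)) -
    (psi (t, x) * (K * (E t * v t x) + h^-1 * (W t x - W (t - h) x)) -
     E (t - h) * (h^-1 * ((v t x - v (t - h) x) * psi (t, x)))) =
  h^-1 * (psi (t, x) * (z t x - z (t - h) x) - (gJ (z t x) - gJ (z (t - h) x)) +
    psi (t, x) * (v t x * (E (t - h) - E t * (1 + K * h)))).
  by rewrite /z; field; rewrite gt_eqF.
rewrite mulr_ge0 ?invr_ge0 ?(ltW h0)// addr_ge0 ?subr_ge0//.
by rewrite !mulr_ge0// subr_ge0.
Qed.
End step.
Let ae_step_ready h : 0 < h -> {ae mu1, forall t, `]0, T[%classic t ->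
  forall j, L2 mu Omega (fun x => tavg T Omega h (fj j) (t, x))}.
Proof.
move=> h0; have H j : {ae mu1, forall t, `]0, T[%classic t ->
    L2 mu Omega (fun x => tavg T Omega h (fj j) (t, x))}.
  have [mt it] := L2_tavg mO (f2 j).1 (f2 j) h0.
  apply: filterS (ae_integrable_sect1 mI mO it) => t it' t0T; split; last exact: it'.
  exact: (measurable_sect1 mI mO mt t0T).
have Hs (s : seq (option 'I_n)) : {ae mu1, forall t, `]0, T[%classic t ->
    forall j, j \in s -> L2 mu Omega (fun x => tavg T Omega h (fj j) (t, x))}.
  elim: s => [|j s IHs]; first by apply: aeW => t _ j; rewrite in_nil.
  apply: (@filterS2 _ _ (ae_filter_ringOfSetsType mu1) _ _ _ _ (H j) IHs) => t H1 H2 t0T i; rewrite in_cons => /predU1P[->|].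
    exact: H1.
  exact: H2.
by apply: (@filterS _ _ (ae_filter_ringOfSetsType mu1) _ _ _ (Hs (enum {: option 'I_n}))) => t Ht t0T j; apply: Ht => //; rewrite mem_enum.
Qed.

(** [Ek] and [Yk] are set to 0 up to time [k.+1%:R^-1], where a backward step would leave the
    positive times; all integrals thus live on the same cylinder [Q], and at each of its points the
    two are given by the true formula for large [k]. *)
Let Ek k (p : RX) : R := if k.+1%:R^-1 < p.1 then E (p.1 - k.+1%:R^-1) else 0.
Let Yk k (p : RX) : R := if k.+1%:R^-1 < p.1 then
  psi p * (K * (E p.1 * v p.1 p.2) + k.+1%:R * (W p.1 p.2 - W (p.1 - k.+1%:R^-1) p.2)) else 0.
Let Y (p : RX) : R := psi p * (K * (E p.1 * v p.1 p.2) + Wt p.1 p.2).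

Let mlt k : measurable_fun Q (fun p : RX => k.+1%:R^-1 < p.1).
Proof.
by apply: measurable_fun_ltr; [exact: measurable_cst|exact: measurable_funTS measurable_fst].
Qed.

Let mshift k : measurable_fun [set: RX] (fun p : RX => p.1 - k.+1%:R^-1).
Proof. by apply: measurable_funB; [exact: measurable_fst|exact: measurable_cst]. Qed.

Let mEk k : measurable_fun Q (Ek k).
Proof.
have mEs : measurable_fun [set: RX] (fun p => E (p.1 - k.+1%:R^-1)).
  rewrite (_ : (fun p => _) = (fun p : RX => E p.1) \o (fun p : RX => (p.1 - k.+1%:R^-1, p.2))) //.
  apply: (measurableT_comp mE); apply/measurable_fun_pairP; split; first exact: mshift.
  exact: measurable_snd.
rewrite /Ek; apply: measurable_fun_if => //.
  exact: measurable_funTS mEs.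
Qed.

Let mKEv : measurable_fun Q (fun p => K * (E p.1 * v p.1 p.2)).
Proof.
apply: measurable_funM; first exact: measurable_cst.
by apply: measurable_funM; [exact: measurable_funTS mE|exact: mv].
Qed.

Let mYk k : measurable_fun Q (Yk k).
Proof.
have mWs : measurable_fun [set: RX] (fun p => W (p.1 - k.+1%:R^-1) p.2).
  rewrite (_ : (fun p => _) = (fun p : RX => W p.1 p.2) \o
    (fun p : RX => (p.1 - k.+1%:R^-1, p.2))) //.
  apply: (measurableT_comp mW); apply/measurable_fun_pairP; split; first exact: mshift.
  exact: measurable_snd.
have m : measurable_fun Q (fun p => psi p * (K * (E p.1 * v p.1 p.2) +
    k.+1%:R * (W p.1 p.2 - W (p.1 - k.+1%:R^-1) p.2))).
  apply: measurable_funM => //; apply: measurable_funD => //.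
  apply: measurable_funM; first exact: measurable_cst.
  by apply: measurable_funB; apply: measurable_funTS.
rewrite /Yk; apply: measurable_fun_if => //.
by apply: measurable_funS m => //; exact: subIsetl.
Qed.

Let mY : measurable_fun Q Y.
Proof.
by apply: measurable_funM => //; apply: measurable_funD => //; exact: measurable_funTS.
Qed.

Let Ek1 k p : Q p -> `|Ek k p| <= 1.
Proof.
move=> _; rewrite /Ek; case: ifPn => h; last by rewrite normr0.
by rewrite ger0_norm// E_le1// subr_ge0 ltW.
Qed.

Let Q_ge0 p : Q p -> 0 <= p.1.
Proof. by move=> [p0 _]; move: p0; rewrite /= in_itv/= => /andP[/ltW]. Qed.

Let KEv_le p : Q p -> 0 <= v p.1 p.2 <= M -> `|K * (E p.1 * v p.1 p.2)| <= K * M.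
Proof.
move=> Qp /andP[v0 vM]; rewrite ger0_norm ?mulr_ge0// ler_wpM2l//.
by rewrite (le_trans _ vM)// ler_piMl// E_le1// Q_ge0.
Qed.

Let psiM_le p r C : `|r| <= C -> `|psi p * r| <= C.
Proof.
by move=> rC; rewrite normrM (le_trans _ rC)// ler_piMl.
Qed.

Let YkC : {ae mutx, forall p, Q p -> forall k, `|Yk k p| <= K * M + L}.
Proof.
apply: filterS vb => p vp Qp k; have {}vp := vp (QQ Qp).
rewrite /Yk; case: ifPn => _; last first.
  by rewrite normr0 (le_trans (normr_ge0 _) (le_trans (KEv_le Qp vp) _))// lerDl.
apply: psiM_le; rewrite (le_trans (ler_normD _ _))// lerD ?KEv_le//.
rewrite normrM ger0_norm// -ler_pdivlMl ?ltr0n// mulrC (le_trans (W_lip _ _ _))//.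
by rewrite subKr ger0_norm ?invr_ge0.
Qed.

Let YC : {ae mutx, forall p, Q p -> `|Y p| <= K * M + L}.
Proof.
apply: filterS vb => p vp Qp; have {}vp := vp (QQ Qp).
by apply: psiM_le; rewrite (le_trans (ler_normD _ _))// lerD ?KEv_le.
Qed.

Let near_lt p : Q p -> \forall k \near \oo, k.+1%:R^-1 < p.1.
Proof.
move=> [p0 _]; have {}p0 : 0 < p.1 by move: p0; rewrite /= in_itv/= => /andP[].
have : \forall k \near \oo, `|(0 : R) - k.+1%:R^-1| < p.1.
  by have /cvgrPdist_lt := @cvg_harmonic R; apply.
by apply: filterS => k; rewrite sub0r normrN ger0_norm.
Qed.

Let cvg_Ek p : Q p -> Ek k p @[k --> \oo] --> E p.1.
Proof.
move=> Qp; have cEE : continuous (E : R -> R) := continuous_E.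
have cE : E (p.1 - k.+1%:R^-1) @[k --> \oo] --> E p.1.
  have c : p.1 - k.+1%:R^-1 @[k --> \oo] --> (p.1 - 0 : R).
    by apply: cvgB; [exact: cvg_cst|exact: cvg_harmonic].
  by rewrite subr0 in c; exact: (cvg_comp _ E c (cEE p.1)).
move: cE; apply: cvg_trans; apply: near_eq_cvg.
by apply: filterS (near_lt Qp) => k kp; rewrite /Ek kp.
Qed.

Let cvg_Yk p : Q p -> Yk k p @[k --> \oo] --> Y p.
Proof.
move=> Qp; have cY : psi p * (K * (E p.1 * v p.1 p.2) +
    k.+1%:R * (W p.1 p.2 - W (p.1 - k.+1%:R^-1) p.2)) @[k --> \oo] --> Y p.
  apply: cvgM; first exact: cvg_cst.
  apply: cvgD; first exact: cvg_cst.
  exact: (cvg_backward_quotient (dW p.1 p.2)).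
move: cY; apply: cvg_trans; apply: near_eq_cvg.
by apply: filterS (near_lt Qp) => k kp; rewrite /Yk kp.
Qed.

Let tPhi (s : R) := Phi (Num.max s 0).

Let step_integral k :
  \int[mutx]_(p in Q) (Ek k p * (\sum_(j <- indices)
     tavg T Omega k.+1%:R^-1 (fj j) p * gj j p) + Yk k p) <=
  - (k.+1%:R * \int[mu1]_(s in `]k.+1%:R^-1, T[) (tPhi s - tPhi (s - k.+1%:R^-1))).
Proof.
set h : R := k.+1%:R^-1.
have h0 : 0 < h by rewrite invr_gt0.
have A2 j := L2_tavg mO (f2 j).1 (f2 j) h0.
have iS := integrableRsum mQ indices (fun j => integrable_L2M mQ (A2 j) (g2 j)).
have YkCk : {ae mutx, forall p, Q p -> `|Yk k p| <= K * M + L}.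
  by apply: filterS YkC => p H Qp; exact: H.
have iR := integrableRD mQ (integrable_Mbd mQ iS (mEk k) (@Ek1 k))
  (integrable_ae_bd mQ Qlty (mYk k) YkCk).
have mIh : measurable (`]h, T[%classic : set (measurableTypeR R)) by exact: measurable_itv.
rewrite (Rintegral_sect1 mI mO iR).
have hI : (`]h, T[%classic : set (measurableTypeR R)) `<=` `]0, T[%classic.
  by move=> s; rewrite /= !in_itv/= => /andP[s1 ->]; rewrite (lt_trans h0).
rewrite (@Rintegral_restrict _ _ _ mu1 _ _ _ hI); last first.
  move=> t; rewrite /= !in_itv/= => /andP[t0 tT] /negP; rewrite tT andbT => th.
  transitivity (\int[mu]_(x in Omega) (0 : R)); last by rewrite Rintegral_cst// mul0r.
  by apply: eq_Rintegral => x _; rewrite /Ek /Yk /= -/h (negbTE th) mul0r addr0.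
have cF : continuous (fun s => tPhi s - tPhi (s - h)).
  apply: contB; first exact: continuous_Phi.
  apply: (cont_comp (f := tPhi)); first exact: continuous_Phi.
  by apply: contB; [exact: cont_id|exact: cont_cst].
have iF : mu1.-integrable `]h, T[ (EFin \o (fun s => tPhi s - tPhi (s - h))).
  by apply: integrableS (continuous_itv_integrable h T cF) => //; exact: subset_itv_oo_cc.
rewrite -mulNr -(Rintegral_scale mIh _ iF).
apply: (le_Rintegral_ae mIh _ (integrableRZ mIh _ iF)).
  by apply: (integrableS mI mIh hI); exact: (integrable_sect1 mI mO iR).
apply: (@filterS2 _ _ (ae_filter_ringOfSetsType mu1) _ _ _ _ vH (ae_step_ready h0)) => t tH tA.
rewrite /= in_itv/= => /andP[ht tT]; have t0 := lt_trans h0 ht.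
have tI : `]0, T[%classic t by rewrite /= in_itv/= t0.
have := convexity_step h0 ht tT (tH t0) (tA tI).
rewrite /tPhi !max_l ?subr_ge0 ?(ltW ht) ?(ltW t0)//.
have -> : k.+1%:R = h^-1 by rewrite /h invrK.
rewrite mulNr.
apply: le_trans; rewrite le_eqVlt; apply/orP; left; apply/eqP; apply: eq_Rintegral => x _.
by rewrite /Ek /Yk /= -/h ht /h invrK.
Qed.

Lemma entropy_inequality :
  \int[mutx]_(p in Q) (E p.1 * (\sum_(j <- indices) fj j p * gj j p) + Y p) <= Phi 0 - Phi T.
Proof.
have L1 := cvg_mean_difference continuous_Phi T0.
rewrite !max_l ?(ltW T0)// in L1.
apply: (fatou_average (s := indices) mO Ooo f2 g2 mEk _ mYk mY Ek1 _ YkC YC cvg_Ek cvg_Yk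
  step_integral).
- exact: measurable_funTS mE.
- by move=> p Qp; rewrite ger0_norm// E_le1// Q_ge0.
- by rewrite -opprB; exact: (cvgN L1).
Qed.
Let lap (t : R) x := \sum_i grad (fun y => grad (W t) y ord0 i) x ord0 i.

(** Write [E * Dv] as [(E * Dv - grad W) + grad W]. The first part, paired with [bco], is [gG']
    times a square; the second is integrated by parts with [green_H10] and yields the Laplacian of
    [W] tested with [psi]. What is left is [psi] times the supersolution inequality. *)
Lemma supersolution_step (t : R) : 0 < t < T -> H10 Omega (v t) (Dv t) ->
  mu.-integrable Omega (EFin \o (fun x => source alpha beta lambda v (t, x))) ->
  0 <= \int[mu]_(x in Omega) (E t * (\sum_(j <- indices) fj j (t, x) * gj j (t, x)) + Y (t, x)).
Proof.
move=> t0T tH iF; have /andP[t0 tT] := t0T.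
have [_ D2 _] := tH.
have [C C0 [G'C _ _]] := @gG_bounds R.
have mzt : measurable_fun Omega (z t) by have [] := z2 (ltW t0).
have mpsit : measurable_fun Omega (fun x => psi (t, x)).
  exact: (measurableT_comp (continuous_measurable_fun (@continuous_gG R)) mzt).
have psi2 : L2 mu Omega (fun x => psi (t, x)).
  exact: (@L2_bd _ _ _ _ _ mO _ 1 Ooo mpsit (fun x _ => normr_psi (t, x))).
have gW2 i : L2 mu Omega (fun x => grad (W t) x ord0 i).
  exact: (smooth_L2 (smooth_grad i (sW t)) oO bO).
have ggW2 i : L2 mu Omega (fun x => grad (fun y => grad (W t) y ord0 i) x ord0 i).
  exact: (smooth_L2 (smooth_grad i (smooth_grad i (sW t))) oO bO).
have d2 i : L2 mu Omega (fun x => E t * Dv t x ord0 i - grad (W t) x ord0 i).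
  exact: (L2B mO (L2Z mO (E t) (D2 i)) (gW2 i)).
have b2 i : L2 mu Omega (fun x => bco i (t, x)).
  apply: (@L2_Mbd _ _ _ _ _ mO _ _ C (d2 i)) => //.
  exact: (measurableT_comp (continuous_measurable_fun (@continuous_gG' R)) mzt).
have iB i := integrable_L2M mO (d2 i) (b2 i).
have iG i := integrable_L2M mO (gW2 i) (b2 i).
have iH i := integrable_L2M mO (ggW2 i) psi2.
have iF' := integrable_Mbd mO iF mpsit (fun x _ => normr_psi (t, x)).
have lap2 := L2_sum mO (index_enum _) ggW2.
have Wt2 : L2 mu Omega (Wt t).
  apply: (@L2_bd _ _ _ _ _ mO _ L) => //.
  exact: measurable_funTS (measurableT_comp mWt (measurable_pair1 t)).
have y2 : L2 mu Omega (fun x => Wt t x - lap t x + K * (E t * v t x)).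
  by apply: (L2D mO); [exact: (L2B mO Wt2 lap2)|exact: (L2Z mO K (L2Z mO _ (v2 (ltW t0))))].
have iX2 := integrableRB mO (integrable_L2M mO psi2 y2) (integrableRZ mO (E t) iF').
have iGH i := integrableRD mO (iG i) (iH i).
have iBGH i := integrableRD mO (iB i) (iGH i).
(* The Laplacian is subtracted in the first group and added again in the sum, where together with
   the terms in [grad W] it integrates to 0. *)
have -> : \int[mu]_(x in Omega)
    (E t * (\sum_(j <- indices) fj j (t, x) * gj j (t, x)) + Y (t, x)) =
  \int[mu]_(x in Omega) (psi (t, x) * (Wt t x - lap t x + K * (E t * v t x)) -
      E t * (psi (t, x) * source alpha beta lambda v (t, x)) +
    \sum_i ((E t * Dv t x ord0 i - grad (W t) x ord0 i) * bco i (t, x) +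
      (grad (W t) x ord0 i * bco i (t, x) +
       grad (fun y => grad (W t) y ord0 i) x ord0 i * psi (t, x)))).
  apply: eq_Rintegral => x _; rewrite sum_indices big_split/= big_split/= -mulr_suml -/(lap t x).
  have -> : \sum_i (E t * Dv t x ord0 i - grad (W t) x ord0 i) * bco i (t, x) =
      E t * (\sum_i Dv t x ord0 i * bco i (t, x)) - \sum_i grad (W t) x ord0 i * bco i (t, x).
    rewrite mulr_sumr -sumrB; apply: eq_bigr => i _; ring.
  rewrite /Y /Dv_coord /=; ring.
rewrite (RintegralD mO iX2 (integrableRsum mO _ iBGH)) (Rintegral_sum mO _ iBGH).
apply: addr_ge0.
  rewrite -[leLHS](_ : \int[mu]_(x in Omega) (0 : R) = 0); last by rewrite Rintegral_cst// mul0r.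
  apply: (le_Rintegral_ae mO _ iX2).
    by apply: (@integrable_bd _ _ _ _ _ mO _ 0) => // x _; rewrite normr0.
  apply: filterS (v_ge0 (ltW t0)) => x vx Ox; have {}vx := vx Ox.
  have -> : psi (t, x) * (Wt t x - lap t x + K * (E t * v t x)) -
      E t * (psi (t, x) * source alpha beta lambda v (t, x)) =
    psi (t, x) * (Wt t x - lap t x + K * (E t * v t x) - E t * reaction alpha beta lambda (v t x)).
    by rewrite /source /=; ring.
  (* The supersolution inequality is available only where [E * v] exceeds [W]; elsewhere [psi]
     vanishes. *)
  have [z0|z0] := leP (z t x) 0; first by rewrite /psi /= gG_le0// mul0r.
  apply: mulr_ge0; first by have /andP[] := psi01 (t, x).
  by apply: supersolution => //; rewrite -subr_gt0.
apply: sumr_ge0 => i _; rewrite (RintegralD mO (iB i) (iGH i)) (RintegralD mO (iG i) (iH i)).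
rewrite (green_H10 oO bO tH (E_ge0 t) (sW t) (W_ge0 t)) addNr addr0.
apply: Rintegral_ge0 => x _; rewrite /bco /= mulrCA -expr2.
by rewrite mulr_ge0 ?sqr_ge0// gG'_ge0.
Qed.

Lemma comparison : {ae mu, forall x, Omega x -> v 0 x <= W 0 x} ->
  {ae mu, forall x, Omega x -> expR (- (K * T)) * v T x <= W T x}.
Proof.
move=> v0W; have P0 : Phi 0 = 0.
  transitivity (\int[mu]_(x in Omega) (0 : R)); last by rewrite Rintegral_cst// mul0r.
  have i0 := integrable_gJ (lexx 0).
  apply: (eq_Rintegral_ae mO) => //; first by apply/measurable_EFinP; exact: measurable_int i0.
  apply: filterS v0W => x vW Ox; apply: gJ_le0.
  by rewrite /z /E mulr0 oppr0 expR0 mul1r subr_le0 vW.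
have mEQ : measurable_fun Q (fun p => E p.1) by exact: measurable_funTS mE.
have E1 p : Q p -> `|E p.1| <= 1 by move=> Qp; rewrite ger0_norm// E_le1// Q_ge0.
have iS := integrableRsum mQ indices (fun j => integrable_L2M mQ (f2 j) (g2 j)).
have iR := integrableRD mQ (integrable_Mbd mQ iS mEQ E1) (integrable_ae_bd mQ Qlty mY YC).
have PT : Phi T <= 0.
  rewrite -subr_ge0 sub0r -[leRHS]add0r -{2}P0; apply: le_trans entropy_inequality.
  rewrite (Rintegral_sect1 mI mO iR).
  rewrite -[leLHS](_ : \int[mu1]_(t in `]0, T[) (0 : R) = 0); last by rewrite Rintegral_cst// mul0r.
  apply: (le_Rintegral_ae mI _ (integrable_sect1 mI mO iR)).
    by apply: (@integrable_bd _ _ _ _ _ mI _ 0) => //; [exact: lebesgue_oo_lty|move=> x _; rewrite normr0].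
  have iF := ae_integrable_sect1 mI mO (integrable_L2 mQ Qlty (f2 None)).
  apply: (@filterS2 _ _ (ae_filter_ringOfSetsType mu1) _ _ _ _ vH iF) => t tH tF tI.
  have t0T : 0 < t < T by move: tI; rewrite /= in_itv.
  by apply: supersolution_step => //; [apply: tH; case/andP: t0T|exact: tF].
have iT := integrable_gJ (ltW T0).
have JT : (\int[mu]_(x in Omega) `|(gJ (z T x))%:E| = 0)%E.
  under eq_integral do rewrite gee0_abs ?lee_fin ?gJ_ge0//.
  rewrite -(fineK (integrable_fin_num mO iT)); congr EFin; apply/eqP; rewrite eq_le PT/=.
  by apply: Rintegral_ge0 => x _; exact: gJ_ge0.
have := (ae_eq_integral_abs mu mO (measurable_int _ iT)).1 JT.
apply: filterS => x H Ox; have [] := H Ox => /gJ_eq0.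
by rewrite /z subr_le0.
Qed.
End comparison.

(** * The barrier *)

Section barrier.
Context {R : realType} {n : nat}.
Variables (x0 : 'rV[R]_n) (p A kap r2 : R).
Hypotheses (p0 : 0 < p) (A0 : 0 <= A).
Local Notation P1 := (fexp_next p 1).
Local Notation P2 := (fexp_next p P1).

Definition sqdist (x : 'rV[R]_n) : R := \sum_i (x ord0 i - x0 ord0 i) ^+ 2.
(** The zero set is a sphere about [x0] whose squared radius [r2 - kap * t] decreases linearly; the
    barrier vanishes inside it. *)
Definition level t x := sqdist x - r2 + kap * t.
Definition barrier t x := A * fexp p 1 (level t x).
Definition barrier_t t x := kap * (A * fexp p P1 (level t x)).

Lemma is_derive_sqdist x i : is_derive x (delta_mx ord0 i) sqdist (2 * (x ord0 i - x0 ord0 i)).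
Proof.
have H j : is_derive x (delta_mx ord0 i) (fun y : 'rV[R]_n => (y ord0 j - x0 ord0 j) ^+ 2)
    (if j == i then 2 * (x ord0 i - x0 ord0 i) else 0).
  have dj : is_derive x (delta_mx ord0 i) (fun y : 'rV[R]_n => y ord0 j - x0 ord0 j) (j == i)%:R.
    have := is_deriveB (is_derive_coord x (delta_mx ord0 i) j)
      (is_derive_cst (x0 ord0 j) x (delta_mx ord0 i)).
    by rewrite subr0 mxE eqxx.
  rewrite (_ : (fun y => _) = (fun y : 'rV[R]_n => (y ord0 j - x0 ord0 j) * (y ord0 j - x0 ord0 j)));
    last by apply/funext => y; rewrite expr2.
  have := is_deriveM dj dj; congr is_derive.
  by case: eqP => [->|_]; rewrite ?scaler0 ?addr0// /GRing.scale /=; ring.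
have := @is_derive_sum _ _ _ n (fun j (y : 'rV[R]_n) => (y ord0 j - x0 ord0 j) ^+ 2) x
  (delta_mx ord0 i) _ H.
rewrite -big_mkcond big_pred1_eq; congr is_derive.
by apply/funext => y; rewrite fct_sumE.
Qed.

Lemma smooth_sqdist : smooth sqdist.
Proof.
move=> k; apply: Ck_sum => i.
rewrite (_ : (fun x => _) = fun x : 'rV[R]_n => (x ord0 i - x0 ord0 i) * (x ord0 i - x0 ord0 i));
  last by apply/funext => x; rewrite expr2.
by apply: CkM; apply: CkD; (try exact: Ck_coord); exact: Ck_cst.
Qed.

Lemma smooth_level t : smooth (level t).
Proof.
move=> k; apply: CkD; last exact: Ck_cst.
by apply: CkD; [exact: smooth_sqdist|exact: Ck_cst].
Qed.

Lemma is_derive_level t x i :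
  is_derive x (delta_mx ord0 i) (level t) (2 * (x ord0 i - x0 ord0 i)).
Proof.
have := is_deriveD (is_deriveB (is_derive_sqdist x i) (is_derive_cst r2 x (delta_mx ord0 i)))
  (is_derive_cst (kap * t) x (delta_mx ord0 i)).
by rewrite subr0 addr0.
Qed.

Lemma smooth_barrier t : smooth (barrier t).
Proof.
move=> k; apply: CkM; first exact: Ck_cst.
exact: (smooth_fexp_comp 1 p0 (smooth_level t)).
Qed.

Lemma barrier_ge0 t x : 0 <= barrier t x.
Proof.
by rewrite mulr_ge0// /fexp; case: ifP => // _; rewrite hornerC mul1r expR_ge0.
Qed.

Lemma is_derive_level_fexp P t x i : is_derive x (delta_mx ord0 i)
  (fun y => A * fexp p P (level t y))
  (A * fexp p (fexp_next p P) (level t x) * (2 * (x ord0 i - x0 ord0 i))).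
Proof.
have := is_deriveZ A (is_derive_comp (is_derive_fexp P (level t x) p0) (is_derive_level t x i)).
by rewrite /GRing.scale /= mulrA.
Qed.

Lemma grad_barrier t x i :
  grad (barrier t) x ord0 i = A * fexp p P1 (level t x) * (2 * (x ord0 i - x0 ord0 i)).
Proof. by rewrite mxE; have [_ ->] := is_derive_level_fexp 1 t x i. Qed.

Lemma grad2_barrier t x i :
  grad (fun y => grad (barrier t) y ord0 i) x ord0 i =
  4 * (x ord0 i - x0 ord0 i) ^+ 2 * (A * fexp p P2 (level t x)) +
  2 * (A * fexp p P1 (level t x)).
Proof.
rewrite (_ : (fun y => _) = fun y => A * fexp p P1 (level t y) * (2 * (y ord0 i - x0 ord0 i)));
  last by apply/funext => y; exact: grad_barrier.
rewrite mxE.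
have dl : is_derive x (delta_mx ord0 i) (fun y : 'rV[R]_n => 2 * (y ord0 i - x0 ord0 i)) 2.
  have := is_deriveZ 2 (is_deriveB (is_derive_coord x (delta_mx ord0 i) i)
    (is_derive_cst (x0 ord0 i) x (delta_mx ord0 i))).
  by rewrite subr0 mxE !eqxx /GRing.scale /= mulr1.
have [_ ->] := is_deriveM (is_derive_level_fexp P1 t x i) dl.
by rewrite /GRing.scale /=; ring.
Qed.

Lemma laplacian_barrier t x :
  \sum_i grad (fun y => grad (barrier t) y ord0 i) x ord0 i =
  4 * sqdist x * (A * fexp p P2 (level t x)) + 2 * n%:R * (A * fexp p P1 (level t x)).
Proof.
under eq_bigr do rewrite grad2_barrier.
rewrite big_split/= -mulr_suml -mulr_sumr; congr (_ + _).
by rewrite sumr_const card_ord -[LHS]mulr_natr; ring.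
Qed.

Lemma is_derive_barrier_t (t : R) x : is_derive t 1 (fun s : R => barrier s x) (barrier_t t x).
Proof.
have dl : is_derive t 1 (fun s : R => level s x) kap.
  have := @is_derive_affine R (sqdist x - r2) kap 0 t.
  by congr is_derive; apply/funext => s; rewrite subr0.
have df := is_derive_fexp 1 (level t x) p0.
have := is_deriveZ A (is_derive_comp (F := fun s : R => level s x) df dl).
by congr is_derive; rewrite /barrier_t /GRing.scale /=; ring.
Qed.

Lemma measurable_level :
  measurable_fun [set: measurableTypeR R * 'rV[R]_n] (fun q => level q.1 q.2).
Proof.
apply: measurable_funD; last by apply: measurable_funM; [exact: measurable_cst|exact: measurable_fst].
apply: measurable_funB; last exact: measurable_cst.
apply: (measurableT_comp (f := sqdist)); last exact: measurable_snd.
exact: smooth_measurable smooth_sqdist.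
Qed.

Lemma measurable_level_fexp P :
  measurable_fun [set: measurableTypeR R * 'rV[R]_n] (fun q => A * fexp p P (level q.1 q.2)).
Proof.
apply: measurable_funM; first exact: measurable_cst.
apply: (measurableT_comp (f := fexp p P)); last exact: measurable_level.
by apply: continuous_measurable_fun; exact: continuous_fexp.
Qed.

Lemma measurable_grad_barrier i :
  measurable_fun [set: measurableTypeR R * 'rV[R]_n] (fun q => grad (barrier q.1) q.2 ord0 i).
Proof.
rewrite (_ : (fun q => _) = fun q : measurableTypeR R * 'rV[R]_n =>
  A * fexp p P1 (level q.1 q.2) * (2 * (q.2 ord0 i - x0 ord0 i))); last first.
  by apply/funext => q; rewrite grad_barrier.
apply: measurable_funM; first exact: measurable_level_fexp.
apply: (measurableT_comp (f := fun x : 'rV[R]_n => 2 * (x ord0 i - x0 ord0 i))); last first.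
  exact: measurable_snd.
apply: measurable_funM; first exact: measurable_cst.
by apply: measurable_funB; [exact: measurable_coord_rV|exact: measurable_cst].
Qed.
End barrier.

(** * Reaction and absorption inequalities *)

Section inequalities.
Context {R : realType}.

Lemma reaction_le (alpha beta lambda : R) : 0 < alpha -> alpha < beta -> beta < 1 -> 0 < lambda ->
  exists2 K, 0 <= K & forall s, 0 <= s ->
    reaction alpha beta lambda s <= K * s - 2^-1 * s `^ alpha.
Proof.
move=> a0 ab b1 l0; have b0 := lt_trans a0 ab.
(* The point where [lambda * s]^ (beta - alpha)[equals]1 / 2[: below it half of the absorption pays
   for the source, above it]s [^ beta] is at most a multiple of [s] because [beta < 1]. *)
pose s0 := (2 * lambda)^-1 `^ (beta - alpha)^-1.
have ba0 : 0 < beta - alpha by rewrite subr_gt0.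
have s00 : 0 < s0 by rewrite powR_gt0// invr_gt0 mulr_gt0.
have s0E : lambda * s0 `^ (beta - alpha) = 2^-1.
  rewrite /s0 -powRrM mulVf ?gt_eqF// powRr1 ?invr_ge0 ?mulr_ge0 ?(ltW l0)//.
  by field; rewrite gt_eqF.
have c0 : 0 < s0 `^ (1 - beta) by rewrite powR_gt0.
exists (lambda / s0 `^ (1 - beta)); first by rewrite divr_ge0// ltW.
move=> s s_ge0; rewrite /reaction !spow_ge0//.
have [->|s_neq0] := eqVneq s 0; first by rewrite !powR0 ?gt_eqF// !mulr0.
have s_gt0 : 0 < s by rewrite lt_neqAle eq_sym s_neq0.
have [ss0|s0s] := leP s s0.
  have -> : s `^ beta = s `^ (beta - alpha) * s `^ alpha.
    by rewrite -powRD ?subrK// s_neq0 implybT.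
  have le1 : lambda * s `^ (beta - alpha) <= 2^-1.
    rewrite -s0E ler_wpM2l ?(ltW l0)// ge0_ler_powR ?nnegrE ?(ltW ba0) ?(ltW s00)//.
  have sa0 : 0 <= s `^ alpha by exact: powR_ge0.
  have Ks : 0 <= lambda / s0 `^ (1 - beta) * s by rewrite mulr_ge0// divr_ge0// ltW.
  have := ler_wpM2r sa0 le1; rewrite -mulrA; lra.
have H : lambda * s `^ beta <= lambda / s0 `^ (1 - beta) * s.
  rewrite -mulrA ler_wpM2l ?(ltW l0)// ler_pdivlMl//.
  have {2}<- : s `^ (1 - beta) * s `^ beta = s.
    by rewrite -powRD ?subrK ?powRr1 ?s_neq0 ?implybT.
  by rewrite ler_wpM2r ?powR_ge0// ge0_ler_powR ?nnegrE ?subr_ge0 ?(ltW b1) ?(ltW s00) ?(ltW s0s).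
have := powR_ge0 s alpha; lra.
Qed.

(* With [y = 1 / g] large, the exponential smallness of the barrier beats the factor [y ^+ 4] coming
   from its second derivatives; this fixes [p] independently of [d]. *)
Lemma barrier_absorption (alpha c D2 M : R) : alpha < 1 -> 0 < c -> 0 <= D2 -> 0 <= M ->
  exists2 p, 0 < p & forall d g, 0 < g -> g < d / 2 ->
    4 * D2 * p ^+ 2 / g ^+ 4 * (M * expR (p / d) * expR (- (p / g))) <=
    c * (M * expR (p / d) * expR (- (p / g))) `^ alpha.
Proof.
move=> a1 c0 D20 M0; pose e := 1 - alpha.
have e0 : 0 < e by rewrite subr_gt0.
(* With [y = e * p / (2 * g)], the estimate [expR (- y) <= 4 ^+ 4 / y ^+ 4] cancels [g ^+ 4] and
   leaves [B / p ^+ 2]. It then suffices that [B <= c * p ^+ 2], which the choice of [p] ensures. *)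
pose B := 4 * D2 * (8 ^+ 4 / e ^+ 4) * M `^ e.
have B0 : 0 <= B.
  apply: mulr_ge0; last exact: powR_ge0.
  by rewrite mulr_ge0 ?divr_ge0 ?exprn_ge0 ?(ltW e0)// mulr_ge0.
exists (B / c + 1); first by rewrite ltr_wpDl// divr_ge0// ltW.
set p := B / c + 1 => d g g0 gd.
have p1 : 1 <= p by rewrite lerDr divr_ge0// ltW.
have p0 : 0 < p by apply: lt_le_trans p1.
have Bp : B <= c * p ^+ 2.
  have : B <= c * p by rewrite mulrDr mulrCA divff ?gt_eqF// !mulr1 lerDl ltW.
  by move=> /le_trans; apply; rewrite ler_wpM2l ?(ltW c0)// expr2 ler_peMl// ltW.
set V := M * _ * _.
have V0 : 0 <= V by rewrite !mulr_ge0 ?expR_ge0.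
have [->|Vn0] := eqVneq V 0; first by rewrite mulr0 mulr_ge0 ?powR_ge0// ltW.
have {1}<- : V `^ e * V `^ alpha = V by rewrite -powRD ?Vn0 ?implybT// subrK powRr1.
rewrite mulrA ler_wpM2r ?powR_ge0//.
have Ve : V `^ e <= M `^ e * expR (- (e * p / (2 * g))).
  (* This is where the threshold [d / 2] comes from: for [g < d / 2], one half of the exponent
     [p / g] pays for the factor [expR (p / d)] and the other half remains. *)
  have VM : V <= M * expR (- (p / (2 * g))).
    rewrite /V -mulrA ler_wpM2l// -expRD ler_expR.
    have : p / d <= p / (2 * g).
      have d0 : 0 < d by lra.
      rewrite ler_pM2l// lef_pV2 ?posrE ?mulr_gt0//; lra.
    have -> : p / g = p / (2 * g) + p / (2 * g) by field; rewrite gt_eqF.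
    by lra.
  have -> : expR (- (e * p / (2 * g))) = expR (- (p / (2 * g))) `^ e.
    by rewrite -expRM; congr expR; field; rewrite gt_eqF.
  rewrite -powRM ?expR_ge0// ge0_ler_powR ?nnegrE ?(ltW e0)//.
  by rewrite mulr_ge0 ?expR_ge0.
set y := e * p / (2 * g) in Ve.
have y0 : 0 < y by rewrite divr_gt0 ?mulr_gt0.
have ey : expR (- y) <= 4 ^+ 4 / y ^+ 4.
  rewrite expRN ler_pdivlMr ?exprn_gt0// mulrC ler_pdivrMr ?expR_gt0//.
  exact: exprn_le_expR (ltW y0).
have {}Ve : V `^ e <= M `^ e * (4 ^+ 4 / y ^+ 4).
  by apply: le_trans Ve _; rewrite ler_wpM2l ?powR_ge0.
apply: le_trans (ler_wpM2l _ Ve) _.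
  by rewrite divr_ge0 ?exprn_ge0 ?(ltW g0)// mulr_ge0 ?sqr_ge0// mulr_ge0.
have -> : 4 * D2 * p ^+ 2 / g ^+ 4 * (M `^ e * (4 ^+ 4 / y ^+ 4)) = B / p ^+ 2.
  by rewrite /B /y; field; rewrite !gt_eqF.
by rewrite ler_pdivrMr ?exprn_gt0.
Qed.
End inequalities.

Section supersolution.
Context {R : realType} {n : nat}.
Local Notation mu := (@lebesgue_rV R n).
Local Notation mu1 := (@lebesgue_measure R).
Local Notation mutx := (mu1 \x mu)%E.

Lemma fexp1E (p g : R) : 0 < g -> fexp p 1 g = expR (- (p / g)).
Proof. by move=> g0; rewrite fexp_gt0// hornerC mul1r. Qed.

Lemma fexp_next1E (p : R) : fexp_next p 1 = 'X^2 * p%:P.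
Proof. by rewrite /fexp_next -polyC1 derivC subr0 mulr1. Qed.

Lemma fexp_next2E (p : R) : fexp_next p (fexp_next p 1) =
  p%:P ^+ 2 * 'X^4 - p%:P * 'X^3 *+ 2.
Proof.
rewrite fexp_next1E /fexp_next derivM derivC mulr0 addr0 derivXn /= expr1; ring.
Qed.

(** In [kap], the summand [2 * n%:R] cancels the part of the Laplacian containing the first
    derivative of [fexp]. In its second derivative the term in [1 / g ^+ 3] has the favourable sign,
    and the one in [1 / g ^+ 4] is absorbed by hypothesis when [g < d / 2]. Otherwise
    [1 / g ^+ 2 <= 4 / d ^+ 2], which explains the second summand of [kap]. *)
Lemma barrier_supersolution (x0 : 'rV[R]_n) (alpha c D2 M p d r2 : R) t x :
  0 < p -> 0 < c -> 0 < d -> 0 <= M ->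
  (forall g, 0 < g -> g < d / 2 ->
    4 * D2 * p ^+ 2 / g ^+ 4 * (M * expR (p / d) * expR (- (p / g))) <=
    c * (M * expR (p / d) * expR (- (p / g))) `^ alpha) ->
  sqdist x0 x <= D2 ->
  let A := M * expR (p / d) in let kap := 2 * n%:R + 16 * D2 * p / d ^+ 2 in
  0 <= barrier_t x0 p A kap r2 t x -
       \sum_i grad (fun y => grad (barrier x0 p A kap r2 t) y ord0 i) x ord0 i +
       c * barrier x0 p A kap r2 t x `^ alpha.
Proof.
move=> p0 c0 d0 M0 abs xD /=; set A := M * expR (p / d); set kap := _ + _ / _.
rewrite laplacian_barrier//.
have q0 : 0 <= sqdist x0 x by apply: sumr_ge0 => i _; exact: sqr_ge0.
have D20 := le_trans q0 xD.
have A0 : 0 <= A by rewrite mulr_ge0// expR_ge0.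
rewrite /barrier_t /barrier; set g := level _ _ _ _ _.
have [g0|g0] := leP g 0.
  by rewrite !fexp_le0// !mulr0 addr0 subr0 add0r mulr_ge0 ?powR_ge0// ltW.
pose w := expR (- (p / g)).
have -> : fexp p (fexp_next p 1) g = p / g ^+ 2 * w.
  by rewrite fexp_next1E fexp_gt0// !hornerE /w; field; rewrite gt_eqF.
have -> : fexp p (fexp_next p (fexp_next p 1)) g = (p ^+ 2 / g ^+ 4 - 2 * p / g ^+ 3) * w.
  rewrite fexp_next2E fexp_gt0// hornerD hornerN hornerMn.
  rewrite hornerM !horner_exp hornerM !horner_exp !hornerC !hornerX /w.
  by field; rewrite gt_eqF.
rewrite fexp1E// -/w.
have w0 : 0 <= w by exact: expR_ge0.
have Aw0 : 0 <= A * w by exact: mulr_ge0.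
have c'0 : 0 <= c * (A * w) `^ alpha by rewrite mulr_ge0 ?powR_ge0// ltW.
have -> : kap * (A * (p / g ^+ 2 * w)) -
   (4 * sqdist x0 x * (A * ((p ^+ 2 / g ^+ 4 - 2 * p / g ^+ 3) * w)) +
    2 * n%:R * (A * (p / g ^+ 2 * w))) + c * (A * w) `^ alpha =
  ((16 * D2 * p / d ^+ 2) * (p / g ^+ 2) * (A * w) - 4 * sqdist x0 x * p ^+ 2 / g ^+ 4 * (A * w)
    + c * (A * w) `^ alpha) + 8 * sqdist x0 x * p / g ^+ 3 * (A * w).
  by rewrite /kap; ring.
apply: addr_ge0; last by rewrite !mulr_ge0// ?invr_ge0 ?exprn_ge0// ltW.
have qD : 4 * sqdist x0 x * p ^+ 2 / g ^+ 4 * (A * w) <= 4 * D2 * p ^+ 2 / g ^+ 4 * (A * w).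
  rewrite ler_wpM2r// ler_wpM2r ?invr_ge0 ?exprn_ge0 ?(ltW g0)// ler_wpM2r ?sqr_ge0//.
  by rewrite ler_wpM2l.
have [gd|dg] := ltP g (d / 2).
  have := abs g g0 gd; rewrite -/A -/w => H.
  have : 0 <= (16 * D2 * p / d ^+ 2) * (p / g ^+ 2) * (A * w).
    by rewrite !mulr_ge0// ?invr_ge0 ?exprn_ge0// ltW.
  lra.
have : 4 * D2 * p ^+ 2 / g ^+ 4 * (A * w) <= (16 * D2 * p / d ^+ 2) * (p / g ^+ 2) * (A * w).
  rewrite ler_wpM2r//.
  have -> : 4 * D2 * p ^+ 2 / g ^+ 4 = 4 * D2 * p ^+ 2 / g ^+ 2 * (g ^+ 2)^-1.
    by field; rewrite gt_eqF.
  have -> : 16 * D2 * p / d ^+ 2 * (p / g ^+ 2) = 4 * D2 * p ^+ 2 / g ^+ 2 * (2 ^+ 2 / d ^+ 2).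
    by field; rewrite !gt_eqF.
  rewrite ler_wpM2l//.
    by rewrite !mulr_ge0// ?invr_ge0 ?exprn_ge0// ltW.
  rewrite -expr_div_n -exprVn lerXn2r ?nnegrE ?invr_ge0 ?divr_ge0 ?(ltW g0) ?(ltW d0)//.
  by rewrite invf_ple ?posrE ?divr_gt0// invf_div.
lra.
Qed.
End supersolution.

(** * Vanishing of the solution on smaller balls *)

Section vanishing.
Context {R : realType} {n : nat}.
Local Notation mu := (@lebesgue_rV R n).
Local Notation mu1 := (@lebesgue_measure R).
Local Notation mutx := (mu1 \x mu)%E.
Implicit Types (Omega : set 'rV[R]_n) (x : 'rV[R]_n).

Lemma enorm_sqr x0 x : enorm (x - x0) ^+ 2 = sqdist x0 x.
Proof.
rewrite /enorm sqr_sqrtr; last by apply: sumr_ge0 => i _; rewrite -expr2 sqr_ge0.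
by apply: eq_bigr => i _; rewrite !mxE expr2.
Qed.

Lemma eballE x0 r x : 0 <= r -> eball x0 r x <-> sqdist x0 x < r ^+ 2.
Proof.
move=> r0; rewrite -enorm_sqr /eball /= ltr_pXn2r// nnegrE//.
exact: sqrtr_ge0.
Qed.

(** Non-negativity is given at each time for almost every [x], the bound at almost every point of
    the cylinder; sections join the two because the set where [v] is negative is measurable. *)
Lemma nonnegative_bounded Omega (v : R -> 'rV[R]_n -> R) (M : R) : open Omega ->
  measurable_fun (cylinder `]0, +oo[ Omega) (fun p => v p.1 p.2) ->
  {ae mutx, forall p, cylinder `]0, +oo[ Omega p -> `|v p.1 p.2| <= M} ->
  nonnegative_solution Omega v ->
  {ae mutx, forall p, cylinder `]0, +oo[ Omega p -> 0 <= v p.1 p.2 <= M}.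
Proof.
move=> oO vm vM v0; have mO := open_measurable_rV oO.
pose C := cylinder `]0, +oo[ Omega.
have mC : measurable C.
  by apply: (@measurableX _ _ (measurableTypeR R) 'rV[R]_n `]0, +oo[%classic Omega).
have H : {ae mutx, forall p, C p -> 0 <= v p.1 p.2}.
  apply: ae_of_sect1.
    rewrite (_ : [set p | _] = C `&` (fun p => v p.1 p.2) @^-1` `]-oo, 0[%classic).
      by apply: vm => //; exact: measurable_itv.
    apply/seteqP; split => p /=.
      by move=> /not_implyP[Cp /negP]; rewrite -ltNge in_itv.
    by rewrite in_itv/= => -[Cp vp]; apply/not_implyP; split => //; apply/negP; rewrite -ltNge.
  apply: aeW => s; have [s0|s0] := ltP 0 s.
    by apply: filterS (v0 s (ltW s0)) => x vx [_ Ox]; exact: vx.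
  by apply: aeW => x [/=]; rewrite in_itv/= andbT ltNge s0.
apply: filterS2 H vM => p H1 H2 Cp; rewrite H1//=; exact: le_trans (ler_norm _) (H2 Cp).
Qed.

Lemma normr_le_sqr (a b : R) : a ^+ 2 <= b -> `|a| <= b + 1.
Proof.
rewrite -real_normK ?num_real// => ab; have := sqr_ge0 (`|a| - 1).
have -> : (`|a| - 1) ^+ 2 = `|a| ^+ 2 - 2 * `|a| + 1 by ring.
by have := normr_ge0 a; lra.
Qed.

Lemma level_speed (a b q p m t : R) : 0 <= b -> b < a -> 0 <= q -> 0 <= p -> 0 <= m -> 0 < t ->
  t * (8 * (m * a ^+ 2 + 16 * q * p) + 1) <= (a - b) ^+ 3 ->
  (m + 16 * q * p / ((a - b) / 2) ^+ 2) * t <= (a - b) / 2.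
Proof.
move=> b0 ba q0 p0 m0 t0; set d := (a - b) / 2.
have d0 : 0 < d by rewrite divr_gt0// subr_gt0.
have -> : a - b = 2 * d by rewrite /d; field.
have da : d <= a by rewrite /d; lra.
move: d0 da; clearbody d => d0 da tC.
have d2 : 0 < d ^+ 2 by rewrite exprn_gt0.
have dr : d ^+ 2 <= a ^+ 2 by rewrite lerXn2r// nnegrE ltW// (lt_le_trans d0).
have md := ler_wpM2l (ltW t0) (ler_wpM2l m0 dr).
rewrite -(ler_pM2r d2).
have -> : (m + 16 * q * p / d ^+ 2) * t * d ^+ 2 = t * (m * d ^+ 2) + t * (16 * q * p).
  by field; rewrite gt_eqF.
have -> : d * d ^+ 2 = d ^+ 3 by rewrite -exprS.
move: tC; rewrite exprMn (_ : 2 ^+ 3 = 8 :> R); last by ring.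
rewrite mulrDr mulr1 mulrCA mulrDr; lra.
Qed.

Lemma vanishing Omega (alpha beta lambda : R) v0 v x0 (rho0 M : R) :
  open Omega -> bounded_set Omega -> 0 < alpha -> alpha < beta -> beta < 1 -> 0 < lambda ->
  parabolic_weak_solution Omega alpha beta lambda v0 v -> nonnegative_solution Omega v ->
  (forall x, Omega x -> v0 x <= M) -> 0 < rho0 ->
  {ae mu, forall x, Omega x -> eball x0 rho0 x -> v0 x = 0} ->
  exists2 C : R, 0 < C & forall rho t : R, 0 <= rho -> rho < rho0 -> 0 < t -> t <= 1 ->
    t * C <= (rho0 ^+ 2 - rho ^+ 2) ^+ 3 ->
    {ae mu, forall x, Omega x -> eball x0 rho x -> v t x = 0}.
Proof.
move=> oO bO alpha0 ab beta1 lambda0 pws v_ge0 v0M rho00 v00.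
have beta0 := lt_trans alpha0 ab.
have [K K0 reactK] := reaction_le alpha0 ab beta1 lambda0.
have [D2 D20 qD] := smooth_bounded (smooth_sqdist x0) bO.
pose M1 := `|M| + 1.
have M10 : 0 <= M1 by rewrite addr_ge0.
(* Half of the absorption, weakened by [expR (- (K * s))], which is at least [expR (- K)] as only
   times up to 1 occur. *)
pose c := 2^-1 * expR (- K).
have c0 : 0 < c by rewrite mulr_gt0 ?expR_gt0.
have [p p0 absorb] := barrier_absorption (lt_trans ab beta1) c0 D20 M10.
exists (8 * (2 * n%:R * rho0 ^+ 4 + 16 * D2 * p) + 1).
  by rewrite ltr_wpDl// mulr_ge0// addr_ge0 ?mulr_ge0 ?exprn_ge0 ?(ltW p0) ?(ltW rho00).
move=> rho t rho_ge0 rho_lt t0 t1 tC.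
(* Half of the gap between the squared radii, so that [rho0 ^+ 2 - d = rho ^+ 2 + d]. The outer half
   separates the initial sphere of the barrier from that of radius [rho0]; the inner half is what
   the sphere may lose up to time [t]. *)
pose d := (rho0 ^+ 2 - rho ^+ 2) / 2.
have d0 : 0 < d by rewrite divr_gt0// subr_gt0 ltr_pXn2r ?nnegrE ?(ltW rho00).
pose kap := 2 * n%:R + 16 * D2 * p / d ^+ 2.
have kap0 : 0 <= kap.
  by rewrite addr_ge0 ?mulr_ge0 ?invr_ge0 ?exprn_ge0 ?(ltW p0) ?(ltW d0).
have kapt : kap * t <= d.
  apply: level_speed => //; first exact: sqr_ge0.
  - by rewrite ltr_pXn2r// nnegrE ltW.
  - exact: ltW.
  - by rewrite -exprM.
clear tC.
pose A := M1 * expR (p / d).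
have A0 : 0 <= A by rewrite mulr_ge0 ?expR_ge0.
pose r2 := rho0 ^+ 2 - d.
pose W := barrier x0 p A kap r2.
have [Cb Cb0 fexpC] := fexp_bounded (fexp_next p 1) p0.
(* The first summand bounds the time derivative of the barrier and the second its gradient, where a
   coordinate is bounded through [|a| <= a ^+ 2 + 1]. *)
pose L := kap * (A * Cb) + A * Cb * (2 * (D2 + 1)).
have ACb0 : 0 <= A * Cb by exact: mulr_ge0.
have L1 : 0 <= kap * (A * Cb) by exact: mulr_ge0.
have L2' : 0 <= A * Cb * (2 * (D2 + 1)) by rewrite mulr_ge0// mulr_ge0// addr_ge0.
have L0 : 0 <= L by exact: addr_ge0.
have [Mv vM] := pws_bounded pws.
have [Dv [Dv2 vH veq]] := pws_equation pws.
have vb := nonnegative_bounded oO (pws_measurable pws) vM v_ge0.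
have WtL s x : `|barrier_t x0 p A kap r2 s x| <= kap * (A * Cb).
  rewrite /barrier_t normrM (ger0_norm kap0) ler_wpM2l//.
  by rewrite normrM (ger0_norm A0) ler_wpM2l.
have WtL' s x : `|barrier_t x0 p A kap r2 s x| <= L.
  by rewrite (le_trans (WtL s x))// lerDl.
have gWL i s x : 0 < s < t -> Omega x -> `|grad (W s) x ord0 i| <= L.
  move=> _ Ox; rewrite grad_barrier// normrM [`|A * _|]normrM (ger0_norm A0).
  apply: (@le_trans _ _ (A * Cb * (2 * (D2 + 1)))); last by rewrite lerDr.
  apply: ler_pM => //; first by rewrite mulr_ge0.
    by rewrite ler_wpM2l.
  rewrite normrM ger0_norm// ler_wpM2l//.
  have q0 : (x ord0 i - x0 ord0 i) ^+ 2 <= D2.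
    apply: le_trans (qD x Ox); rewrite ger0_norm; last by apply: sumr_ge0 => j _; exact: sqr_ge0.
    by rewrite /sqdist (bigD1 i)//= lerDl; apply: sumr_ge0 => j _; exact: sqr_ge0.
  exact: normr_le_sqr.
have Wlip s s' x : `|W s x - W s' x| <= L * `|s - s'|.
  apply: (@le_trans _ _ (kap * (A * Cb) * `|s - s'|)); last by rewrite ler_wpM2r// lerDl.
  exact: (lipschitz_derive (fun y => is_derive_barrier_t x0 A kap r2 p0 y x) (WtL^~ x)).
have super s x r : 0 < s < t -> Omega x -> 0 <= r -> W s x < expR (- (K * s)) * r ->
    0 <= barrier_t x0 p A kap r2 s x - \sum_i grad (fun y => grad (W s) y ord0 i) x ord0 i
       + K * (expR (- (K * s)) * r) - expR (- (K * s)) * reaction alpha beta lambda r.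
  move=> /andP[s0 st] Ox r0 Wr.
  have sup : 0 <= barrier_t x0 p A kap r2 s x -
      \sum_i grad (fun y => grad (W s) y ord0 i) x ord0 i + c * W s x `^ alpha
    := @barrier_supersolution R n x0 alpha c D2 M1 p d r2 s x p0 c0 d0 M10
    (absorb d) (le_trans (ler_norm _) (qD x Ox)).
  set E := expR _ in Wr *; have E0 : 0 <= E by exact: expR_ge0.
  have E1 : E <= 1 by rewrite -expR0 ler_expR oppr_le0 mulr_ge0// ltW.
  have EK : expR (- K) <= E.
    by rewrite ler_expR lerN2 ler_piMr// (le_trans (ltW st)).
  have Wr' : W s x <= r by rewrite (le_trans (ltW Wr))// ler_piMl.
  have W0 : 0 <= W s x by exact: barrier_ge0.
  have Wa : c * W s x `^ alpha <= E * (2^-1 * r `^ alpha).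
    rewrite /c -mulrA [leRHS]mulrCA ler_wpM2l// ler_pM ?expR_ge0 ?powR_ge0//.
    by rewrite ge0_ler_powR ?nnegrE ?(ltW alpha0).
  have rK : E * reaction alpha beta lambda r <= K * (E * r) - E * (2^-1 * r `^ alpha).
    by rewrite mulrCA -mulrBr ler_wpM2l// reactK.
  rewrite -addrA; apply: le_trans sup _; rewrite lerD2l (le_trans Wa)//.
  by rewrite lerBrDr -lerBrDl.
have v0W : {ae mu, forall x, Omega x -> v 0 x <= W 0 x}.
  apply: filterS2 (pws_initial pws) v00 => x v0x vx Ox; rewrite v0x//.
  have [xB|xB] := pselect (eball x0 rho0 x); first by rewrite vx//; exact: barrier_ge0.
  (* Outside the ball of radius [rho0] the initial level is at least [d], where the factor
     [expR (p / d)] brings the barrier up to [M1], hence above [v0]. *)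
  have dg : d <= level x0 kap r2 0 x.
    rewrite /level /r2 mulr0 addr0 opprB addrCA lerDl subr_ge0 leNgt; apply/negP => h.
    by apply: xB; apply/eballE => //; exact: ltW.
  have g0 := lt_le_trans d0 dg.
  rewrite /W /barrier fexp1E// /A -mulrA -expRD.
  rewrite (le_trans (v0M x Ox))// (le_trans (ler_norm _))// (@le_trans _ _ M1) ?lerDl//.
  rewrite ler_peMr// -expR0 ler_expR subr_ge0 ler_pM2l// lef_pV2 ?posrE//.
have := comparison oO bO alpha0 beta0 t0 K0 L0 (pws_measurable pws) vb v_ge0 (pws_L2 pws)
  (pws_continuous pws) (Dv2 t t0) vH veq (smooth_barrier x0 A kap r2 p0)
  (barrier_ge0 x0 p kap r2 A0) (measurable_level_fexp x0 A kap r2 p0 1)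
  (measurable_grad_barrier x0 A kap r2 p0) gWL
  (measurable_funM (measurable_cst kap) (measurable_level_fexp x0 A kap r2 p0 (fexp_next p 1)))
  WtL' Wlip (is_derive_barrier_t x0 A kap r2 p0) super v0W.
apply: filterS2 (v_ge0 t (ltW t0)) => x vx H Ox xB; have {}vx := vx Ox.
have WT : W t x = 0.
  rewrite /W /barrier fexp_le0 ?mulr0// /level /r2.
  have : sqdist x0 x < rho ^+ 2 by apply/eballE.
  have : d = rho0 ^+ 2 - rho ^+ 2 - d by rewrite /d; field.
  by move: kapt; lra.
apply/eqP; rewrite eq_le vx andbT -(ler_pM2l (expR_gt0 (- (K * t)))) mulr0 -WT.
exact: H.
Qed.
End vanishing.

(** * Balls and essential supports *)

Section supports.
Context {R : realType} {n : nat}.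
Local Notation mu := (@lebesgue_rV R n).
Implicit Types (Omega : set 'rV[R]_n) (x : 'rV[R]_n).

Lemma open_eball x0 r : 0 <= r -> open (eball x0 r).
Proof.
move=> r0; have [cq _ _] := smoothP (smooth_sqdist x0).
rewrite (_ : eball x0 r = sqdist x0 @^-1` [set y | y < r ^+ 2]).
  by move/continuousP : cq; apply; exact: open_lt.
by apply/seteqP; split => x /(eballE x0 x r0).
Qed.

Lemma compact_closure_rV Omega : bounded_set Omega -> compact (closure Omega).
Proof.
move=> /bounded_setP_rV[C OC].
have sub : Omega `<=` [set x | forall i, `|x ord0 i| <= C].
  by move=> x Ox i; exact: le_trans (ler_coord_rV _ _) (OC _ Ox).
have cK := @compact_cbox R n C.
have clK := compact_closed (@norm_hausdorff _ _) cK.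
apply: subclosed_compact cK _; first exact: closed_closure.
by rewrite [X in _ `<=` X]((closure_id _).1 clK); exact: closure_subset.
Qed.

Lemma ae_zero_off_essential_support Omega (u : 'rV[R]_n -> R) (A : set 'rV[R]_n) :
  A `<=` ~` essential_support (zero_ext Omega u) ->
  {ae mu, forall x, Omega x -> A x -> u x = 0}.
Proof.
move=> Au; have H : {ae mu, forall x, A x -> zero_ext Omega u x = 0}.
  apply: ae_local => x /Au; rewrite /essential_support /= => /existsNP[U].
  by move=> /not_implyP[oU] /not_implyP[Ux] /contrapT H; exists U.
by apply: filterS H => x Hx Ox /Hx; rewrite /zero_ext patchE mem_set.
Qed.

Lemma off_essential_support (f : 'rV[R]_n -> R) (U : set 'rV[R]_n) : open U ->
  {ae mu, forall x, U x -> f x = 0} -> U `<=` ~` essential_support f.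
Proof. by move=> oU fU x Ux H; exact: H U oU Ux fU. Qed.
End supports.

(** * The shrinking radius *)

Section shrinking_radius.
Context {R : realType}.
Variables (C rho0 : R).
Hypotheses (C0 : 0 < C) (rho00 : 0 < rho0).

(* [rho0 ^+ 2 - rho ^+ 2] has to dominate the cube root of [t / extinction_time]; its fourth root is
   larger on the unit interval and is written with square roots only. *)
Definition extinction_time : R := Num.min 1 (rho0 ^+ 6 / C).
Definition radius (t : R) : R := rho0 * (1 - Num.sqrt (Num.sqrt (t / extinction_time))).

Lemma extinction_time_gt0 : 0 < extinction_time.
Proof. by rewrite lt_min ltr01 divr_gt0// exprn_gt0. Qed.

Let q t := Num.sqrt (Num.sqrt (t / extinction_time)).

Let q_itv t : 0 <= t <= extinction_time -> 0 <= q t <= 1.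
Proof.
move=> /andP[t0 tT]; rewrite sqrtr_ge0 /=.
by rewrite -sqrtr1 ler_sqrt// -sqrtr1 ler_sqrt// ler_pdivrMr ?mul1r// extinction_time_gt0.
Qed.

Lemma continuous_radius : continuous radius.
Proof.
apply: contM; first exact: cont_cst.
apply: contB; first exact: cont_cst.
apply: (cont_comp (f := Num.sqrt)); first exact: sqrt_continuous.
apply: (cont_comp (f := Num.sqrt)); first exact: sqrt_continuous.
by apply: contM; [exact: cont_id|exact: cont_cst].
Qed.

Lemma radius_decreasing s t : 0 <= s -> s < t -> radius t < radius s.
Proof.
move=> s0 st; have T0 := extinction_time_gt0; have t0 := le_lt_trans s0 st.
rewrite ltr_pM2l// ltrD2l ltrN2 ltr_sqrt ?sqrtr_gt0 ?divr_gt0//.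
by rewrite ltr_sqrt ?divr_gt0// ltr_pM2r ?invr_gt0.
Qed.

Lemma radius0 : radius 0 = rho0.
Proof. by rewrite /radius mul0r !sqrtr0 subr0 mulr1. Qed.

Lemma radius_extinction : radius extinction_time = 0.
Proof. by rewrite /radius divff ?gt_eqF ?extinction_time_gt0// !sqrtr1 subrr mulr0. Qed.

Lemma radius_itv t : 0 <= t <= extinction_time -> 0 <= radius t <= rho0.
Proof.
move=> /q_itv/andP[q0 q1]; rewrite /radius -/(q t) mulr_ge0 ?subr_ge0 ?(ltW rho00)//=.
by rewrite ler_piMr ?(ltW rho00)// gerBl.
Qed.

Lemma radius_cube t : 0 <= t <= extinction_time -> t * C <= (rho0 ^+ 2 - radius t ^+ 2) ^+ 3.
Proof.
move=> tT; have /andP[q0 q1] := q_itv tT; have /andP[t0 _] := tT; have T0 := extinction_time_gt0.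
have q4 : q t ^+ 4 = t / extinction_time.
  rewrite (_ : 4 = 2 * 2)%N// exprM !sqr_sqrtr ?sqrtr_ge0// divr_ge0// ltW//.
have tq : t = q t ^+ 4 * extinction_time by rewrite q4 divfK// gt_eqF.
have -> : rho0 ^+ 2 - radius t ^+ 2 = rho0 ^+ 2 * (q t * (2 - q t)).
  by rewrite /radius -/(q t); ring.
rewrite exprMn -exprM {1}tq -mulrA.
have TC : extinction_time * C <= rho0 ^+ 6.
  by rewrite -ler_pdivlMr// ge_min lexx orbT.
rewrite [leRHS]mulrC; apply: ler_pM => //.
- exact: exprn_ge0.
- by rewrite mulr_ge0// ltW.
(* As [0 <= q t <= 1], the fourth power is at most the cube, and [2 - q t] is at least 1. *)
- rewrite (@le_trans _ _ (q t ^+ 3))//; first by rewrite exprS ler_piMl// exprn_ge0.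
  rewrite lerXn2r ?nnegrE ?mulr_ge0// ?ler_peMr//; lra.
Qed.
End shrinking_radius.

Theorem theorem7p1 (R : realType) (N : nat) (Omega : set 'rV[R]_N)
  (alpha beta lstar lambda theta rho0 : R)
  (ustar : 'rV[R]_N -> R) (v : R -> 'rV[R]_N -> R) (x0 : 'rV[R]_N) :
  (3 <= N)%N ->
  bounded_domain Omega ->
  C2_boundary Omega ->
  (exists y, strictly_star_shaped Omega y) ->
  0 < alpha -> alpha < beta -> beta < 1 ->
  2 * (1 + alpha) * (1 + beta) - N%:R * (1 - alpha) * (1 - beta) < 0 ->
  critical_value Omega alpha beta lstar ->
  flat_or_compact_support_ground_state Omega alpha beta lstar ustar ->
  lstar < lambda ->
  parabolic_weak_solution Omega alpha beta lambda ustar v ->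
  nonnegative_solution Omega v ->
  0 < theta -> theta `^ (beta - alpha) < 1 / lambda ->
  ~ essential_support (zero_ext Omega ustar) x0 ->
  0 < rho0 ->
  eball x0 rho0 `<=` ~` essential_support (zero_ext Omega ustar) ->
  exists (that : R) (rho : R -> R),
    [/\ 0 < that,
        [/\ {within `[0, that], continuous rho},
            forall s t, 0 <= s -> s < t -> t <= that -> rho t < rho s,
            forall t, 0 <= t <= that -> 0 <= rho t <= rho0,
            rho 0 = rho0 &
            rho that = 0],
        forall t, 0 <= t <= that ->
          eball x0 (rho t) `<=`
            ~` (essential_support (zero_ext Omega (v t)) `&` sublevel Omega v theta t) &
        forall t, 0 <= t <= that ->
          {ae lebesgue_rV N, forall x, eball x0 (rho t) x ->
            zero_ext Omega (v t) x = 0}].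
Proof.
move=> _ [oO _ _ bO] _ _ alpha0 ab beta1 _ [lstar0 _ _] [_ _ [Du [[cu _ _] _]] _ _] ll pws v_ge0.
move=> _ _ _ rho00 ball0.
(* The upper bound on the initial datum comes from its continuity on the compact closure of
   [Omega]. *)
have [M M0 uM] := compact_bounded_fun cu (compact_closure_rV bO).
have u0 := ae_zero_off_essential_support ball0.
have uM' x : Omega x -> ustar x <= M.
  by move=> Ox; apply: le_trans (ler_norm _) (uM x _); exact: subset_closure.
have [C C0 vanish] := vanishing oO bO alpha0 ab beta1 (lt_trans lstar0 ll) pws v_ge0 uM' rho00 u0.
have T0 := extinction_time_gt0 C0 rho00.
have vt0 t : 0 <= t <= extinction_time C rho0 ->
    {ae lebesgue_rV N, forall x, eball x0 (radius C rho0 t) x -> zero_ext Omega (v t) x = 0}.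
  move=> tT; have /andP[t0 tT'] := tT.
  suff : {ae lebesgue_rV N, forall x, Omega x -> eball x0 (radius C rho0 t) x -> v t x = 0}.
    apply: filterS => x H xB; rewrite /zero_ext patchE; case: ifPn => // /set_mem Ox.
    exact: H.
  (* At [t = 0] the radius is still [rho0] and leaves no room for a barrier; there the initial
     condition gives the claim directly. *)
  have [->|tn0] := eqVneq t 0.
    rewrite radius0; apply: filterS2 (pws_initial pws) u0 => x v0 H Ox xB.
    by rewrite v0// H.
  have tgt0 : 0 < t by rewrite lt_neqAle eq_sym tn0.
  have /andP[r0 _] := radius_itv C0 rho00 tT.
  apply: vanish => //.
  - by rewrite -[ltRHS](radius0 C rho0); exact: radius_decreasing.
  - by apply: le_trans tT' _; rewrite ge_min lexx.
  - exact: radius_cube.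
exists (extinction_time C rho0), (radius C rho0); split => //.
- split.
  + by apply: continuous_subspaceT; exact: continuous_radius.
  + by move=> s t s0 st _; exact: radius_decreasing.
  + by move=> t; exact: radius_itv.
  + exact: radius0.
  + exact: radius_extinction.
- move=> t tT x xB [+ _]; apply: off_essential_support xB; last exact: vt0.
  by apply: open_eball; have /andP[] := radius_itv C0 rho00 tT.
Qed.
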